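(* In the mixture regression setting, with the estimators $\hat\lambda_1,\hat\lambda_3$ and under the standing assumptions given in the context, the estimator $\hat\beta=\hat\lambda_3\hat\lambda_1$ of $\beta$ is consistent and asymptotically normal, and as $n\to\infty$ $$\sqrt n(\hat\beta-\beta)=\frac1{\sqrt n}\sum_{i=1}^n\xi_i+o_P(1),$$ where $$\xi_i=\big[\lambda_3 I_m+\lambda_1\{D_{\lambda_1}\lambda_3(\lambda_1)\}^T\big]\varepsilon_i+\lambda_1\{g_3(\lambda_1)\,\mathbf Pw\}^{-1}w_i\{a_3(\lambda_1)f_i^2-a_2(\lambda_1)f_i^1\},$$ $$\varepsilon_i=A(m)\,E(\tilde X_i\tilde X_i^T)^{-1}\tilde X_i\{Y_i-E(Y_i\mid \tilde X_i)\},$$ $$f_i^1=\Big(\eta_i-\frac{\mathbf P(\eta\cdot w)}{\mathbf P w}\Big)\{Y_i^2-E(Y_i^2\mid X_i)\},\qquad f_i^2=\Big(\eta_i^2-\frac{\mathbf P(\eta^2\cdot w)}{\mathbf P w}\Big)\{Y_i^2-E(Y_i^2\mid X_i)\},$$ and $I_m$ is the $m\times m$ identity matrix.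
   Context: Model. Let $Y=PY_1+(1-P)Y_2$, where $P\in\{0,1\}$ with $\Pr(P=1)=p\in(0,1)$, $Y_1$ and $Y_2$ are independent, and $X$ is an $\mathbb R^m$-valued predictor. $P$ is independent of $(X,Y_1,Y_2)$. Assume $E(Y_1\mid X)=\mu_1+\beta^TX$ and $V(Y_1\mid X)=\sigma_1^2$ with $\beta\in\mathbb R^m$, and $Y_2$ is independent of $X$ with finite mean $E(Y_2)=\mu_2$ and variance $V(Y_2)=\sigma_2^2$. No distributional form is assumed. Observed data are i.i.d. copies $(X_i,Y_i)$, $i=1,\dots,n$, of $(X,Y)$. Parameters. $\lambda_1=p\beta\in\mathbb R^m$, $\lambda_2=2\mu_1$, $\lambda_3=p^{-1}$ (so $\beta=\lambda_3\lambda_1$), $\eta_i=\lambda_1^TX_i$ (and $\eta=\lambda_1^TX$). Then $E(Y_i^2\mid X_i)=\tilde\alpha+\lambda_2\eta_i+\lambda_3\eta_i^2$ for a constant $\tilde\alpha$. First-stage estimator. Let $\tilde X_i=(1,X_i^T)^T$, let $\tilde X$ (when used as the design matrix) be the $n\times(m+1)$ matrix with rows $\tilde X_i^T$, let $\mathbf Y=(Y_1,\dots,Y_n)^T$ be the vector of observed responses, and let $A(m)$ be the $m\times(m+1)$ matrix projecting a vector to its last $m$ components. Put $\hat\lambda_1=A(m)(\tilde X^T\tilde X)^{-1}\tilde X^T\mathbf Y$. Second-stage estimator. Let $w:\mathbb R\to[0,\infty)$ be a weight function. For $\ell\in\mathbb R^m$ write $\eta_i(\ell)=\ell^TX_i$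 and $w_i(\ell)=w(\ell^TX_i)$, and for a function $f$ with values $f_i$ let $\mathbb P_n^{w}(f)=\sum_i f_iw_i(\ell)/\sum_i w_i(\ell)$. With $\eta$ standing for $\eta(\ell)$ define $a_1^n(\ell)=\mathbb P_n^w(\eta^4)-\mathbb P_n^w(\eta^2)^2$, $a_2^n(\ell)=\mathbb P_n^w(\eta^3)-\mathbb P_n^w(\eta)\mathbb P_n^w(\eta^2)$, $a_3^n(\ell)=\mathbb P_n^w(\eta^2)-\mathbb P_n^w(\eta)^2$, $b_1^n(\ell)=\mathbb P_n^w(\eta Y^2)-\mathbb P_n^w(\eta)\mathbb P_n^w(Y^2)$, $b_2^n(\ell)=\mathbb P_n^w(\eta^2Y^2)-\mathbb P_n^w(\eta^2)\mathbb P_n^w(Y^2)$, $g_3^n(\ell)=a_1^n(\ell)a_3^n(\ell)-a_2^n(\ell)^2$, $\lambda_3^n(\ell)=\{a_3^n(\ell)b_2^n(\ell)-a_2^n(\ell)b_1^n(\ell)\}/g_3^n(\ell)$. The estimator is $\hat\lambda_3=\lambda_3^n(\hat\lambda_1)$. Limits and notation. $\mathbf Pf=E f(X_i,Y_i)$. The limits in probability $a_j(\ell),b_j(\ell),g_3(\ell),\lambda_3(\ell)$ are obtained by replacing each $\mathbb P_n^w(f)$ above with $\mathbf P(f\cdot w)/\mathbf Pw$, where $\eta=\ell^TX$ and $w=w(\ell^TX)$. $D_{\lambda_1}\lambda_3(\lambda_1)\in\mathbb R^m$ is the gradient (column vector) of $\ell\mapsto\lambda_3(\ell)$ at the true value $\ell=\lambda_1$.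 In the asymptotic expansion $w$, $\eta$, $\mathbf Pw$ etc. are evaluated at the true $\lambda_1$, i.e. $w_i=w(\eta_i)$ with $\eta_i=\lambda_1^TX_i$. Standing assumptions. (i) $w$ is twice continuously differentiable, and $\ell\mapsto w(\ell^TX)$ and its first and second derivatives in $\ell$ are bounded, for all $\ell$ in some open neighbourhood of the true $\lambda_1$, by functions of the data with finite mean. (ii) For each function $f(\eta,Y)\in\{\eta,\eta^2,\eta^3,\eta^4,Y^2,\eta Y^2,\eta^2Y^2\}$, the map $\ell\mapsto f(\ell^TX,Y)w(\ell^TX)$ and its first and second derivatives in $\ell$ are bounded, on an open neighbourhood of the true $\lambda_1$, by functions of the data with finite mean. Moreover, for each of these $f$ and for $f=1$, $E[\{f(\lambda_1^TX,Y)w(\lambda_1^TX)\}^2]<\infty$. (iii) $E(\tilde X_i\tilde X_i^T)$ exists and is invertible, $E\|\tilde X_i\{Y_i-E(Y_i\mid X_i)\}\|^2<\infty$, $\mathbf Pw>0$ and $g_3(\lambda_1)\neq0$ at the true $\lambda_1$. *)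

(* Defs.v *)
From HB Require Import structures.
From mathcomp Require Import all_boot all_order all_algebra.
From mathcomp Require Import all_classical all_reals all_analysis.

Set Implicit Arguments.
Unset Strict Implicit.
Unset Printing Implicit Defensive.

Import Order.TTheory GRing.Theory Num.Theory.
Import numFieldNormedType.Exports.

Local Open Scope classical_set_scope.
Local Open Scope ring_scope.

(* Column vectors of R^m, with their Borel sigma-algebra. *)
Notation rvec R m := (g_sigma_algebraType (@open 'cV[R]_m)).

Definition dotp (R : realType) (m : nat) (u v : 'cV[R]_m) : R :=
  (u^T *m v) 0 0.

Definition basisv (R : realType) (m : nat) (j : 'I_m) : 'cV[R]_m :=
  delta_mx j 0.

Definition gradient (R : realType) (m : nat) (f : 'cV[R]_m -> R)
    (l : 'cV[R]_m) : 'cV[R]_m :=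
  \col_j 'D_(basisv R j) f l.

Section probability.
Context (R : realType) (d : measure_display) (T : measurableType d)
  (P : probability T R).

(* Real-valued expectation; meaningful for integrable Z. *)
Definition mean (Z : T -> R) : R := fine ('E_P[Z])%E.

Definition indep d1 d2 (S1 : measurableType d1) (S2 : measurableType d2)
    (U : T -> S1) (V : T -> S2) : Prop :=
  forall (A : set S1) (B : set S2), measurable A -> measurable B ->
    P (U @^-1` A `&` V @^-1` B) = (P (U @^-1` A) * P (V @^-1` B))%E.

Definition iid_copies d1 (S : measurableType d1) (Zs : nat -> T -> S)
    (Z : T -> S) : Prop :=
  (forall i (A : set S), measurable A -> P (Zs i @^-1` A) = P (Z @^-1` A)) /\
  (forall (s : seq nat) (A : nat -> set S), uniq s ->
    (forall i, measurable (A i)) ->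
    P (\big[setI/setT]_(i <- s) (Zs i @^-1` A i)) =
    (\prod_(i <- s) P (Zs i @^-1` A i))%E).

(* g is a version of E(Z | V), i.e. given the sigma-algebra generated by V. *)
Definition is_condE d1 (S : measurableType d1) (V : T -> S) (Z g : T -> R)
    : Prop :=
  [/\ P.-integrable setT (EFin \o Z),
      P.-integrable setT (EFin \o g),
      measurable_fun [set: g_sigma_algebra_preimageType V] g &
      forall B : set S, measurable B ->
        (\int[P]_(o in V @^-1` B) (g o)%:E =
         \int[P]_(o in V @^-1` B) (Z o)%:E)%E].

(* A chosen version of E(Z | V), almost surely unique for integrable Z. *)
Definition condE d1 (S : measurableType d1) (V : T -> S) (Z : T -> R)
    : T -> R :=
  xget (cst 0) [set g | is_condE V Z g].

Definition is_condV d1 (S : measurableType d1) (V : T -> S) (Z v : T -> R)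
    : Prop :=
  is_condE V (fun o => (Z o - condE V Z o) ^+ 2) v.

Definition cvg_in_prob m (Z : nat -> T -> 'cV[R]_m) (c : 'cV[R]_m) : Prop :=
  forall e : R, 0 < e ->
    (fun n => P [set o | e <= `|Z n o - c|]) @ \oo --> 0%E.

Definition oP1 m (Z : nat -> T -> 'cV[R]_m) : Prop := cvg_in_prob Z 0.

Definition cvg_in_law m (Z : nat -> T -> 'cV[R]_m)
    (nu : probability (rvec R m) R) : Prop :=
  forall f : 'cV[R]_m -> R, continuous f ->
    (exists M : R, forall x, `|f x| <= M) ->
    (fun n => 'E_P[fun o => f (Z n o)]%E) @ \oo --> (\int[nu]_x (f x)%:E)%E.

End probability.

(* N(0, v) on the line. The degenerate case is separate because normal_prob
   is not a Dirac mass when its standard deviation is 0. *)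
Definition normal0 (R : realType) (v : R) (B : set R) : \bar R :=
  if v == 0 then dirac (0 : R) B else normal_prob 0 (Num.sqrt v) B.

(* nu = N(0, Sigma): each linear form t has law N(0, t^T Sigma t). *)
Definition centered_normal (R : realType) (m : nat) (Sigma : 'M[R]_m)
    (nu : probability (rvec R m) R) : Prop :=
  forall (t : 'cV[R]_m) (B : set R), measurable B ->
    nu [set x | B (dotp t x)] = normal0 (dotp t (Sigma *m t)) B.

Definition asymptotically_normal (R : realType) (d : measure_display)
    (T : measurableType d) (P : probability T R) (m : nat)
    (Z : nat -> T -> 'cV[R]_m) (Sigma : 'M[R]_m) : Prop :=
  exists nu : probability (rvec R m) R,
    centered_normal Sigma nu /\ cvg_in_law P Z nu.

(* Quantities built from a weighted averaging functional M, where M f stands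
   for the weighted average of f(eta, Y). *)
Section moment_formulas.
Context (R : realType) (M : (R -> R -> R) -> R).

Definition avg (j k : nat) : R := M (fun eta y => eta ^+ j * y ^+ k).

Definition a1 : R := avg 4 0 - avg 2 0 ^+ 2.
Definition a2 : R := avg 3 0 - avg 1 0 * avg 2 0.
Definition a3 : R := avg 2 0 - avg 1 0 ^+ 2.
Definition b1 : R := avg 1 2 - avg 1 0 * avg 0 2.
Definition b2 : R := avg 2 2 - avg 2 0 * avg 0 2.
Definition g3 : R := a1 * a3 - a2 ^+ 2.
Definition lambda3_of : R := (a3 * b2 - a2 * b1) / g3.

End moment_formulas.

(* Exponents (j, k) of eta^j Y^k for
   eta, eta^2, eta^3, eta^4, Y^2, eta Y^2, eta^2 Y^2. *)
Definition moment_exponents : seq (nat * nat) :=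
  [:: (1, 0); (2, 0); (3, 0); (4, 0); (0, 2); (1, 2); (2, 2)]%N.

Section estimators.
Context (R : realType) (m : nat).

Definition tilde (x : 'cV[R]_m) : 'cV[R]_(1 + m) := col_mx 1%:M x.

Definition Aproj : 'M[R]_(m, 1 + m) := row_mx 0 1%:M.

Definition design (n : nat) (x : nat -> 'cV[R]_m) : 'M[R]_(n, 1 + m) :=
  \matrix_(i < n) (tilde (x i))^T.

Definition response (n : nat) (y : nat -> R) : 'cV[R]_n := \col_(i < n) y i.

(* invmx returns its argument when D^T D is singular. *)
Definition lambda1_hat (n : nat) (x : nat -> 'cV[R]_m) (y : nat -> R)
    : 'cV[R]_m :=
  let D := design n x in
  Aproj *m invmx (D^T *m D) *m D^T *m response n y.

(* Equal to 0 when all the weights vanish. *)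
Definition Pn_w (w : R -> R) (n : nat) (x : nat -> 'cV[R]_m) (y : nat -> R)
    (l : 'cV[R]_m) (f : R -> R -> R) : R :=
  (\sum_(i < n) f (dotp l (x i)) (y i) * w (dotp l (x i))) /
  \sum_(i < n) w (dotp l (x i)).

Definition lambda3_hat (w : R -> R) (n : nat) (x : nat -> 'cV[R]_m)
    (y : nat -> R) : R :=
  lambda3_of (Pn_w w n x y (lambda1_hat n x y)).

Definition beta_hat (w : R -> R) (n : nat) (x : nat -> 'cV[R]_m)
    (y : nat -> R) : 'cV[R]_m :=
  lambda3_hat w n x y *: lambda1_hat n x y.

End estimators.

Section population.
Context (R : realType) (d : measure_display) (T : measurableType d)
  (P : probability T R) (m : nat) (w : R -> R).
Context (X : T -> rvec R m) (Y : T -> R).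

(* P(f.w), for f a function of eta = l^T X and Y *)
Definition Pfw (l : 'cV[R]_m) (f : R -> R -> R) : R :=
  mean P (fun o => f (dotp l (X o)) (Y o) * w (dotp l (X o))).

Definition Pw (l : 'cV[R]_m) : R := mean P (fun o => w (dotp l (X o))).

Definition P_w (l : 'cV[R]_m) (f : R -> R -> R) : R := Pfw l f / Pw l.

Definition lambda3_lim (l : 'cV[R]_m) : R := lambda3_of (P_w l).

Definition Xtilde : T -> rvec R (1 + m) := fun o => tilde (X o).

Definition second_moment : 'M[R]_(1 + m) :=
  \matrix_(j, k) mean P (fun o => (Xtilde o : 'cV_(1 + m)) j 0 *
                                  (Xtilde o : 'cV_(1 + m)) k 0).

(* h(l^T X, Y) and its partial derivatives in l of order 1 and 2 are bounded,
   for l in a neighbourhood of l0, by an integrable function of the data. *)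
Definition locally_dominated (l0 : 'cV[R]_m) (h : R -> R -> R) : Prop :=
  exists (U : set 'cV[R]_m) (G : rvec R m * R -> R),
    [/\ open_nbhs l0 U,
        measurable_fun setT G,
        P.-integrable setT (fun o => (G (X o, Y o))%:E) &
        {ae P, forall o, forall l : 'cV[R]_m, U l ->
          let ho := fun l' : 'cV[R]_m => h (dotp l' (X o)) (Y o) in
          [/\ `|ho l| <= G (X o, Y o),
              forall j, `|'D_(basisv R j) ho l| <= G (X o, Y o) &
              forall j k, `|'D_(basisv R k) ('D_(basisv R j) ho) l|
                          <= G (X o, Y o)]}].

End population.

(* Terms of the expansion for one observation (Xi, Yi); (X, Y) is the generic
   observation that determines the population quantities. *)
Section influence.
Context (R : realType) (d : measure_display) (T : measurableType d)
  (P : probability T R) (m : nat) (w : R -> R).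
Context (X : T -> rvec R m) (Y : T -> R).
Context (lambda1 : 'cV[R]_m) (lambda3 : R).
Context (Xi : T -> rvec R m) (Yi : T -> R).

Let eta (o : T) : R := dotp lambda1 (Xi o).
Let PXY := P_w P w X Y lambda1.

Definition eps_term (o : T) : 'cV[R]_m :=
  Aproj R m *m invmx (second_moment P X) *m
  ((Yi o - condE P (Xtilde Xi) Yi o) *: (Xtilde Xi o : 'cV_(1 + m))).

Definition delta_term (o : T) : R :=
  Yi o ^+ 2 - condE P Xi (fun o' => Yi o' ^+ 2) o.

Definition f1_term (o : T) : R :=
  (eta o - PXY (fun e _ => e)) * delta_term o.

Definition f2_term (o : T) : R :=
  (eta o ^+ 2 - PXY (fun e _ => e ^+ 2)) * delta_term o.

Definition xi_term (o : T) : 'cV[R]_m :=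
  (lambda3%:M + lambda1 *m (gradient (lambda3_lim P w X Y) lambda1)^T)
    *m eps_term o
  + ((g3 PXY * Pw P w X lambda1)^-1 * w (eta o)
     * (a3 PXY * f2_term o - a2 PXY * f1_term o)) *: lambda1.

End influence.

Definition covmx (R : realType) (d : measure_display) (T : measurableType d)
    (P : probability T R) (m : nat) (Z : T -> 'cV[R]_m) : 'M[R]_m :=
  \matrix_(j, k) fine (covariance P (fun o => Z o j 0) (fun o => Z o k 0)).

(* Main.v *)
Require Import Defs.
From HB Require Import structures.
From mathcomp Require Import all_boot all_order all_algebra.
From mathcomp Require Import all_classical all_reals all_analysis.
From mathcomp Require Import measurable_realfun ring lra.
Set Implicit Arguments.
Unset Strict Implicit.
Unset Printing Implicit Defensive.
Import Order.TTheory GRing.Theory Num.Theory.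
Import numFieldNormedType.Exports.
Local Open Scope classical_set_scope.
Local Open Scope ring_scope.

(** This is the delta method for an estimator in two stages.

    Since Y is a mixture, E(Y | X) is affine in eta = lambda1.X and E(Y^2 | X)
    is a quadratic polynomial in eta with leading coefficient 1/p
    ([mixture_condE], [mixture_condE_sqr]). The first fact makes ordinary least
    squares a normalized sum up to a negligible term ([ols_expansion]). The
    second identifies 1/p as the slope of eta^2 in the weighted regression of
    Y^2 on eta and eta^2, which Cramer's rule writes through the moments in
    [lambda3_of] ([lambda3_of_slope]).

    The second stage averages functions of lambda1_hat.X. A Taylor expansion of
    order two, with second derivatives dominated near lambda1, shows that each
    weighted average Q with limit q(lambda1) satisfies
      sqrt n (Q - q(lambda1)) = n^(-1/2) (sum of phi over the observations)
        + grad q(lambda1) . sqrt n (lambda1_hat - lambda1) + o_P(1)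
    ([moment_expansion], [avg_expansion]). Expansions of this form are stable
    under differences, products and inverses with the Leibniz rules for q and
    for phi ([expansionB], [expansionM], [expansionV]); applied to the formula
    for lambda3 they give its influence function, which collapses to the
    residual of Y^2 because the regression of Y^2 is exactly quadratic
    ([lambda3_phiE]). One more product gives the influence function of the
    estimator of beta, once the first-stage expansion replaces lambda1_hat in
    the gradient term ([product_expansion]).

    Asymptotic normality follows from the central limit theorem for vectors
    ([vector_clt]), proved through characteristic functions in the real form
    E cos(a + t.x): they converge for normalized sums ([cos_clt]), they
    determine convergence in law because trigonometric polynomials approximate
    bounded continuous functions on boxes without increasing their bound
    ([trig_approximation], [cvg_in_law_of_cos]), and a law with the limiting
    characteristic function is built from a decomposition of the covariance form into squares
    ([gaussian_exists]).

    Convergence in probability is convergence along a filter on pairs of a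
    sample size and a sample point ([whp]), to which the algebra of limits
    applies directly. *)

(** * Integrable random variables *)

Notation L1 P f := (P.-integrable setT (EFin \o f)).

Section integrable_functions.
Context (R : realType) (d : measure_display) (T : measurableType d)
  (P : probability T R).
Implicit Types (f g h : T -> R) (c M : R).

Lemma L1_measurable f : L1 P f -> measurable_fun setT f.
Proof. by move=> /(measurable_int _)/measurable_EFinP. Qed.

Lemma L1_le f g : measurable_fun setT f -> (forall x, `|f x| <= g x) ->
  L1 P g -> L1 P f.
Proof.
move=> mf fg ig; apply: le_integrable ig => //; first exact/measurable_EFinP.
move=> x _ /=; rewrite lee_fin; apply: le_trans (fg x) _; exact: ler_norm.
Qed.

Lemma L1_cst c : L1 P (fun=> c).
Proof.
exact: (finite_measure_integrable_cst P c measurableT).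
Qed.

Lemma L1_bounded f M : measurable_fun setT f -> (forall x, `|f x| <= M) ->
  L1 P f.
Proof. by move=> mf fM; apply: (L1_le mf fM); exact: L1_cst. Qed.

Lemma L1D f g : L1 P f -> L1 P g -> L1 P (fun x => f x + g x).
Proof. by move=> i1 i2; exact: (integrableD _ i1 i2). Qed.

Lemma L1N f : L1 P f -> L1 P (fun x => - f x).
Proof. by move=> i1; exact: (integrableN i1). Qed.

Lemma L1B f g : L1 P f -> L1 P g -> L1 P (fun x => f x - g x).
Proof. by move=> i1 i2; apply: L1D => //; exact: L1N. Qed.

Lemma L1Z c f : L1 P f -> L1 P (fun x => c * f x).
Proof. by move=> i1; exact: (integrableZl _ c i1). Qed.

Lemma L1_norm f : L1 P f -> L1 P (fun x => `|f x|).
Proof. by move=> i; exact: (integrable_abse i). Qed.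

Lemma L1_sum (I : Type) (s : seq I) (Q : pred I) (F : I -> T -> R) :
  (forall i, Q i -> L1 P (F i)) -> L1 P (fun x => \sum_(i <- s | Q i) F i x).
Proof.
move=> H; elim: s => [|i s IH].
  by under eq_fun do rewrite big_nil; exact: L1_cst.
under eq_fun do rewrite big_cons.
case: (boolP (Q i)) => Qi //; exact: L1D (H _ Qi) IH.
Qed.

Lemma meanE f : mean P f = fine (\int[P]_x (f x)%:E)%E.
Proof. by rewrite /mean unlock. Qed.

Lemma EFin_mean f : L1 P f -> ((mean P f)%:E = \int[P]_x (f x)%:E)%E.
Proof. by move=> i; rewrite meanE fineK// integrable_fin_num. Qed.

Lemma eq_mean f g : f =1 g -> mean P f = mean P g.
Proof. by move=> /funext ->. Qed.

Lemma mean_cst c : mean P (fun=> c) = c.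
Proof. by have := expectation_cst P c; rewrite /mean /cst => ->. Qed.

Lemma meanD f g : L1 P f -> L1 P g ->
  mean P (fun x => f x + g x) = mean P f + mean P g.
Proof.
move=> i1 i2; apply: EFin_inj; rewrite EFinD !EFin_mean//; last exact: L1D.
by rewrite -integralD_EFin.
Qed.

Lemma meanZ c f : L1 P f -> mean P (fun x => c * f x) = c * mean P f.
Proof.
move=> i1; apply: EFin_inj; rewrite EFinM !EFin_mean//; last exact: L1Z.
by rewrite -integralZl.
Qed.

Lemma meanN f : L1 P f -> mean P (fun x => - f x) = - mean P f.
Proof.
by move=> i; under eq_mean do rewrite -mulN1r; rewrite meanZ// mulN1r.
Qed.

Lemma meanB f g : L1 P f -> L1 P g ->
  mean P (fun x => f x - g x) = mean P f - mean P g.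
Proof. by move=> i1 i2; rewrite meanD ?meanN//; exact: L1N. Qed.

Lemma mean_sum (I : Type) (s : seq I) (Q : pred I) (F : I -> T -> R) :
  (forall i, Q i -> L1 P (F i)) ->
  mean P (fun x => \sum_(i <- s | Q i) F i x) = \sum_(i <- s | Q i) mean P (F i).
Proof.
move=> H; elim: s => [|i s IH].
  by under eq_mean do rewrite big_nil; rewrite mean_cst big_nil.
under eq_mean do rewrite big_cons; rewrite big_cons.
case: (boolP (Q i)) => Qi //; rewrite meanD ?IH//; first exact: H.
exact: L1_sum.
Qed.

Lemma mean_ge0 f : (forall x, 0 <= f x) -> 0 <= mean P f.
Proof.
by move=> f0; rewrite meanE fine_ge0// integral_ge0// => x _; rewrite lee_fin.
Qed.

Lemma le_mean f g : L1 P f -> L1 P g -> (forall x, f x <= g x) ->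
  mean P f <= mean P g.
Proof.
move=> i1 i2 fg; rewrite -subr_ge0 -meanB//; apply: mean_ge0 => x.
by rewrite subr_ge0.
Qed.

Lemma norm_mean f : L1 P f -> `|mean P f| <= mean P (fun x => `|f x|).
Proof.
move=> i; rewrite ler_norml -meanN; last exact: L1_norm.
apply/andP; split; apply: le_mean => //; try exact: L1_norm.
- by apply: L1N; exact: L1_norm.
- by move=> x; rewrite lerNl; rewrite -normrN; exact: ler_norm.
- by move=> x; exact: ler_norm.
Qed.

Lemma norm_mean_le f c : L1 P f -> (forall x, `|f x| <= c) -> `|mean P f| <= c.
Proof.
move=> i fc; apply: le_trans (norm_mean i) _.
by rewrite -[leRHS](mean_cst c); apply: le_mean => //; [exact: L1_norm|exact: L1_cst].
Qed.

Lemma mean_indic (A : set T) : measurable A -> (mean P \1_A)%:E = P A.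
Proof.
move=> mA; rewrite /mean expectation_indic// fineK// fin_num_measure//.
Qed.

Lemma L1_indic (A : set T) : measurable A -> L1 P \1_A.
Proof. by move=> mA; exact: integrable_indic. Qed.

Lemma measurable_sqr f : measurable_fun setT f ->
  measurable_fun setT (fun x => f x ^+ 2).
Proof. exact: measurable_funX. Qed.

Lemma L1M_of_sqr f g : measurable_fun setT f -> measurable_fun setT g ->
  L1 P (fun x => f x ^+ 2) -> L1 P (fun x => g x ^+ 2) ->
  L1 P (fun x => f x * g x).
Proof.
move=> mf mg f2 g2; apply: L1_le (L1D f2 g2); first exact: measurable_funM.
move=> x; rewrite normrM -(real_normK (num_real (f x))).
rewrite -(real_normK (num_real (g x))).
have := sqr_ge0 (`|f x| - `|g x|); have := normr_ge0 (f x).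
have := normr_ge0 (g x); nra.
Qed.

Lemma L1_of_sqr f : measurable_fun setT f -> L1 P (fun x => f x ^+ 2) -> L1 P f.
Proof.
move=> mf f2.
have i1 : L1 P (fun=> 1 ^+ 2 : R) by exact: L1_cst.
have := L1M_of_sqr mf (measurable_cst (1 : R)) f2 i1.
by under eq_fun do rewrite /cst mulr1.
Qed.

Lemma L1D_sqr f g : measurable_fun setT f -> measurable_fun setT g ->
  L1 P (fun x => f x ^+ 2) -> L1 P (fun x => g x ^+ 2) ->
  L1 P (fun x => (f x + g x) ^+ 2).
Proof.
move=> mf mg f2 g2; under eq_fun do rewrite sqrrD.
apply: L1D => //; apply: L1D => //.
by under eq_fun do rewrite -mulr_natl; apply: L1Z; exact: L1M_of_sqr.
Qed.

Lemma L1Z_sqr c f : L1 P (fun x => f x ^+ 2) -> L1 P (fun x => (c * f x) ^+ 2).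
Proof. by move=> f2; under eq_fun do rewrite exprMn; exact: L1Z. Qed.

Lemma L1_sum_sqr (I : Type) (s : seq I) (F : I -> T -> R) :
  (forall i, measurable_fun setT (F i)) ->
  (forall i, L1 P (fun x => F i x ^+ 2)) ->
  L1 P (fun x => (\sum_(i <- s) F i x) ^+ 2).
Proof.
move=> mF F2; elim: s => [|i s IH].
  by under eq_fun do rewrite big_nil expr0n; exact: L1_cst.
under eq_fun do rewrite big_cons; apply: L1D_sqr => //.
exact: measurable_sum.
Qed.

Lemma ae_L1 f g : measurable_fun setT g -> {ae P, forall x, f x = g x} ->
  L1 P f -> L1 P g.
Proof.
move=> mg fg i; have mf := L1_measurable i.
have i0 : L1 P (fun x => g x - f x).
  apply/integrableP; split; first by apply/measurable_EFinP; exact: measurable_funB.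
  rewrite (ae_eq_integral (cst 0%E)) ?integral_cst ?mul0e//.
  - by apply: measurableT_comp => //; apply/measurable_EFinP; exact: measurable_funB.
  - by apply: filterS fg => x /= -> _; rewrite subrr normr0.
have := L1D i0 i; congr (L1 P _); apply/funext => x; ring.
Qed.

Lemma ae_mean f g : measurable_fun setT f -> measurable_fun setT g ->
  {ae P, forall x, f x = g x} -> mean P f = mean P g.
Proof.
move=> mf mg fg; rewrite !meanE; congr fine; apply: ae_eq_integral => //.
- exact/measurable_EFinP.
- exact/measurable_EFinP.
- by apply: filterS fg => x /= -> _.
Qed.

Lemma markov_L1 f e : 0 < e -> L1 P f -> (forall x, 0 <= f x) ->
  (P [set x | (e <= f x)%R] <= (mean P f / e)%:E)%E.
Proof.
move=> e0 i f0; set A := [set x | _].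
have mA : measurable A.
  have := L1_measurable i measurableT; move=> /(_ `[e, +oo[%classic).
  rewrite setTI => H; have := H (measurable_itv _); congr measurable.
  by apply/seteqP; split => x /=; rewrite in_itv/= andbT.
rewrite -mean_indic// lee_fin ler_pdivlMr// mulrC -meanZ; last exact: L1_indic.
apply: le_mean => //; first by apply: L1Z; exact: L1_indic.
move=> x; rewrite indicE; case: (boolP (x \in A)) => /=; first by rewrite inE mulr1.
by rewrite mulr0.
Qed.

End integrable_functions.

(** * Laws, independence and i.i.d. sequences *)

Section laws.
Context (R : realType) (d d1 : measure_display) (T : measurableType d)
  (S : measurableType d1) (P : probability T R).

Definition law (U : T -> S) (mU : measurable_fun setT U) : probability S R :=
  distribution P (mfun_Sub (mem_set mU)).

Section law.
Context (U : T -> S) (mU : measurable_fun setT U).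

Lemma ge0_integral_law (f : S -> \bar R) : measurable_fun setT f ->
  (forall y, 0 <= f y)%E -> (\int[law mU]_y f y = \int[P]_x f (U x))%E.
Proof. by move=> mf f0; rewrite ge0_integral_distribution. Qed.

Lemma L1_law (h : S -> R) : measurable_fun setT h ->
  L1 (law mU) h <-> L1 P (fun x => h (U x)).
Proof.
move=> mh; have mhU : measurable_fun setT (fun x => h (U x)).
  exact: measurableT_comp.
have E : (\int[law mU]_y `|(h y)%:E| = \int[P]_x `|(h (U x))%:E|)%E.
  rewrite (ge0_integral_law (f := fun y => `|(h y)%:E|%E))//.
  by apply: measurableT_comp => //; exact/measurable_EFinP.
by split=> /integrableP[_ fin]; apply/integrableP; split;
  [exact/measurable_EFinP| rewrite /= -E |exact/measurable_EFinP|rewrite /= E].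
Qed.

Lemma mean_law (h : S -> R) : measurable_fun setT h ->
  L1 P (fun x => h (U x)) -> mean (law mU) h = mean P (fun x => h (U x)).
Proof.
move=> mh i; rewrite !meanE; congr fine.
rewrite integral_distribution//; exact/measurable_EFinP.
Qed.

End law.

Definition same_law (U V : T -> S) := forall A, measurable A ->
  P (U @^-1` A) = P (V @^-1` A).

Context (U V : T -> S) (mU : measurable_fun setT U) (mV : measurable_fun setT V)
  (UV : same_law U V).

Lemma same_law_L1 (h : S -> R) : measurable_fun setT h ->
  L1 P (fun x => h (V x)) -> L1 P (fun x => h (U x)).
Proof.
move=> mh /(L1_law mV mh)/integrableP[_ fin]; apply/(L1_law mU mh).
apply/integrableP; split; first exact/measurable_EFinP.
rewrite (eq_measure_integral (law mV))// => A mA _; exact: UV.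
Qed.

Lemma same_law_mean (h : S -> R) : measurable_fun setT h ->
  L1 P (fun x => h (V x)) ->
  mean P (fun x => h (U x)) = mean P (fun x => h (V x)).
Proof.
move=> mh i; rewrite -(mean_law mU)//; last exact: same_law_L1.
rewrite -(mean_law mV)// !meanE; congr fine.
by apply: eq_measure_integral => A mA _; exact: UV.
Qed.

End laws.

Section independence.
Context (R : realType) (d : measure_display) (T : measurableType d)
  (P : probability T R).

Lemma indepC d1 d2 (S1 : measurableType d1) (S2 : measurableType d2)
  (U : T -> S1) (V : T -> S2) : indep P U V -> indep P V U.
Proof. by move=> UV A B mA mB; rewrite setIC muleC; exact: UV. Qed.

Lemma indep_comp d1 d2 d3 d4 (S1 : measurableType d1) (S2 : measurableType d2)
  (S3 : measurableType d3) (S4 : measurableType d4)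
  (U : T -> S1) (V : T -> S2) (f : S1 -> S3) (g : S2 -> S4) :
  measurable_fun setT f -> measurable_fun setT g ->
  indep P U V -> indep P (f \o U) (g \o V).
Proof.
move=> mf mg UV A B mA mB; apply: (UV (f @^-1` A) (g @^-1` B)).
- by rewrite -[X in measurable X]setTI; exact: mf.
- by rewrite -[X in measurable X]setTI; exact: mg.
Qed.

(** Under the joint law, which is the product of the marginals, the
    expectation of a product factors by Fubini. *)
Lemma indep_mul (U V : T -> R) : measurable_fun setT U ->
  measurable_fun setT V -> indep P U V -> L1 P U -> L1 P V ->
  L1 P (fun x => U x * V x) /\
  mean P (fun x => U x * V x) = mean P U * mean P V.
Proof.
move=> mU mV UV iU iV.
have mUV : measurable_fun setT (fun x => (U x, V x)).
  exact: measurable_fun_pair.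
have jointE : forall A, measurable A -> (law P mU \x law P mV)%E A = law P mUV A.
  apply: product_measure_unique => A B mA mB.
  by move: (UV A B mA mB); rewrite /law/= /distribution /pushforward /= => <-.
pose h (z : R * R) : R := z.1 * z.2.
have mh : measurable_fun setT h by apply: measurable_funM.
have mhE : measurable_fun setT (EFin \o h) by exact/measurable_EFinP.
have iUl : L1 (law P mU) id by apply/L1_law.
have iVl : L1 (law P mV) id by apply/L1_law.
have ih : (law P mU \x law P mV)%E.-integrable setT (EFin \o h).
  apply/integrable12ltyP => //=.
  under eq_integral => x _.
    under eq_integral => y _ do rewrite /h/= normrM EFinM.
    rewrite ge0_integralZl//; last exact: measurableT_comp.
    over.
  rewrite ge0_integralZr//; last 2 first.
  - exact: measurableT_comp.
  - by apply: integral_ge0.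
  apply: lte_mul_pinfty => //.
  - exact: integral_ge0.
  - rewrite ge0_fin_numE; last exact: integral_ge0.
    by case/integrableP : iUl.
  - by case/integrableP : iVl.
have ihl : L1 (law P mUV) h.
  apply/integrableP; split => //.
  rewrite (eq_measure_integral (law P mU \x law P mV)%E); last first.
    by move=> A mA _; rewrite /= jointE.
  by case/integrableP : ih.
have iUV : L1 P (fun x => U x * V x) by exact: ((L1_law P mUV mh).1 ihl).
split=> //; apply: EFin_inj; rewrite -(mean_law mUV mh iUV).
rewrite -(mean_law mU (h := id))// -(mean_law mV (h := id))//.
rewrite EFin_mean// (eq_measure_integral (law P mU \x law P mV)%E); last first.
  by move=> A mA _; rewrite /= jointE.
rewrite -integral12_prod_meas1//; set c := mean (law P mV) id.
transitivity (\int[law P mU]_x (c * x)%:E)%E.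
  apply: eq_integral => x _; rewrite /fubini_F /h /= mulrC -meanZ// EFin_mean//.
  exact: (L1Z _ iVl).
by rewrite -EFin_mean ?(meanZ c iUl) 1?mulrC//; exact: (L1Z _ iUl).
Qed.

Lemma indep_mean_mul (U V : T -> R) : measurable_fun setT U ->
  measurable_fun setT V -> indep P U V -> L1 P U -> L1 P V ->
  mean P (fun x => U x * V x) = mean P U * mean P V.
Proof. by move=> *; apply: (indep_mul _ _ _ _ _).2. Qed.

(** Independence of an event from rectangles extends to the sigma-algebra of
    the pair, because two finite measures that agree on rectangles are equal. *)
Lemma indep_pair_event d1 d2 (S1 : measurableType d1) (S2 : measurableType d2)
  (U : T -> S1) (V : T -> S2) (C : set T) :
  measurable_fun setT U -> measurable_fun setT V -> measurable C ->
  (forall A B, measurable A -> measurable B ->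
    P (U @^-1` A `&` V @^-1` B `&` C) = (P (U @^-1` A `&` V @^-1` B) * P C)%E) ->
  forall E : set (S1 * S2), measurable E ->
    P ((fun x => (U x, V x)) @^-1` E `&` C) =
    (P ((fun x => (U x, V x)) @^-1` E) * P C)%E.
Proof.
move=> mU mV mC H E mE.
pose W x := (U x, V x).
have mW : measurable_fun setT W by exact: measurable_fun_pair.
have mWs A : measurable A -> measurable (W @^-1` A).
  by move=> mA; rewrite -[X in measurable X]setTI; exact: mW.
pose Wm : {mfun T >-> (S1 * S2)%type} := mfun_Sub (mem_set mW).
pose r := NngNum (fine_ge0 (measure_ge0 P C)).
pose G : set (set (S1 * S2)) :=
  [set A `*` B | A in measurable & B in measurable].
have := @measure_unique _ R _ G (fun=> setT) _ _ _ _
  (pushforward (mrestr P mC) Wm) (mscale r (pushforward P Wm)) _ _ E mE.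
rewrite /= /mscale /= /pushforward /mrestr /= fineK ?fin_num_measure// muleC.
apply.
- by rewrite measurable_prod_measurableType.
- move=> _ _ [A1 mA1 [B1 mB1 <-]] [A2 mA2 [B2 mB2 <-]].
  exists (A1 `&` A2); first exact: measurableI.
  by exists (B1 `&` B2); [exact: measurableI|rewrite setXI].
- by move=> _; exists setT => //; exists setT => //; rewrite setXTT.
- by rewrite bigcup_const//; exists 0%N.
- exact: mW.
- exact: mW.
- by move=> _ [A mA [B mB <-]]; rewrite muleC; exact: H.
- move=> _; apply: le_lt_trans (ltry 1); apply: probability_le1.
  by apply: measurableI => //; exact: mWs.
Qed.

End independence.

Section iid.
Context (R : realType) (d d1 : measure_display) (T : measurableType d)
  (S : measurableType d1) (P : probability T R).
Context (Zs : nat -> T -> S) (Z : T -> S).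
Context (mZs : forall i, measurable_fun setT (Zs i)) (mZ : measurable_fun setT Z)
  (iid : iid_copies P Zs Z).

Lemma iid_same_law i : same_law P (Zs i) Z.
Proof. exact: iid.1. Qed.

Let mZp i A : measurable A -> measurable (Zs i @^-1` A).
Proof. by move=> mA; rewrite -[X in measurable X]setTI; exact: mZs. Qed.

Let mcap (s : seq nat) (A : nat -> set S) : (forall i, measurable (A i)) ->
  measurable (\big[setI/setT]_(i <- s) (Zs i @^-1` A i)).
Proof. by move=> mA; apply: bigsetI_measurable => i _; exact: mZp. Qed.

Context (h : S -> R) (mh : measurable_fun setT h).

Let V k : T -> R := fun o => \sum_(i < k) h (Zs i o).

Lemma measurable_partial_sum k :
  measurable_fun setT (fun o => \sum_(i < k) h (Zs i o)).
Proof. by apply: measurable_sum => i; exact: measurableT_comp. Qed.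

(** Independence from all later observations at once, rather than from the next
    one only, makes the induction go through: the step moves one observation
    from the tail into the partial sum. *)
Let V_indep_tail k (s : seq nat) (A : nat -> set S) (B : set R) :
  uniq s -> all (leq k) s -> (forall i, measurable (A i)) -> measurable B ->
  P (V k @^-1` B `&` \big[setI/setT]_(i <- s) (Zs i @^-1` A i)) =
  (P (V k @^-1` B) * P (\big[setI/setT]_(i <- s) (Zs i @^-1` A i)))%E.
Proof.
move=> us ks mA; elim: k => [|k IH] in s us ks A mA B *.
  move=> mB; have -> : V 0 = cst 0 by apply/funext => o; rewrite /V big_ord0.
  rewrite preimage_cst; case: ifP => _; first by rewrite setTI probability_setT mul1e.
  by rewrite set0I measure0 mul0e.
move=> mB; set C := \big[_/_]_(_ <- _) _.
pose E : set (R * S) := [set z | B (z.1 + h z.2)].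
have mE : measurable E.
  have mf : measurable_fun setT (fun z : R * S => z.1 + h z.2).
    by apply: measurable_funD => //; exact: measurableT_comp.
  by have := mf measurableT B mB; rewrite setTI.
have VE : V k.+1 @^-1` B = (fun x => (V k x, Zs k x)) @^-1` E.
  by apply/seteqP; split => o; rewrite /E /= /V big_ord_recr.
have ks' : all (leq k) s by apply: sub_all ks => i; exact: ltnW.
have kNs : k \notin s by apply/negP => /(allP ks); rewrite ltnn.
have mC : measurable C by exact: mcap.
rewrite VE; apply: indep_pair_event => //; first exact: measurable_partial_sum.
move=> A1 B1 mA1 mB1.
pose A' i := if i == k then B1 else A i.
have mA' i : measurable (A' i) by rewrite /A'; case: ifP.
have CE : C = \big[setI/setT]_(i <- s) (Zs i @^-1` A' i).
  rewrite /C big_seq [RHS]big_seq; apply: eq_bigr => i si; rewrite /A'.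
  by case: eqP => // ik; rewrite -ik si in kNs.
have e1 : P (V k @^-1` A1 `&` Zs k @^-1` B1 `&` C) =
    (P (V k @^-1` A1) * P (Zs k @^-1` B1 `&` C))%E.
  have := IH (k :: s) _ _ A' mA' A1 mA1; rewrite /= kNs us leqnn ks'.
  by rewrite big_cons -CE {1 2}/A' eqxx setIA; exact.
have e2 : P (V k @^-1` A1 `&` Zs k @^-1` B1) =
    (P (V k @^-1` A1) * P (Zs k @^-1` B1))%E.
  have := IH [:: k] _ _ A' mA' A1 mA1; rewrite /= leqnn.
  by rewrite big_cons big_nil setIT /A' eqxx; exact.
have e3 : P (Zs k @^-1` B1 `&` C) = (P (Zs k @^-1` B1) * P C)%E.
  have := iid.2 (k :: s) A' _ mA'; rewrite /= kNs us !big_cons -CE.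
  by rewrite {1 2}/A' eqxx CE iid.2//; exact.
by rewrite e1 e2 e3 muleA.
Qed.

Lemma partial_sum_indep k :
  indep P (fun o => \sum_(i < k) h (Zs i o)) (Zs k).
Proof.
move=> B A mB mA.
have := @V_indep_tail k [:: k] (fun=> A) B.
by rewrite big_cons big_nil setIT /= leqnn; exact.
Qed.

End iid.

(** * Borel sets of vectors and versions of conditional expectations *)

Section borel_vectors.
Context (R : realType) (m : nat).
Implicit Types (x y l : 'cV[R]_m).

Lemma dotpE l x : dotp l x = \sum_j l j 0 * x j 0.
Proof. by rewrite /dotp mxE; apply: eq_bigr => j _; rewrite mxE. Qed.

(** A vector lies within 1/(n+1) of a rational one whose ball stays in the open
    set: this countable family of balls replaces the uncountable ones in
    measurability arguments. *)
Lemma open_rat_ball (U : set 'cV[R]_m) x : open U -> U x ->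
  exists (q : 'cV[rat]_m) (n : nat),
    ball (map_mx ratr q : 'cV[R]_m) n.+1%:R^-1 x /\
    ball (map_mx ratr q : 'cV[R]_m) n.+1%:R^-1 `<=` U.
Proof.
move=> oU Ux; have /nbhs_ballP[e /= e0 eU] : nbhs x U by apply: open_nbhs_nbhs.
have [n ne] : exists n : nat, n.+1%:R^-1 < e / 2.
  have e2 : 0 < e / 2 by rewrite divr_gt0.
  exists (Num.truncn (e / 2)^-1); rewrite -[ltRHS]invrK ltf_pV2 ?posrE ?invr_gt0//.
  exact: truncnS_gt.
have qex j : exists q : rat, x j 0 < ratr q < x j 0 + n.+1%:R^-1.
  have /rat_in_itvoo[q] : x j 0 < x j 0 + n.+1%:R^-1 by rewrite ltrDl invr_gt0.
  by rewrite in_itv/= => ?; exists q.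
have [q qP] := choice qex.
exists (\col_j q j), n; split.
  split; first by rewrite invr_gt0.
  move=> i j; rewrite (ord1 j) !mxE /ball/= ltr_norml.
  have r0 : 0 < n.+1%:R^-1 :> R by rewrite invr_gt0.
  have /andP[h1 h2] := qP i; apply/andP; split.
    by rewrite ltrBrDl; apply: lt_trans h1; rewrite gtrDl oppr_lt0.
  by rewrite ltrBlDl.
move=> y [_ qy]; apply: eU; split => // i j; rewrite (ord1 j).
have := qy i j; rewrite (ord1 j) !mxE /ball /= => h.
have /andP[h1 h2] := qP i.
have h3 : `|x i 0 - ratr (q i)| < n.+1%:R^-1.
  by rewrite ltr_distlC; apply/andP; split=> //; apply: lt_trans h1; rewrite gtrDl oppr_lt0 invr_gt0.
rewrite (splitr e); apply: le_lt_trans (ltrD (lt_trans h3 ne) (lt_trans h ne)).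
exact: ler_distD.
Qed.

(** A ball of the max norm is a box, and every open set is a countable union of
    rational balls. *)
Lemma measurable_rvec d (T : measurableType d) (f : T -> rvec R m) :
  (forall j, measurable_fun setT (fun o => (f o : 'cV[R]_m) j 0)) ->
  measurable_fun setT f.
Proof.
move=> mf; apply: (@measurability _ _ _ _ setT f (@open 'cV[R]_m)) => //.
move=> _ [U oU <-].
pose F (qn : 'cV[rat]_m * nat) : set T :=
  if `[< ball (map_mx ratr qn.1 : 'cV[R]_m) qn.2.+1%:R^-1 `<=` U >]
  then [set o | ball (map_mx ratr qn.1 : 'cV[R]_m) qn.2.+1%:R^-1 (f o)]
  else set0.
have -> : setT `&` f @^-1` U = \bigcup_qn F qn.
  apply/seteqP; split => [t [_ Ut] | t [qn _]]; last first.
    by rewrite /F; case: asboolP => // qU /qU.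
  have [q [n [h1 h2]]] := open_rat_ball oU Ut.
  by exists (q, n) => //; rewrite /F; case: asboolP.
apply: countable_bigcupT_measurable => // -[q n]; rewrite /F; case: asboolP => //= _.
set r := n.+1%:R^-1; rewrite (_ : mkset _ =
  ~` \bigcup_j (fun o => (f o : 'cV[R]_m) j 0) @^-1`
       (~` ball (ratr (q j 0) : R) r)).
  apply: measurableC; apply: countable_bigcupT_measurable => // j.
  rewrite -[X in measurable X]setTI; apply: mf => //; apply: measurableC.
  by apply: open_measurable; exact: ball_open.
apply/seteqP; split => [t [_ H] [j _] /=|t H].
  by have := H j 0; rewrite !mxE.
split; first by rewrite /r invr_gt0.
move=> i j; rewrite (ord1 j) mxE; apply: contrapT => h; apply: H.
by exists i.
Qed.

Lemma continuous_measurable_rvec (f : 'cV[R]_m -> R) : continuous f ->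
  measurable_fun setT (f : rvec R m -> R).
Proof.
move=> /continuousP cf; apply: (measurability _ (RGenOpens.measurableE R)).
move=> _ [_ [a [b ->] <-]]; rewrite setTI; apply: sub_sigma_algebra.
by apply: cf; exact: interval_open.
Qed.

Lemma measurable_coord j :
  measurable_fun setT (fun x : rvec R m => (x : 'cV[R]_m) j 0).
Proof.
exact: (continuous_measurable_rvec (@coord_continuous R m 1 j 0)).
Qed.

End borel_vectors.

Section conditional_expectation.
Context (R : realType) (d d1 : measure_display) (T : measurableType d)
  (S : measurableType d1) (P : probability T R).
Implicit Types (V : T -> S) (Z g : T -> R).

Lemma condE_measurable V Z g : measurable_fun setT V -> is_condE P V Z g ->
  measurable_fun setT g.
Proof. by move=> mV [_ /L1_measurable]. Qed.

(** The set where one version exceeds the other is in the sigma-algebra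
    generated by the conditioning variable, so the difference integrates to
    zero over it. *)
Lemma condE_ae_unique V Z g1 g2 : measurable_fun setT V ->
  is_condE P V Z g1 -> is_condE P V Z g2 -> {ae P, forall t, g1 t = g2 t}.
Proof.
move=> mV c1 c2.
have half : forall f1 f2, is_condE P V Z f1 -> is_condE P V Z f2 ->
    {ae P, forall t, f1 t <= f2 t}.
  move=> f1 f2 [iZ i1 m1 e1] [_ i2 m2 e2].
  have [B mB BE] : exists2 B, measurable B & V @^-1` B = [set t | 0 < f1 t - f2 t].
    have := measurable_funB m1 m2; move=> /(_ measurableT _ (measurable_itv `]0, +oo[)).
    rewrite setTI => -[B mB]; rewrite setTI => BE; exists B => //.
    by rewrite BE; apply/seteqP; split => t /=; rewrite in_itv/= andbT.
  have mVB : measurable (V @^-1` B) by rewrite -[X in measurable X]setTI; exact: mV.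
  have if12 : P.-integrable (V @^-1` B) (EFin \o (fun t => f1 t - f2 t)).
    by apply: (@integrableS _ _ _ P setT) => //; exact: L1B.
  have int0 : (\int[P]_(t in V @^-1` B) `|(f1 t - f2 t)%:E| = 0)%E.
    transitivity (\int[P]_(t in V @^-1` B) ((f1 t)%:E - (f2 t)%:E))%E.
      apply: eq_integral => t; rewrite inE BE /= => h.
      by rewrite ger0_norm// ltW.
    rewrite integralB//; try by apply: (@integrableS _ _ _ P setT).
    rewrite e1// e2// subee// integrable_fin_num//.
    by apply: (@integrableS _ _ _ P setT) => //.
  have : ae_eq P (V @^-1` B) (EFin \o (fun t => f1 t - f2 t)) (cst 0%E).
    apply/ae_eq_integral_abs => //; exact: measurable_int if12.
  apply: filterS => t /= H; rewrite leNgt; apply/negP => h.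
  have Bt : (V @^-1` B) t by rewrite BE /= subr_gt0.
  by have [] := H Bt => /eqP; rewrite subr_eq0 => /eqP f12; rewrite f12 ltxx in h.
have h1 := half _ _ c1 c2; have h2 := half _ _ c2 c1.
by apply: filterS2 h1 h2 => t a b; apply/eqP; rewrite eq_le a b.
Qed.

Lemma condEP V Z g : is_condE P V Z g -> is_condE P V Z (condE P V Z).
Proof. by move=> c; apply: (xgetPex (cst 0) (P := [set g | is_condE P V Z g])); exists g. Qed.

Lemma condE_ae V Z g : measurable_fun setT V -> is_condE P V Z g ->
  {ae P, forall t, condE P V Z t = g t}.
Proof. by move=> mV c; exact: (condE_ae_unique mV (condEP c) c). Qed.

(** Means against indicators are easier to establish than equalities of
    integrals over preimages. *)
Lemma is_condE_indic V Z g : measurable_fun setT V ->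
  L1 P Z -> L1 P (fun t => g t) ->
  measurable_fun [set: g_sigma_algebra_preimageType V] g ->
  (forall B, measurable B -> mean P (fun t => \1_B (V t) * Z t) =
    mean P (fun t => \1_B (V t) * g t)) -> is_condE P V Z g.
Proof.
move=> mV iZ ig mg H; split=> // B mB.
have mVB : measurable (V @^-1` B) by rewrite -[X in measurable X]setTI; exact: mV.
have E : forall f, L1 P f -> (\int[P]_(t in V @^-1` B) (f t)%:E)%E =
    (mean P (fun t => \1_B (V t) * f t))%:E.
  move=> f jf; have jBf : L1 P (fun t => \1_B (V t) * f t).
    apply: L1_le (L1_norm jf) => [|t].
      apply: measurable_funM; last exact: (L1_measurable jf).
      by apply: (measurableT_comp (f := \1_B : S -> R)) => //; exact: measurable_indic.
    rewrite normrM indicE; case: (_ \in _); last by rewrite normr0 mul0r.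
    by rewrite normr1 mul1r.
  rewrite EFin_mean// integral_mkcond; apply: eq_integral => t _.
  rewrite patchE indicE (_ : (t \in _) = (V t \in B)); last by apply/idP/idP; rewrite !inE.
  by case: ifP => _; rewrite ?mul1r ?mul0r.
by rewrite !E// H.
Qed.

Lemma condE_indic V Z g B : measurable_fun setT V -> is_condE P V Z g ->
  measurable B -> mean P (fun t => \1_B (V t) * Z t) =
    mean P (fun t => \1_B (V t) * g t).
Proof.
move=> mV [iZ ig mg H] mB.
have E : forall f, L1 P f -> (\int[P]_(t in V @^-1` B) (f t)%:E)%E =
    (\int[P]_t (\1_B (V t) * f t)%:E)%E.
  move=> f jf; rewrite integral_mkcond; apply: eq_integral => t _.
  rewrite patchE indicE (_ : (t \in _) = (V t \in B)); last by apply/idP/idP; rewrite !inE.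
  by case: ifP => _; rewrite ?mul1r ?mul0r.
by rewrite !meanE -!E// H.
Qed.

End conditional_expectation.

(** * Convergence in probability and the weak law of large numbers *)

Section dominated.
Context (R : realType) (d : measure_display) (T : measurableType d)
  (P : probability T R).

Lemma mean_dominated_cvg (f : nat -> T -> R) (g h : T -> R) :
  (forall n, measurable_fun setT (f n)) -> measurable_fun setT h ->
  (forall t, f ^~ t @ \oo --> h t) -> L1 P g -> (forall n t, `|f n t| <= g t) ->
  (fun n => mean P (f n)) @ \oo --> mean P h.
Proof.
move=> mf mh fh ig fg.
have if_ n : L1 P (f n) by apply: L1_le ig => //; exact: fg.
have hg t : `|h t| <= g t.
  have := fh t; move=> /cvg_norm H.
  rewrite -(cvg_lim _ H)//; apply: limr_le; first by apply: cvgP H.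
  by near=> n; exact: fg.
have ih : L1 P h by apply: L1_le ig.
have [] := @dominated_convergence _ _ _ P setT measurableT
  (fun n => EFin \o f n) (EFin \o h) (EFin \o g).
- by move=> n; exact/measurable_EFinP.
- exact/measurable_EFinP.
- by apply: aeW => t _; apply: cvg_EFin; [exact: nearW|exact: fh].
- exact: ig.
- by apply: aeW => t n _; rewrite /= lee_fin.
move=> _ _ H; have /fine_cvgP[_] : (fun n => \int[P]_x (f n x)%:E)%E @ \oo -->
    (mean P h)%:E by rewrite EFin_mean.
by apply: cvg_trans; apply: near_eq_cvg; near=> n; rewrite /= meanE.
Unshelve. all: by end_near. Qed.

End dominated.

Section limit_algebra.
Context (R : numFieldType) (I : Type) (F : set_system I) {FF : Filter F}.

Lemma cvgD_to (V : normedModType R) (f g : I -> V) (a b c : V) : f @ F --> a ->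
  g @ F --> b -> a + b = c -> (fun x => f x + g x) @ F --> c.
Proof. by move=> fa gb <-; exact: cvgD. Qed.

Lemma cvgM_to (f g : I -> R) (a b c : R) : f @ F --> a -> g @ F --> b ->
  a * b = c -> (fun x => f x * g x) @ F --> c.
Proof. by move=> fa gb <-; exact: cvgM. Qed.

Lemma cvg_from0 (V : normedModType R) (f : I -> V) (a : V) :
  (fun x => f x - a) @ F --> (0 : V) -> f @ F --> a.
Proof. by move/subr_cvg0. Qed.

Lemma cvg_to0 (V : normedModType R) (f : I -> V) (a : V) :
  f @ F --> a -> (fun x => f x - a) @ F --> (0 : V).
Proof. by move/subr_cvg0. Qed.

Lemma cvg_sum (J : Type) (V : normedModType R) (s : seq J) (f : J -> I -> V)
  (a : J -> V) : (forall j, f j @ F --> a j) ->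
  (fun x => \sum_(j <- s) f j x) @ F --> \sum_(j <- s) a j.
Proof.
move=> fa; elim: s => [|j s IH].
  by rewrite big_nil; under eq_fun do rewrite big_nil; exact: cvg_cst.
by rewrite big_cons; under eq_fun do rewrite big_cons; exact: cvgD.
Qed.

End limit_algebra.

Section high_probability.
Context (R : realType) (d : measure_display) (T : measurableType d)
  (P : probability T R).

(** Convergence along this filter on pairs (sample size, sample point) is
    convergence in outer probability; the filter makes the general theory of
    limits (algebra, continuous mappings) available for it, without any
    measurability side condition. *)
Definition whp : set_system (nat * T) :=
  [set A | forall eta : R, 0 < eta -> exists F : nat -> set T,
     [/\ forall n, measurable (F n),
         \forall n \near \oo, (P (F n) <= eta%:E)%E &
         forall n t, ~ F n t -> A (n, t)]].

Global Instance whp_filter : Filter whp.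
Proof.
split.
- move=> eta eta0; exists (fun=> set0); split => //.
  by apply: nearW => n; rewrite measure0 lee_fin ltW.
- move=> A B FA FB eta eta0; have eta2 : 0 < eta / 2 by rewrite divr_gt0.
  have [F [mF PF {}FA]] := FA _ eta2; have [G [mG PG {}FB]] := FB _ eta2.
  exists (fun n => F n `|` G n); split.
  + by move=> n; exact: measurableU.
  + near=> n; rewrite [eta]splitr EFinD.
    apply: le_trans (leeD _ _); first exact: measureU2.
    * by near: n.
    * by near: n.
  + move=> n t /= FG; split; [apply: FA|apply: FB]; apply: contra_not FG; by [left|right].
- move=> A B AB FA eta eta0; have [F [mF PF {}FA]] := FA _ eta0.
  by exists F; split => // n t /FA; exact: AB.
Unshelve. all: by end_near. Qed.

Lemma whp_near_nat (A : set nat) : (\forall n \near \oo, A n) ->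
  \forall x \near whp, A x.1.
Proof.
move=> [N _ NA] eta eta0; exists (fun n => if (n < N)%N then setT else set0); split.
- by move=> n; case: ifP.
- by exists N => // n /= Nn; rewrite ltnNge Nn /= measure0 lee_fin ltW.
- move=> n t; case: ltnP => [_ /(_ I)//|Nn _]; exact: NA.
Qed.

Lemma whp_cvg_nat (V : topologicalType) (u : nat -> V) (l : V) :
  u @ \oo --> l -> (fun x => u x.1) @ whp --> l.
Proof. by move=> ul A /ul nA; exact: (whp_near_nat nA). Qed.

Lemma whp_ae (Q : nat -> T -> Prop) : (forall n, {ae P, forall t, Q n t}) ->
  \forall x \near whp, Q x.1 x.2.
Proof.
move=> Qn; have /choice[F FP] : forall n, exists F, [/\ measurable F, P F = 0%E &
    forall t, ~ F t -> Q n t].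
  move=> n; have [F [mF PF FQ]] := Qn n; exists F; split => // t Ft.
  by apply: contrapT => nQ; apply: Ft; exact: FQ.
move=> eta eta0; exists F; split=> [n||n t]; [by have [] := FP n| |by have [_ _] := FP n; exact].
by apply: nearW => n; have [_ -> _] := FP n; rewrite lee_fin ltW.
Qed.

Lemma measurable_norm_ge (Z : T -> R) (e : R) : measurable_fun setT Z ->
  measurable [set t | e <= `|Z t|].
Proof.
move=> mZ; have mn : measurable_fun setT (fun t => `|Z t|) by exact: measurableT_comp.
have := mn measurableT _ (measurable_itv `[e, +oo[); rewrite setTI.
by congr measurable; apply/seteqP; split => t /=; rewrite in_itv /= andbT.
Qed.

(** Markov's inequality. *)
Lemma whp_of_mean (Z : nat -> T -> R) :
  (\forall n \near \oo, L1 P (Z n)) -> (forall n, measurable_fun setT (Z n)) ->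
  (fun n => mean P (fun t => `|Z n t|)) @ \oo --> (0 : R) ->
  (fun x => Z x.1 x.2) @ whp --> (0 : R).
Proof.
move=> iZ mZ H; apply/cvgr0Pnorm_lt => e e0 eta eta0.
exists (fun n => [set t | e <= `|Z n t|]); split.
- by move=> n; exact: measurable_norm_ge.
- have ee : 0 < e * eta by rewrite mulr_gt0.
  move/cvgr0Pnorm_le : H => /(_ _ ee) H; near=> n.
  have i : L1 P (Z n) by near: n.
  apply: le_trans (markov_L1 e0 (L1_norm i) _) _ => //.
  rewrite lee_fin ler_pdivrMr// mulrC; apply: le_trans (ler_norm _) _.
  by near: n.
- by move=> n t /= /negP; rewrite -ltNge.
Unshelve. all: by end_near. Qed.

(** Tightness, stated as the property through which it is used. *)
Definition bounded_prob (Z : nat * T -> R) : Prop :=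
  forall r : nat * T -> R, r @ whp --> (0 : R) ->
    (fun x => r x * Z x) @ whp --> (0 : R).

Lemma bounded_prob_cvg (Z : nat * T -> R) (l : R) : Z @ whp --> l ->
  bounded_prob Z.
Proof. by move=> Zl r r0; rewrite -(mul0r l); exact: cvgM. Qed.

Lemma bounded_probD (Z W : nat * T -> R) : bounded_prob Z -> bounded_prob W ->
  bounded_prob (fun x => Z x + W x).
Proof.
move=> bZ bW r r0; under eq_fun do rewrite mulrDr.
by apply: (cvgD_to (bZ _ r0) (bW _ r0)); rewrite addr0.
Qed.

(** By Chebyshev's inequality the values exceed K with probability at most
    C/K^2. *)
Lemma bounded_prob_L2 (Z : nat -> T -> R) (C : R) :
  (forall n, measurable_fun setT (Z n)) ->
  (forall n, L1 P (fun t => Z n t ^+ 2)) ->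
  (forall n, mean P (fun t => Z n t ^+ 2) <= C) ->
  bounded_prob (fun x => Z x.1 x.2).
Proof.
move=> mZ iZ mC r r0; apply/cvgr0Pnorm_lt => e e0 eta eta0.
have [K K0 KC] : exists2 K : R, 0 < K & C / K ^+ 2 <= eta / 2.
  (* As K >= 1, this gives |C| = (eta / 2)(K - 1) <= (eta / 2) K^2. *)
  pose K := 1 + 2 * `|C| / eta; have K1 : 1 <= K.
    by rewrite lerDl divr_ge0 ?mulr_ge0// ltW.
  exists K; first by apply: lt_le_trans K1.
  have K20 : 0 < K ^+ 2 by rewrite exprn_gt0// (lt_le_trans _ K1).
  rewrite ler_pdivrMr//; apply: le_trans (ler_norm _) _.
  have -> : `|C| = eta / 2 * (K - 1) by rewrite /K; field; rewrite gt_eqF.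
  rewrite ler_pM2l ?divr_gt0//; nra.
have eK : 0 < e / K by rewrite divr_gt0.
have eta2 : 0 < eta / 2 by rewrite divr_gt0.
move/cvgr0Pnorm_lt : r0 => /(_ _ eK) /(_ _ eta2) [F [mF PF FA]].
exists (fun n => F n `|` [set t | K <= `|Z n t|]); split.
- by move=> n; apply: measurableU => //; exact: measurable_norm_ge.
- near=> n; rewrite [eta]splitr EFinD.
  apply: le_trans (leeD _ _); first by apply: measureU2 => //; exact: measurable_norm_ge.
    by near: n.
  have -> : [set t | K <= `|Z n t|] = [set t | (K ^+ 2 <= Z n t ^+ 2)%R].
    apply/seteqP; split => t /=; rewrite -(real_normK (num_real (Z n t)));
      by rewrite ler_pXn2r// ?nnegrE// ltW.
  have K20 : 0 < K ^+ 2 by rewrite exprn_gt0.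
  apply: le_trans (markov_L1 K20 (iZ n) _) _ => [t|]; first exact: sqr_ge0.
  rewrite lee_fin; apply: le_trans KC; rewrite ler_pM2r ?invr_gt0//.
- move=> n t /= /not_orP[/FA /= h1 /negP]; rewrite -ltNge => h2.
  rewrite normrM -(divfK (lt0r_neq0 K0) e).
  by apply: ltr_pM.
Unshelve. all: by end_near. Qed.

End high_probability.

Section averages.
Context (R : realType) (d d1 : measure_display) (T : measurableType d)
  (S : measurableType d1) (P : probability T R).
Context (Zs : nat -> T -> S) (Z : T -> S).
Context (mZs : forall i, measurable_fun setT (Zs i)) (mZ : measurable_fun setT Z)
  (iid : iid_copies P Zs Z).
Implicit Types h : S -> R.

Definition average h (x : nat * T) : R :=
  x.1%:R^-1 * \sum_(i < x.1) h (Zs i x.2).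

Definition root_sum h (x : nat * T) : R :=
  (Num.sqrt x.1%:R)^-1 * \sum_(i < x.1) h (Zs i x.2).

Let mh_i h i : measurable_fun setT h -> measurable_fun setT (fun t => h (Zs i t)).
Proof. by move=> mh; exact: measurableT_comp. Qed.

Lemma iid_L1 h i : measurable_fun setT h -> L1 P (fun t => h (Z t)) ->
  L1 P (fun t => h (Zs i t)).
Proof. by move=> mh; apply: (same_law_L1 (mZs i) mZ (iid_same_law iid i)). Qed.

Lemma iid_mean h i : measurable_fun setT h -> L1 P (fun t => h (Z t)) ->
  mean P (fun t => h (Zs i t)) = mean P (fun t => h (Z t)).
Proof. by move=> mh; apply: (same_law_mean (mZs i) mZ (iid_same_law iid i)). Qed.

Lemma iid_ae (A : set S) : measurable A -> {ae P, forall t, A (Z t)} ->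
  forall i, {ae P, forall t, A (Zs i t)}.
Proof.
move=> mA aeA i; exists (Zs i @^-1` (~` A)); split => //.
- by rewrite -[X in measurable X]setTI; apply: mZs => //; exact: measurableC.
- rewrite iid.1; last exact: measurableC.
  apply: (measure_negligible _ _) => //.
  by rewrite -[X in measurable X]setTI; apply: mZ => //; exact: measurableC.
Qed.

(** The summands are centered and uncorrelated. *)
Lemma mean_sum_sqr h n : measurable_fun setT h -> mean P (fun t => h (Z t)) = 0 ->
  L1 P (fun t => h (Z t) ^+ 2) ->
  mean P (fun t => (\sum_(i < n) h (Zs i t)) ^+ 2)
    = n%:R * mean P (fun t => h (Z t) ^+ 2).
Proof.
move=> mh h0 ih2.
have mh2 : measurable_fun setT (fun z => h z ^+ 2) by exact: measurable_sqr.
have ih : L1 P (fun t => h (Z t)).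
  by apply: L1_of_sqr => //; exact: measurableT_comp.
elim: n => [|n IH].
  by under eq_mean do rewrite big_ord0 expr0n; rewrite mean_cst mul0r.
under eq_mean do rewrite big_ord_recr /= sqrrD.
set V := fun t => \sum_(i < n) h (Zs i t).
have mV : measurable_fun setT V by exact: (measurable_partial_sum mZs mh n).
have iV2 : L1 P (fun t => V t ^+ 2).
  apply: (@L1_sum_sqr _ _ _ _ _ _ (fun (i : 'I_n) t => h (Zs i t))) => i.
    exact: mh_i.
  exact: (iid_L1 i mh2 ih2).
have iV : L1 P V by exact: L1_of_sqr.
have VZ := partial_sum_indep mZs iid mh n.
have VhZ : indep P V (h \o Zs n) := indep_comp (@measurable_id _ _ setT) mh VZ.
have [iVh mVh] := indep_mul mV (mh_i n mh) VhZ iV (iid_L1 n mh ih).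
have e0 : mean P (fun t => V t * h (Zs n t)) = 0.
  by rewrite mVh (iid_mean n mh ih) h0 mulr0.
rewrite (_ : mean P _ = mean P (fun t => (V t ^+ 2 + 2 * (V t * h (Zs n t)))
   + h (Zs n t) ^+ 2)); last by apply: eq_mean => t; rewrite mulr_natl.
rewrite meanD; last 2 first.
- by apply: L1D => //; exact: L1Z.
- exact: (iid_L1 n mh2 ih2).
rewrite meanD//; last exact: L1Z.
rewrite meanZ// e0 mulr0 addr0 IH (iid_mean n mh2 ih2) -[n.+1]addn1 natrD; ring.
Qed.

Lemma measurable_average h n : measurable_fun setT h ->
  measurable_fun setT (fun t => average h (n, t)).
Proof.
move=> mh; rewrite /average /root_sum /=.
apply: measurable_funM; first exact: measurable_cst.
  exact: (measurable_partial_sum mZs mh n).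
Qed.

Lemma measurable_root_sum h n : measurable_fun setT h ->
  measurable_fun setT (fun t => root_sum h (n, t)).
Proof.
move=> mh; rewrite /average /root_sum /=.
apply: measurable_funM; first exact: measurable_cst.
  exact: (measurable_partial_sum mZs mh n).
Qed.

Lemma root_sum_L2 h n : measurable_fun setT h -> mean P (fun t => h (Z t)) = 0 ->
  L1 P (fun t => h (Z t) ^+ 2) ->
  L1 P (fun t => root_sum h (n, t) ^+ 2) /\
  mean P (fun t => root_sum h (n, t) ^+ 2) <= mean P (fun t => h (Z t) ^+ 2).
Proof.
move=> mh h0 ih2.
have mh2 : measurable_fun setT (fun z => h z ^+ 2) by exact: measurable_sqr.
have iV2 : L1 P (fun t => (\sum_(i < n) h (Zs i t)) ^+ 2).
  apply: (@L1_sum_sqr _ _ _ _ _ _ (fun (i : 'I_n) t => h (Zs i t))) => i.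
    exact: mh_i.
  exact: (iid_L1 i mh2 ih2).
split; first by exact: (L1Z_sqr (Num.sqrt n%:R)^-1 iV2).
have M0 : 0 <= mean P (fun t => h (Z t) ^+ 2) by apply: mean_ge0 => t; exact: sqr_ge0.
under eq_mean do rewrite /root_sum /= exprMn.
rewrite meanZ// mean_sum_sqr//; have [->|n0] := eqVneq n 0%N.
  by rewrite mul0r mulr0.
rewrite exprVn sqr_sqrtr// mulrA mulVf ?mul1r//.
by rewrite pnatr_eq0.
Qed.

Lemma root_sum_bounded h : measurable_fun setT h -> mean P (fun t => h (Z t)) = 0 ->
  L1 P (fun t => h (Z t) ^+ 2) -> bounded_prob P (root_sum h).
Proof.
move=> mh h0 ih2.
rewrite (_ : root_sum h = fun x => (fun n t => root_sum h (n, t)) x.1 x.2); last first.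
  by apply/funext => -[].
apply: (@bounded_prob_L2 _ _ _ _ (fun n t => root_sum h (n, t)) (mean P (fun t => h (Z t) ^+ 2))).
- by move=> n; exact: measurable_root_sum.
- by move=> n; have [] := root_sum_L2 n mh h0 ih2.
- by move=> n; have [] := root_sum_L2 n mh h0 ih2.
Qed.

Lemma truncation h e : measurable_fun setT h -> L1 P (fun t => h (Z t)) -> 0 < e ->
  exists k : S -> R, [/\ measurable_fun setT k, exists M : R, forall z, `|k z| <= M &
    mean P (fun t => `|h (Z t) - k (Z t)|) <= e].
Proof.
move=> mh ih e0.
pose k (n : nat) z : R := if `|h z| <= n%:R then h z else 0.
have mk n : measurable_fun setT (k n).
  apply: measurable_fun_ifT => //.
  by apply: measurable_fun_ler => //; exact: measurableT_comp.
have : (fun n => mean P (fun t => `|h (Z t) - k n (Z t)|)) @ \oo -->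
    mean P (fun=> 0 : R).
  apply: (@mean_dominated_cvg _ _ _ _ _ (fun t => `|h (Z t)|)) => //.
  - move=> n; apply: measurableT_comp => //; apply: measurable_funB.
      exact: measurableT_comp.
    exact: measurableT_comp.
  - move=> t; apply: cvg_near_cst.
    exists (Num.truncn `|h (Z t)|).+1 => // n /= nh; rewrite /k.
    have := lt_le_trans (truncnS_gt `|h (Z t)|) _; move=> /(_ n%:R).
    by rewrite ler_nat => /(_ nh)/ltW ->; rewrite subrr normr0.
  - exact: L1_norm.
  - move=> n t; rewrite normr_id /k; case: ifP => _.
      by rewrite subrr normr0.
    by rewrite subr0.
rewrite mean_cst => /cvgr0Pnorm_le /(_ _ e0) [n _ /(_ n (leqnn n)) /= H].
exists (k n); split => //; last by apply: le_trans H; exact: ler_norm.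
by exists n%:R => z; rewrite /k; case: ifP => // _; rewrite normr0.
Qed.

(** Split off a bounded truncation: its average has variance of order 1/n,
    and the remainder is small in mean uniformly in the sample size. *)
Lemma weak_law h : measurable_fun setT h -> L1 P (fun t => h (Z t)) ->
  average h @ whp P --> mean P (fun t => h (Z t)).
Proof.
move=> mh ih; set c := mean P _.
have -> : average h = (fun x => (fun n t => average h (n, t)) x.1 x.2).
  by apply/funext => -[].
apply: cvg_from0.
have iavg k n : measurable_fun setT k -> L1 P (fun t => k (Z t)) ->
    L1 P (fun t => average k (n, t)).
  move=> mk ik; rewrite /average /=; apply: L1Z.
  by apply: L1_sum => i _; exact: iid_L1.
apply: (@whp_of_mean _ _ _ _ (fun n t => average h (n, t) - c)).
- by apply: nearW => n; apply: L1B; [exact: iavg|exact: L1_cst].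
- by move=> n; apply: measurable_funB => //; exact: measurable_average.
apply/cvgr0Pnorm_le => e e0.
have e4 : 0 < e / 4 by rewrite divr_gt0.
have [k [mk [M kM] hk]] := truncation mh ih e4.
have mkZ : measurable_fun setT (fun t => k (Z t)) by exact: measurableT_comp.
have ik : L1 P (fun t => k (Z t)) by apply: (L1_bounded P mkZ) => t; exact: kM.
pose ck := mean P (fun t => k (Z t)).
pose k0 z := k z - ck.
have mk0 : measurable_fun setT k0 by exact: measurable_funB.
have k0_0 : mean P (fun t => k0 (Z t)) = 0.
  by rewrite meanB ?mean_cst ?subrr//; exact: L1_cst.
have ik02 : L1 P (fun t => k0 (Z t) ^+ 2).
  apply: (@L1_bounded _ _ _ _ _ ((M + `|ck|) ^+ 2)).
    by apply: measurable_sqr; exact: measurableT_comp.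
  move=> t; rewrite normrX ler_pXn2r ?nnegrE//.
    by apply: le_trans (ler_normB _ _) _; rewrite lerD2r.
  by apply: addr_ge0 => //; apply: le_trans (kM (Z t)).
pose v := mean P (fun t => k0 (Z t) ^+ 2).
have cck : `|ck - c| <= e / 4.
  rewrite distrC -meanB//; apply: le_trans (norm_mean _) _ => //.
  exact: L1B.
have v0 : 0 <= v by apply: mean_ge0 => t; exact: sqr_ge0.
pose W n t := average k0 (n, t).
have mW n : measurable_fun setT (W n) by exact: measurable_average.
have W2 n : (0 < n)%N -> L1 P (fun t => W n t ^+ 2) /\
    mean P (fun t => W n t ^+ 2) <= v / n%:R.
  move=> n0; have [i1 i2] := root_sum_L2 n mk0 k0_0 ik02.
  have WE t : W n t = (Num.sqrt n%:R)^-1 * root_sum k0 (n, t).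
    by rewrite /W /average /root_sum /= mulrA -invfM -expr2 sqr_sqrtr.
  under eq_fun do rewrite WE; split; first exact: (L1Z_sqr _ i1).
  under eq_mean do rewrite exprMn exprVn sqr_sqrtr//.
  by rewrite meanZ// mulrC ler_pM2r// invr_gt0 ltr0n.
have split_avg n t : (0 < n)%N -> `|average h (n, t) - c| <=
    `|W n t| + average (fun z => `|h z - k z|) (n, t) + e / 4.
  move=> n0; have -> : average h (n, t) - c = W n t +
      n%:R^-1 * \sum_(i < n) (h (Zs i t) - k (Zs i t)) + (ck - c).
    rewrite /W /average /= /k0 !big_split /= !sumrN sumr_const card_ord -[_ *+ n]mulr_natl.
    field; by rewrite pnatr_eq0 -lt0n.
  apply: le_trans (ler_normD _ _) _; apply: lerD => //.
  apply: le_trans (ler_normD _ _) _; apply: lerD => //.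
  rewrite normrM ger0_norm ?invr_ge0// /average /= ler_wpM2l ?invr_ge0//.
  exact: ler_norm_sum.
near=> n.
have n0 : (0 < n)%N by near: n; exists 1%N.
have [i1 i2] := W2 _ n0.
have iW : L1 P (W n) by exact: L1_of_sqr.
have mhk : measurable_fun setT (fun z => `|h z - k z|).
  by apply: measurableT_comp => //; exact: measurable_funB.
have ihk : L1 P (fun t => `|h (Z t) - k (Z t)|) by apply: L1_norm; exact: L1B.
have iA := iavg _ n mhk ihk.
have EA : mean P (fun t => average (fun z => `|h z - k z|) (n, t)) <= e / 4.
  have iHK i := iid_L1 i mhk ihk; have mHK i := iid_mean i mhk ihk.
  rewrite /average /= meanZ; last by apply: L1_sum => i _; exact: iHK.
  rewrite mean_sum; last by move=> i _; exact: iHK.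
  rewrite (eq_bigr (fun=> mean P (fun t => `|h (Z t) - k (Z t)|))); last first.
    by move=> i _; exact: mHK.
  rewrite sumr_const card_ord mulrnAr -mulrnAl -[n%:R^-1 *+ n]mulr_natl.
  rewrite divff ?mul1r//.
  by rewrite pnatr_eq0 -lt0n.
have EW : mean P (fun t => `|W n t|) <= e / 4 + (v / n%:R) / (e / 4).
  apply: (@le_trans _ _ (mean P (fun t => e / 4 + (e / 4)^-1 * W n t ^+ 2))).
    apply: le_mean => //; first exact: L1_norm.
      by apply: L1D; [exact: L1_cst|exact: L1Z].
    move=> t; rewrite -(real_normK (num_real (W n t))).
    set a := `|W n t|; have a0 : 0 <= a by exact: normr_ge0.
    rewrite -(ler_pM2l e4).
    have -> : e / 4 * (e / 4 + (e / 4)^-1 * a ^+ 2) = (e / 4) ^+ 2 + a ^+ 2.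
      by field; rewrite gt_eqF.
    have := sqr_ge0 (a - e / 4); nra.
  rewrite meanD ?mean_cst; [|exact: L1_cst|exact: L1Z].
  rewrite meanZ// lerD2l mulrC ler_pM2r// invr_gt0//.
have small : v / n%:R <= (e / 4) ^+ 2.
  rewrite ler_pdivrMr ?ltr0n// mulrC -ler_pdivrMr ?exprn_gt0//.
  near: n; exists (Num.truncn (v / (e / 4) ^+ 2)).+1 => // n /= nn.
  by apply: ltW; apply: lt_le_trans (truncnS_gt _) _; rewrite ler_nat.
have EW' : mean P (fun t => `|W n t|) <= e / 4 + e / 4.
  by apply: le_trans EW _; rewrite lerD2l ler_pdivrMr// -expr2.
rewrite ger0_norm; last by apply: mean_ge0.
apply: (@le_trans _ _ (mean P (fun t =>
   `|W n t| + average (fun z => `|h z - k z|) (n, t) + e / 4))).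
  apply: le_mean.
  - by apply: L1_norm; apply: L1B; [exact: iavg|exact: L1_cst].
  - by apply: L1D; [apply: L1D => //; exact: L1_norm|exact: L1_cst].
  - by move=> t; exact: split_avg.
rewrite meanD; [|by apply: L1D => //; exact: L1_norm|exact: L1_cst].
rewrite meanD//; last exact: L1_norm.
rewrite mean_cst; lra.
Unshelve. all: by end_near. Qed.

End averages.

(** * Characteristic functions of normalized sums *)

Section trigonometric_bounds.
Context {R : realType}.
Implicit Types (x y : R).

Lemma le_of_derive_ge0 (f df : R -> R) : (forall x, is_derive x (1 : R) f (df x)) ->
  (forall x, 0 <= x -> 0 <= df x) -> forall x, 0 <= x -> f 0 <= f x.
Proof.
move=> fdf df0 x x0; rewrite -subr_ge0.
have cf : {within `[0, x], continuous f}.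
  apply: continuous_subspaceT => y; apply: differentiable_continuous.
  by apply/derivable1_diffP; have [] := fdf y.
have [c] := MVT_segment x0 (fun y _ => fdf y) cf.
rewrite in_itv /= => /andP[c0 _] ->; rewrite subr0; apply: mulr_ge0 => //.
exact: df0.
Qed.

Lemma sin_le x : 0 <= x -> sin x <= x.
Proof.
move=> x0; rewrite -subr_ge0.
have := @le_of_derive_ge0 (fun x => x - sin x) (fun x => 1 - cos x) _ _ x x0.
rewrite sin0 subr0; apply => y _; by rewrite subr_ge0 cos_le1.
Qed.

Lemma cos_ge x : 1 - x ^+ 2 / 2 <= cos x.
Proof.
wlog x0 : x / 0 <= x.
  move=> H; have [x0|x0] := leP 0 x; first exact: H.
  have := H (- x); rewrite sqrrN cosN; apply; rewrite oppr_ge0; exact: ltW.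
rewrite -subr_ge0.
have := @le_of_derive_ge0 (fun x => cos x - (1 - x ^+ 2 / 2)) (fun x => x - sin x) _ _ x x0.
rewrite cos0 expr0n mul0r subr0 subrr; apply => [y|y y0]; last by rewrite subr_ge0 sin_le.
apply: is_derive_eq; rewrite /GRing.scale /=.
by field.
Qed.
Lemma sin_ge x : 0 <= x -> x - x ^+ 3 / 6 <= sin x.
Proof.
move=> x0; rewrite -subr_ge0.
have := @le_of_derive_ge0 (fun x => sin x - (x - x ^+ 3 / 6))
  (fun x => cos x - (1 - x ^+ 2 / 2)) _ _ x x0.
rewrite sin0 expr0n mul0r subr0 subrr; apply => [y|y _]; last by rewrite subr_ge0 cos_ge.
apply: is_derive_eq; rewrite /GRing.scale /=.
by field.
Qed.

Lemma cos_le x : cos x <= 1 - x ^+ 2 / 2 + x ^+ 4 / 24.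
Proof.
wlog x0 : x / 0 <= x.
  move=> H; have [x0|x0] := leP 0 x; first exact: H.
  have -> : x ^+ 4 = (- x) ^+ 4 by ring.
  by have := H (- x); rewrite sqrrN cosN; apply; rewrite oppr_ge0; exact: ltW.
rewrite -subr_ge0.
have := @le_of_derive_ge0 (fun x => 1 - x ^+ 2 / 2 + x ^+ 4 / 24 - cos x)
  (fun x => sin x - (x - x ^+ 3 / 6)) _ _ x x0.
rewrite cos0 !expr0n !mul0r subr0 addr0 subrr; apply => [y|y y0]; last by rewrite subr_ge0 sin_ge.
apply: is_derive_eq; rewrite /GRing.scale /=.
by field.
Qed.

Lemma cos_taylor x : `|1 - cos x - x ^+ 2 / 2| <= x ^+ 4 / 24.
Proof.
have := cos_ge x; have := cos_le x; set u := x ^+ 2 / 2; set v := x ^+ 4 / 24.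
by move=> h1 h2; rewrite ler_norml; apply/andP; split; lra.
Qed.

Lemma cos_quadratic x : `|1 - cos x| <= x ^+ 2 / 2.
Proof.
rewrite ger0_norm ?subr_ge0 ?cos_le1//.
have := cos_ge x; set u := x ^+ 2 / 2; lra.
Qed.

Lemma sin_cubic x : `|x - sin x| <= `|x| ^+ 3 / 6.
Proof.
wlog x0 : x / 0 <= x.
  move=> H; have [x0|x0] := leP 0 x; first exact: H.
  have := H (- x); rewrite sinN -opprD !normrN; apply; rewrite oppr_ge0; exact: ltW.
rewrite ger0_norm ?subr_ge0 ?sin_le// ger0_norm//.
have := sin_ge x0; set u := x ^+ 3 / 6; lra.
Qed.

Lemma sin_quadratic x : `|x - sin x| <= x ^+ 2 / 2.
Proof.
wlog x0 : x / 0 <= x.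
  move=> H; have [x0|x0] := leP 0 x; first exact: H.
  have := H (- x); rewrite sinN -opprD !normrN sqrrN.
  by apply; rewrite oppr_ge0; exact: ltW.
rewrite ger0_norm ?subr_ge0 ?sin_le//.
have step y : 0 <= y -> 0 <= y - (1 - cos y).
  move=> y0; have := @le_of_derive_ge0 (fun x => x - (1 - cos x))
    (fun x => 1 - sin x) _ _ y y0.
  rewrite cos0 !subrr; apply => [z|z _]; last by rewrite subr_ge0 sin_le1.
  by apply: is_derive_eq; ring.
have := @le_of_derive_ge0 (fun x => x ^+ 2 / 2 - (x - sin x))
  (fun x => x - (1 - cos x)) _ _ x x0.
rewrite sin0 expr0n mul0r !subrr subr_ge0; apply => //.
move=> y; apply: is_derive_eq; rewrite /GRing.scale /=; by field.
Qed.

Lemma expR_quadratic x : 0 <= x -> `|1 - expR (- x) - x| <= x ^+ 2.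
Proof.
move=> x0; have h1 := expR_ge1Dx (- x); have h2 := expR_ge1Dx x.
have h3 : 1 - expR (- x) >= x - x ^+ 2.
  have e0 := expR_gt0 (- x); have e1 := expRxMexpNx_1 x.
  have := ler_wpM2l (ltW e0) h2; rewrite [expR (- x) * expR x]mulrC e1; nra.
rewrite ler_norml; apply/andP; split; nra.
Qed.

End trigonometric_bounds.

Section trigonometric_clt.
Context (R : realType) (d d1 : measure_display) (T : measurableType d)
  (S : measurableType d1) (P : probability T R).
Context (Zs : nat -> T -> S) (Z : T -> S).
Context (mZs : forall i, measurable_fun setT (Zs i)) (mZ : measurable_fun setT Z)
  (iid : iid_copies P Zs Z).
Context (h : S -> R) (mh : measurable_fun setT h).
Hypothesis h0 : mean P (fun t => h (Z t)) = 0.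
Hypothesis ih2 : L1 P (fun t => h (Z t) ^+ 2).

Let v := mean P (fun t => h (Z t) ^+ 2).
Let v0 : 0 <= v. Proof. by apply: mean_ge0 => t; exact: sqr_ge0. Qed.
Let mhZ : measurable_fun setT (fun t => h (Z t)).
Proof. exact: measurableT_comp. Qed.

Let measurable_sin_comp (f : T -> R) : measurable_fun setT f ->
  measurable_fun setT (fun t => sin (f t)).
Proof.
move=> mf; apply: measurableT_comp => //.
by apply: continuous_measurable_fun; exact: continuous_sin.
Qed.

Let measurable_cos_comp (f : T -> R) : measurable_fun setT f ->
  measurable_fun setT (fun t => cos (f t)).
Proof.
move=> mf; apply: measurableT_comp => //.
by apply: continuous_measurable_fun; exact: continuous_cos.
Qed.

(** Adding one independent summand multiplies the cosine mean by the cosine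
    mean of the summand, up to the mean of its sine. *)
Let cos_sum_bound (s q : R) (k : nat) (a : R) : 0 <= q <= 1 ->
  `|mean P (fun t => cos (a + s * \sum_(i < k) h (Zs i t))) - q ^+ k * cos a|
  <= k%:R * (`|mean P (fun t => cos (s * h (Z t))) - q|
             + `|mean P (fun t => sin (s * h (Z t)))|).
Proof.
move=> /andP[q0 q1]; set r := (X in _ <= _ * X).
have r0 : 0 <= r by rewrite addr_ge0.
elim: k a => [|k IH] a.
  by under eq_mean do rewrite big_ord0 mulr0 addr0; rewrite mean_cst mul1r subrr normr0 mul0r.
pose V t := \sum_(i < k) h (Zs i t).
have mV : measurable_fun setT V by exact: (measurable_partial_sum mZs mh k).
have mhk : measurable_fun setT (fun t => h (Zs k t)) by exact: measurableT_comp.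
have VZ : indep P V (Zs k) := partial_sum_indep mZs iid mh k.
have mcosa : measurable_fun setT (fun y : R => cos (a + s * y)).
  apply: continuous_measurable_fun => y.
  apply: continuous_comp; last exact: continuous_cos.
  by apply: cvgD; [exact: cvg_cst|apply: cvgM; [exact: cvg_cst|exact: cvg_id]].
have msina : measurable_fun setT (fun y : R => sin (a + s * y)).
  apply: continuous_measurable_fun => y.
  apply: continuous_comp; last exact: continuous_sin.
  by apply: cvgD; [exact: cvg_cst|apply: cvgM; [exact: cvg_cst|exact: cvg_id]].
have mcosh : measurable_fun setT (fun z => cos (s * h z)).
  apply: measurableT_comp; last exact: measurable_funM.
  by apply: continuous_measurable_fun; exact: continuous_cos.
have msinh : measurable_fun setT (fun z => sin (s * h z)).
  apply: measurableT_comp; last exact: measurable_funM.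
  by apply: continuous_measurable_fun; exact: continuous_sin.
have i1 : L1 P (fun t => cos (a + s * V t)).
  by apply: (@L1_bounded _ _ _ _ _ 1); [exact: (measurableT_comp mcosa mV)|move=> t; exact: cos_max].
have i2 : L1 P (fun t => sin (a + s * V t)).
  by apply: (@L1_bounded _ _ _ _ _ 1); [exact: (measurableT_comp msina mV)|move=> t; exact: sin_max].
have j1 : L1 P (fun t => cos (s * h (Z t))).
  by apply: (@L1_bounded _ _ _ _ _ 1); [exact: (measurableT_comp mcosh mZ)|move=> t; exact: cos_max].
have j2 : L1 P (fun t => sin (s * h (Z t))).
  by apply: (@L1_bounded _ _ _ _ _ 1); [exact: (measurableT_comp msinh mZ)|move=> t; exact: sin_max].
have [I1 E1] := indep_mul (measurableT_comp mcosa mV) (measurableT_comp mcosh (mZs k))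
  (indep_comp mcosa mcosh VZ) i1 (iid_L1 mZs mZ iid k mcosh j1).
have [I2 E2] := indep_mul (measurableT_comp msina mV) (measurableT_comp msinh (mZs k))
  (indep_comp msina msinh VZ) i2 (iid_L1 mZs mZ iid k msinh j2).
have -> : mean P (fun t => cos (a + s * \sum_(i < k.+1) h (Zs i t))) =
    mean P (fun t => cos (a + s * V t)) * mean P (fun t => cos (s * h (Z t)))
    - mean P (fun t => sin (a + s * V t)) * mean P (fun t => sin (s * h (Z t))).
  rewrite -(iid_mean mZs mZ iid k mcosh j1) -(iid_mean mZs mZ iid k msinh j2).
  rewrite -E1 -E2 -meanB//; apply: eq_mean => t.
  rewrite big_ord_recr /= mulrDr addrA; exact: cosD.
set A := mean P (fun t => cos (a + _)); set B := mean P (fun t => sin (a + _)).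
rewrite /r; set c := mean P _; set sn := mean P _.
have A1 : `|A| <= 1 by apply: norm_mean_le => // t; exact: cos_max.
have B1 : `|B| <= 1 by apply: norm_mean_le => // t; exact: sin_max.
have -> : A * c - B * sn - q ^+ k.+1 * cos a =
    A * (c - q) + q * (A - q ^+ k * cos a) - B * sn by rewrite exprS; ring.
apply: le_trans (ler_normB _ _) _; rewrite -addn1 natrD mulrDl mul1r addrCA.
have h1 : `|A * (c - q) + q * (A - q ^+ k * cos a)| <= `|c - q| + k%:R * r.
  apply: le_trans (ler_normD _ _) _; rewrite !normrM; apply: lerD.
    by rewrite ler_piMl.
  apply: le_trans (IH a); rewrite ger0_norm// ler_piMl//.
have h2 : `|B * sn| <= `|sn| by rewrite normrM ler_piMl.
by rewrite addrA; exact: (lerD h1 h2).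
Qed.

Let sqrt_n0 n : (0 < n)%N -> 0 < Num.sqrt n%:R :> R.
Proof. by move=> n0; rewrite sqrtr_gt0 ltr0n. Qed.

Let cvg_sqrtV : (fun n : nat => (Num.sqrt n%:R : R)^-1) @ \oo --> (0 : R).
Proof.
apply/cvgr0Pnorm_lt => e e0.
exists (Num.truncn (e ^- 2)).+1 => // n /= ne.
have n0 : (0 < n)%N by apply: leq_trans ne.
rewrite ger0_norm ?invr_ge0// -[ltRHS]invrK ltf_pV2 ?posrE ?invr_gt0 ?sqrt_n0//.
rewrite -(ltr_pXn2r (n := 2)) ?nnegrE ?invr_ge0 ?(ltW e0)//.
rewrite sqr_sqrtr// exprVn; apply: lt_le_trans (truncnS_gt _) _.
by rewrite ler_nat.
Qed.

(** n (1 - cos (x / sqrt n)) tends to x^2/2 and never exceeds it, so dominated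
    convergence applies. *)
Let cos_defect : (fun n : nat => n%:R * (1 - mean P (fun t => cos ((Num.sqrt n%:R)^-1 * h (Z t)))))
  @ \oo --> v / 2.
Proof.
pose f n t : R := n%:R * (1 - cos ((Num.sqrt n%:R)^-1 * h (Z t))).
have mf n : measurable_fun setT (f n).
  apply: measurable_funM => //; apply: measurable_funB => //.
  apply: measurable_cos_comp; exact: measurable_funM.
have icos n : L1 P (fun t => cos ((Num.sqrt n%:R)^-1 * h (Z t))).
  apply: (@L1_bounded _ _ _ _ _ 1) => [|t]; last exact: cos_max.
  by apply: measurable_cos_comp; exact: measurable_funM.
have -> : (fun n : nat => n%:R * (1 - mean P (fun t => cos ((Num.sqrt n%:R)^-1 * h (Z t)))))
    = (fun n => mean P (f n)).
  apply/funext => n; rewrite meanZ ?meanB ?mean_cst//; try exact: L1_cst.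
  by apply: L1B => //; exact: L1_cst.
have -> : v / 2 = mean P (fun t => h (Z t) ^+ 2 / 2).
  by under [RHS]eq_mean do rewrite mulrC; rewrite meanZ// mulrC.
have n2 (n : nat) (x : R) : (0 < n)%N -> ((Num.sqrt n%:R)^-1 * x) ^+ 2 = x ^+ 2 / n%:R.
  by move=> n0; rewrite exprMn exprVn sqr_sqrtr// mulrC.
apply: (@mean_dominated_cvg _ _ _ _ _ (fun t => h (Z t) ^+ 2 / 2)) => //.
- by apply: measurable_funM => //; exact: measurable_sqr.
- move=> t; apply: cvg_from0; set x := h (Z t).
  apply/cvgr0Pnorm_le => e e0.
  have e24 : 0 < 24 * e by rewrite mulr_gt0.
  exists (Num.truncn (x ^+ 4 / (24 * e))).+1 => // n /= ne.
  have n0 : (0 < n)%N by apply: leq_trans ne.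
  have nR0 : 0 < n%:R :> R by rewrite ltr0n.
  have -> : f n t - x ^+ 2 / 2 = n%:R * (1 - cos ((Num.sqrt n%:R)^-1 * x)
      - ((Num.sqrt n%:R)^-1 * x) ^+ 2 / 2).
    rewrite n2// /f -/x; field; by rewrite gt_eqF.
  rewrite normrM ger0_norm//.
  apply: le_trans (ler_wpM2l _ (cos_taylor _)) _ => //.
  rewrite [_ ^+ 4](exprM _ 2 2) n2//.
  have xn : x ^+ 4 / (24 * e) <= n%:R.
    by apply: ltW; apply: lt_le_trans (truncnS_gt _) _; rewrite ler_nat.
  have -> : n%:R * ((x ^+ 2 / n%:R) ^+ 2 / 24) = x ^+ 4 / (24 * e) * (e / n%:R).
    by field; rewrite !gt_eqF.
  apply: le_trans (ler_wpM2r _ xn) _; first by rewrite divr_ge0// ltW.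
  by rewrite mulrCA divff ?mulr1// gt_eqF.
- by under eq_fun do rewrite mulrC; exact: L1Z.
- move=> n t; have [->|n0] := posnP n.
    by rewrite /f mul0r normr0 divr_ge0// sqr_ge0.
  rewrite /f normrM ger0_norm//.
  apply: le_trans (ler_wpM2l _ (cos_quadratic _)) _ => //.
  rewrite n2// le_eqVlt; apply/orP; left; apply/eqP; field.
  by rewrite pnatr_eq0 -lt0n.
Qed.

(** Since h is centered, only the difference between the sine and its argument
    contributes. *)
Let sin_defect : (fun n : nat => n%:R * mean P (fun t => sin ((Num.sqrt n%:R)^-1 * h (Z t))))
  @ \oo --> (0 : R).
Proof.
pose f n t : R := n%:R * ((Num.sqrt n%:R)^-1 * h (Z t) - sin ((Num.sqrt n%:R)^-1 * h (Z t))).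
have mf n : measurable_fun setT (f n).
  apply: measurable_funM => //; apply: measurable_funB => //; first exact: measurable_funM.
  apply: measurable_sin_comp; exact: measurable_funM.
have isin n : L1 P (fun t => sin ((Num.sqrt n%:R)^-1 * h (Z t))).
  apply: (@L1_bounded _ _ _ _ _ 1) => [|t]; last exact: sin_max.
  by apply: measurable_sin_comp; exact: measurable_funM.
have ih : L1 P (fun t => h (Z t)) by exact: L1_of_sqr.
have -> : (fun n : nat => n%:R * mean P (fun t => sin ((Num.sqrt n%:R)^-1 * h (Z t))))
    = (fun n => - mean P (f n)).
  apply/funext => n; rewrite meanZ ?meanB//; last 2 first.
  - exact: L1Z.
  - by apply: L1B => //; exact: L1Z.
  by rewrite meanZ// h0 mulr0 sub0r mulrN opprK.
have n2 (n : nat) (x : R) : (0 < n)%N -> ((Num.sqrt n%:R)^-1 * x) ^+ 2 = x ^+ 2 / n%:R.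
  by move=> n0; rewrite exprMn exprVn sqr_sqrtr// mulrC.
rewrite -oppr0; apply: cvgN; rewrite -[X in _ --> X](mean_cst P 0).
apply: (@mean_dominated_cvg _ _ _ _ _ (fun t => h (Z t) ^+ 2 / 2)) => //.
- move=> t; set x := h (Z t).
  have bnd n : `|f n t| <= `|x| ^+ 3 / 6 * (Num.sqrt n%:R)^-1.
    have [->|n0] := posnP n.
      by rewrite /f mul0r normr0 !mulr_ge0 ?invr_ge0.
    rewrite /f normrM ger0_norm//.
    apply: le_trans (ler_wpM2l _ (sin_cubic _)) _ => //.
    rewrite -/x normrM exprMn ger0_norm ?invr_ge0//.
    rewrite -{1}(sqr_sqrtr (ler0n R n)) le_eqVlt; apply/orP; left; apply/eqP; field.
    by rewrite gt_eqF// sqrt_n0.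
  apply/norm_cvg0P.
  apply: (squeeze_cvgr (f := fun=> 0) (h := fun n => `|x| ^+ 3 / 6 * (Num.sqrt n%:R)^-1)).
  + by apply: nearW => n; rewrite normr_ge0 bnd.
  + exact: cvg_cst.
  + by rewrite -[X in _ --> X](mulr0 (`|x| ^+ 3 / 6)); apply: cvgMr.
- by under eq_fun do rewrite mulrC; exact: L1Z.
- move=> n t; have [->|n0] := posnP n.
    by rewrite /f mul0r normr0 divr_ge0// sqr_ge0.
  rewrite /f normrM ger0_norm//.
  apply: le_trans (ler_wpM2l _ (sin_quadratic _)) _ => //.
  rewrite n2// le_eqVlt; apply/orP; left; apply/eqP; field.
  by rewrite pnatr_eq0 -lt0n.
Qed.

(** The factor q of [cos_sum_bound] is chosen so that its n-th power is exactly
    the limit; the error then splits into the defects of the cosine, of the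
    exponential and of the sine. *)
Theorem cos_clt (a : R) :
  (fun n => mean P (fun t => cos (a + root_sum Zs h (n, t)))) @ \oo -->
  expR (- (v / 2)) * cos a.
Proof.
pose q n : R := expR (- (v / (2 * n%:R))).
pose c n : R := mean P (fun t => cos ((Num.sqrt n%:R)^-1 * h (Z t))).
pose sn n : R := mean P (fun t => sin ((Num.sqrt n%:R)^-1 * h (Z t))).
apply: cvg_from0; apply/norm_cvg0P.
apply: (squeeze_cvgr (f := fun=> 0)
  (h := fun n => `|n%:R * (1 - c n) - v / 2| + `|v ^+ 2 / 4 * n%:R^-1| + `|n%:R * sn n|)).
- exists 1%N => // n /= n0; rewrite normr_ge0 /=.
  have nR0 : 0 < n%:R :> R by rewrite ltr0n.
  have q01 : 0 <= q n <= 1.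
    rewrite /q expR_ge0 expR_le1 oppr_le0 divr_ge0 ?mulr_ge0//.
  have qn : q n ^+ n = expR (- (v / 2)).
    by rewrite /q -expRM_natl; congr expR; field; rewrite gt_eqF.
  have := cos_sum_bound (Num.sqrt n%:R)^-1 n a q01; rewrite qn => H.
  apply: le_trans H _; rewrite -/(c n) -/(sn n) mulrDr; apply: lerD; last first.
    by rewrite normrM ger0_norm.
  have -> : c n - q n = n%:R^-1 * ((n%:R * (1 - q n) - v / 2) - (n%:R * (1 - c n) - v / 2)).
    by field; rewrite gt_eqF.
  rewrite normrM mulrA ger0_norm ?invr_ge0// divff ?gt_eqF// mul1r.
  apply: le_trans (ler_normB _ _) _; rewrite addrC lerD2l.
  have x0 : 0 <= v / (2 * n%:R) by rewrite divr_ge0 ?mulr_ge0.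
  have -> : n%:R * (1 - q n) - v / 2 = n%:R * (1 - q n - v / (2 * n%:R)).
    by field; rewrite gt_eqF.
  rewrite normrM ger0_norm//; apply: le_trans (ler_wpM2l _ (expR_quadratic x0)) _ => //.
  apply: le_trans (ler_norm _); rewrite le_eqVlt; apply/orP; left; apply/eqP; field.
  by rewrite gt_eqF.
- exact: cvg_cst.
- rewrite (_ : (0 : R) = 0 + 0 + 0); last by rewrite !addr0.
  apply: cvgD; first apply: cvgD.
  + by apply/norm_cvg0P; apply: cvg_to0; exact: cos_defect.
  + apply/norm_cvg0P; rewrite -[X in _ --> X](mulr0 (v ^+ 2 / 4)); apply: cvgMr.
    rewrite (_ : (fun n : nat => _) = (fun n => (Num.sqrt n%:R)^-1 * (Num.sqrt n%:R)^-1 : R)).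
      by apply: (cvgM_to cvg_sqrtV cvg_sqrtV); rewrite mulr0.
    by apply/funext => n; rewrite -expr2 exprVn sqr_sqrtr.
  + by apply/norm_cvg0P; exact: sin_defect.
Qed.

End trigonometric_clt.

(** * Bernstein operators and trigonometric polynomials *)

Section dotp_algebra.
Context {R : realType} {m : nat}.
Implicit Types (l u v x : 'cV[R]_m) (c : R).

Lemma dotpDl u v x : dotp (u + v) x = dotp u x + dotp v x.
Proof. by rewrite !dotpE -big_split; apply: eq_bigr => j _; rewrite mxE mulrDl. Qed.

Lemma dotpZl c u x : dotp (c *: u) x = c * dotp u x.
Proof. by rewrite !dotpE mulr_sumr; apply: eq_bigr => j _; rewrite mxE mulrA. Qed.

Lemma dotpNl u x : dotp (- u) x = - dotp u x.
Proof. by rewrite -scaleN1r dotpZl mulN1r. Qed.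

Lemma dotpBl u v x : dotp (u - v) x = dotp u x - dotp v x.
Proof. by rewrite dotpDl dotpNl. Qed.

Lemma dotp0l x : dotp 0 x = 0.
Proof. by rewrite dotpE big1// => j _; rewrite mxE mul0r. Qed.

Lemma dotpC u v : dotp u v = dotp v u.
Proof. by rewrite !dotpE; apply: eq_bigr => j _; rewrite mulrC. Qed.

Lemma dotpDr u v x : dotp x (u + v) = dotp x u + dotp x v.
Proof. by rewrite dotpC dotpDl !(dotpC x). Qed.

Lemma dotpZr c u x : dotp x (c *: u) = c * dotp x u.
Proof. by rewrite dotpC dotpZl (dotpC x). Qed.

Lemma dotp_basis (j : 'I_m) x : dotp (basisv R j) x = x j 0.
Proof.
rewrite dotpE (bigD1 j)//= big1 => [|k kj]; last by rewrite mxE (negbTE kj) mul0r.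
by rewrite mxE !eqxx mul1r addr0.
Qed.

Lemma continuous_dotp l : continuous (dotp l).
Proof.
move=> x; rewrite (_ : dotp l = fun y => \sum_j l j 0 * y j 0); last first.
  by apply/funext => y; rewrite dotpE.
apply: (@cvg_sum _ _ (nbhs x)) => j; apply: cvgM; first exact: cvg_cst.
exact: coord_continuous.
Qed.

Lemma measurable_dotp l : measurable_fun setT (dotp l : rvec R m -> R).
Proof. apply: continuous_measurable_rvec; exact: continuous_dotp. Qed.

Lemma coord_norm_le x j : `|x j 0| <= `|x|.
Proof.
rewrite [leRHS]/Num.norm /= mx_normrE; apply/bigmax_geP; right => /=.
by exists (j, 0).
Qed.

Lemma norm_le_coord x c : 0 <= c -> (forall j, `|x j 0| <= c) -> `|x| <= c.
Proof.
move=> c0 H; rewrite [leLHS]/Num.norm /= mx_normrE; apply/bigmax_leP; split => //.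
by move=> [i j] _; rewrite (ord1 j); exact: H.
Qed.

End dotp_algebra.

(** Bernstein operator in one variable, by recursion on the degree: the mean
    of [phi] under the binomial law with parameters [N] and [s]. *)
Fixpoint bernstein (R : realType) (N : nat) (s : R) (phi : nat -> R) : R :=
  if N is N'.+1 then s * bernstein N' s (phi \o S) + (1 - s) * bernstein N' s phi
  else phi 0%N.

Section bernstein.
Context {R : realType}.
Implicit Types (s c : R) (phi psi : nat -> R).

Lemma bernsteinD N s phi psi :
  bernstein N s (fun i => phi i + psi i) = bernstein N s phi + bernstein N s psi.
Proof.
elim: N phi psi => //= N IH phi psi.
by rewrite (IH (phi \o S) (psi \o S)) IH; ring.
Qed.

Lemma bernsteinZ N s c phi :
  bernstein N s (fun i => c * phi i) = c * bernstein N s phi.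
Proof.
elim: N phi => //= N IH phi.
by rewrite (IH (phi \o S)) IH; ring.
Qed.

Lemma bernstein_cst N s c : bernstein N s (fun=> c) = c.
Proof. by elim: N => //= N IH; rewrite (_ : _ \o S = fun=> c)// IH; ring. Qed.

Lemma le_bernstein N s phi psi : 0 <= s <= 1 -> (forall i, phi i <= psi i) ->
  bernstein N s phi <= bernstein N s psi.
Proof.
move=> /andP[s0 s1]; elim: N phi psi => //= N IH phi psi H.
by apply: lerD; apply: ler_wpM2l; rewrite ?subr_ge0//; apply: IH => i; exact: H.
Qed.

(** Second moment of the binomial law about an arbitrary point. *)
Lemma bernstein_sqr N s c : bernstein N s (fun i => (i%:R - c) ^+ 2) =
  N%:R * (s * (1 - s)) + (N%:R * s - c) ^+ 2.
Proof.
elim: N c => [|N IH] c /=; first by ring.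
rewrite IH (_ : _ \o S = fun i => (i%:R - (c - 1)) ^+ 2).
  by rewrite IH -[N.+1]addn1 natrD; ring.
by apply/funext => i /=; rewrite -[i.+1]addn1 natrD opprB addrA addrAC.
Qed.

End bernstein.

Section bernstein_multivariate.
Context {R : realType} {I : eqType} (N : nat) (s : I -> R).
Implicit Types (l : seq I) (k : I -> nat) (phi psi : (I -> nat) -> R).

Definition update k (j : I) (n : nat) : I -> nat := fun i => if i == j then n else k i.

(** The operator applied successively to the coordinates listed in [l]. *)
Fixpoint bernsteins l phi k : R :=
  if l is j :: l' then bernstein N (s j) (fun n => bernsteins l' phi (update k j n))
  else phi k.

Lemma bernsteinsD l phi psi k :
  bernsteins l (fun k => phi k + psi k) k = bernsteins l phi k + bernsteins l psi k.
Proof.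
elim: l k => //= j l IH k; rewrite -bernsteinD; congr bernstein.
by apply/funext => n; exact: IH.
Qed.

Lemma bernsteinsZ l c phi k :
  bernsteins l (fun k => c * phi k) k = c * bernsteins l phi k.
Proof.
elim: l k => //= j l IH k; rewrite -bernsteinZ; congr bernstein.
by apply/funext => n; exact: IH.
Qed.

Lemma bernsteins_cst l c k : bernsteins l (fun=> c) k = c.
Proof.
elim: l k => //= j l IH k; rewrite -[RHS](bernstein_cst N (s j)); congr bernstein.
by apply/funext => n; exact: IH.
Qed.

Lemma bernsteins_sum (J : Type) (r : seq J) l (F : J -> (I -> nat) -> R) k :
  bernsteins l (fun k => \sum_(j <- r) F j k) k = \sum_(j <- r) bernsteins l (F j) k.
Proof.
elim: r => [|j r IH].
  rewrite big_nil -[RHS](bernsteins_cst l 0 k); congr bernsteins.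
  by apply/funext => ?; rewrite big_nil.
rewrite big_cons -IH -bernsteinsD; congr bernsteins.
by apply/funext => ?; rewrite big_cons.
Qed.

Hypothesis s01 : forall j, 0 <= s j <= 1.

Lemma le_bernsteins l phi psi k : (forall k, phi k <= psi k) ->
  bernsteins l phi k <= bernsteins l psi k.
Proof. by move=> H; elim: l k => //= j l IH k; exact: le_bernstein. Qed.

Lemma bernsteins_norm l phi k c : (forall k, `|phi k| <= c) ->
  `|bernsteins l phi k| <= c.
Proof.
move=> H; rewrite ler_norml -{1}(bernsteins_cst l (- c) k) -{2}(bernsteins_cst l c k).
apply/andP; split; apply: le_bernsteins => k'; by have := H k'; rewrite ler_norml => /andP[].
Qed.

Lemma bernsteins_coord l i (psi : nat -> R) k : i \in l ->
  bernsteins l (fun k => psi (k i)) k = bernstein N (s i) psi.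
Proof.
have notin l' k' : i \notin l' -> bernsteins l' (fun k => psi (k i)) k' = psi (k' i).
  elim: l' k' => //= j l' IH k'; rewrite inE negb_or => /andP[ij il'].
  rewrite -[RHS](bernstein_cst N (s j)); congr bernstein; apply/funext => n.
  by rewrite IH// /update (negbTE ij).
elim: l k => //= j l IH k; have [il _|il] := boolP (i \in l).
  rewrite -[RHS](bernstein_cst N (s j)); congr bernstein; apply/funext => n.
  exact: IH.
rewrite inE (negbTE il) orbF => /eqP <-; congr bernstein; apply/funext => n.
by rewrite notin// /update eqxx.
Qed.

End bernstein_multivariate.

Section trigonometric_polynomials.
Context {R : realType} {m : nat}.

(** Sums of phase-shifted cosines of linear forms. *)
Definition trigpoly (r : seq (R * R * 'cV[R]_m)) (x : 'cV[R]_m) : R :=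
  \sum_(q <- r) q.1.1 * cos (q.1.2 + dotp q.2 x).

Definition is_trig (g : 'cV[R]_m -> R) : Prop := exists r, g =1 trigpoly r.

Lemma trig_cst c : is_trig (fun=> c).
Proof.
exists [:: (c, 0, 0)] => x; rewrite /trigpoly big_seq1 /= dotp0l addr0 cos0.
by rewrite mulr1.
Qed.

Lemma trigD f g : is_trig f -> is_trig g -> is_trig (fun x => f x + g x).
Proof.
by move=> [r fr] [s gs]; exists (r ++ s) => x; rewrite fr gs /trigpoly big_cat.
Qed.

Lemma trigM f g : is_trig f -> is_trig g -> is_trig (fun x => f x * g x).
Proof.
move=> [r fr] [s gs].
suff : is_trig (fun x => trigpoly r x * trigpoly s x).
  by move=> [u H]; exists u => x; rewrite fr gs.
elim: r {fr} => [|[[c a] t] r [u IH]].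
  by exists [::] => x; rewrite /trigpoly !big_nil mul0r.
suff [v H] : is_trig (fun x => c * cos (a + dotp t x) * trigpoly s x).
  exists (v ++ u) => x; rewrite /trigpoly big_cons mulrDl big_cat -/(trigpoly v x).
  by rewrite -H; congr (_ + _); exact: IH.
elim: s {f g gs IH u r} => [|[[c' a'] t'] s [v IH]].
  by exists [::] => x; rewrite /trigpoly !big_nil mulr0.
exists [:: (c * c' / 2, a + a', t + t'), (c * c' / 2, a - a', t - t') & v] => x.
rewrite /trigpoly !big_cons -/(trigpoly v x) -IH mulrDr addrA; congr (_ + _) => /=.
rewrite dotpDl dotpBl.
have -> : a + a' + (dotp t x + dotp t' x) = (a + dotp t x) + (a' + dotp t' x) by ring.
have -> : a - a' + (dotp t x - dotp t' x) = (a + dotp t x) - (a' + dotp t' x) by ring.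
by move: (a + dotp t x) (a' + dotp t' x) => A B; rewrite cosD cosB; field.
Qed.

Lemma trig_sin (c : R) j : is_trig (fun x => sin (c * x j 0)).
Proof.
exists [:: (1, - (pi / 2), c *: basisv R j)] => x.
by rewrite /trigpoly big_seq1 /= mul1r dotpZl dotp_basis addrC cosBpihalf.
Qed.

Lemma trig_bernstein N (s : 'cV[R]_m -> R) (phi : 'cV[R]_m -> nat -> R) :
  is_trig s -> (forall i, is_trig (phi ^~ i)) ->
  is_trig (fun x => bernstein N (s x) (phi x)).
Proof.
move=> ts; elim: N phi => [|N IH] phi tphi /=; first exact: tphi.
apply: trigD; apply: trigM => //.
- by apply: (IH (fun x => phi x \o S)) => i; exact: tphi.
- apply: trigD; first exact: trig_cst.
  by have := trigM (trig_cst (-1)) ts; under eq_fun do rewrite mulN1r.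
- exact: IH.
Qed.

Lemma trig_bernsteins N (s : 'I_m -> 'cV[R]_m -> R) (l : seq 'I_m)
  (phi : ('I_m -> nat) -> R) k : (forall j, is_trig (s j)) ->
  is_trig (fun x => bernsteins N (s ^~ x) l phi k).
Proof.
move=> ts; elim: l k => [|j l IH] k /=; first exact: trig_cst.
by apply: trig_bernstein => // n; exact: IH.
Qed.

Lemma trig_continuous g : is_trig g -> continuous g.
Proof.
move=> [r /funext ->] x; rewrite /trigpoly; apply: (@cvg_sum _ _ (nbhs x)) => q.
apply: cvgM; first exact: cvg_cst.
apply: continuous_comp; last exact: continuous_cos.
by apply: continuousD; [exact: cst_continuous|exact: continuous_dotp].
Qed.

End trigonometric_polynomials.

(** * Trigonometric approximation of bounded continuous functions *)

Section trigonometric_approximation.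
Context {R : realType}.

Lemma cos_ge_cos1 (x : R) : `|x| <= 1 -> cos 1 <= cos x.
Proof.
move=> x1; rewrite -(cos_norm x) leNgt.
have h1 : (1 : R) \in `[0, pi] by rewrite in_itv /= ler01 (le_trans _ (@pi_ge2 R))// ler1n.
have h2 : `|x| \in `[0, pi].
  by rewrite in_itv /= normr_ge0 (le_trans x1)// (le_trans _ (@pi_ge2 R))// ler1n.
by rewrite (ltr_cos h1 h2) -leNgt.
Qed.

(** Mean value theorem; the derivative of the sine is at least cos 1 on
    [-1, 1]. *)
Lemma sin_expanding (a b : R) : `|a| <= 1 -> `|b| <= 1 ->
  cos 1 * `|a - b| <= `|sin a - sin b|.
Proof.
wlog ab : a b / b <= a.
  move=> H a1 b1; have [ba|ab] := leP b a; first exact: H.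
  by rewrite distrC [leRHS]distrC; apply: H => //; exact: ltW.
move=> a1 b1.
have cs : {within `[b, a], continuous (@sin R)}.
  by apply: continuous_subspaceT; exact: continuous_sin.
have [c] := MVT_segment ab (fun y _ => is_derive_sin y) cs.
rewrite in_itv /= => /andP[bc ca] ->; rewrite normrM ler_wpM2r//.
apply: le_trans (ler_norm _); apply: cos_ge_cos1.
by move: a1 b1; rewrite !ler_norml => /andP[? ?] /andP[? ?]; apply/andP; split; lra.
Qed.

(** Projection on the range of the sine over [-1, 1]. *)
Definition clamp (y : R) : R := Num.max (- sin 1) (Num.min y (sin 1)).

Let sin1_ge0 : 0 <= sin (1 : R).
Proof. by apply: sin_ge0_pi; rewrite ler01 (le_trans _ (@pi_ge2 R))// ler1n. Qed.

Lemma clamp_le y : `|clamp y| <= sin 1.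
Proof.
rewrite /clamp ler_norml le_max lexx /= ge_max ge_min lexx orbT andbT.
by move: sin1_ge0; lra.
Qed.

Lemma clamp_near y z : `|z| <= sin 1 -> `|clamp y - z| <= `|y - z|.
Proof.
rewrite ler_norml => /andP[h1 h2]; have h3 := ler_norm (y - z).
have h4 : z - y <= `|y - z| by rewrite distrC ler_norm.
rewrite ler_norml /clamp; have [h5|h5] := leP y (sin 1); have [h6|h6] := leP (- sin 1) _;
  apply/andP; split; lra.
Qed.

(** Approximate inverse of the map sending a coordinate to the parameter of
    its binomial law. *)
Definition node (A u : R) : R := A * asin (clamp (2 * u - 1)).

(** The parameter of the binomial law for a coordinate y: trigonometric in y,
    and injective for y in [-A, A]. *)
Definition prm (A y : R) : R := (1 + sin (A^-1 * y)) / 2.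

Lemma prm01 A y : 0 <= prm A y <= 1.
Proof. by rewrite /prm; have := sin_le1 (A^-1 * y); have := sin_geN1 (A^-1 * y); lra. Qed.

Lemma node_near A u y : 0 < A -> `|y| <= A ->
  `|y - node A u| <= 2 * A / cos 1 * `|u - prm A y|.
Proof.
move=> A0 yA; rewrite /node /prm; set z := A^-1 * y.
have yz : y = A * z by rewrite /z mulrA divff ?mul1r// gt_eqF.
have z1 : `|z| <= 1.
  by rewrite /z normrM normfV (gtr0_norm A0) mulrC ler_pdivrMr// mul1r.
have c1 : 0 < cos (1 : R) := cos1_gt0 R.
set q := clamp _; have q1 : `|q| <= sin 1 := clamp_le _.
have qin : q \in `[(-1), 1].
  rewrite in_itv /=; move: q1; rewrite ler_norml => /andP[? ?].
  by have := sin_le1 (1 : R); lra.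
have pi2 : (1 : R) <= pi / 2 by have := @pi_ge2 R; lra.
have h1 : (1 : R) \in `[(- (pi / 2)), (pi / 2)] by rewrite in_itv /=; lra.
have hN1 : (- 1 : R) \in `[(- (pi / 2)), (pi / 2)] by rewrite in_itv /=; lra.
have a1 : `|asin q| <= 1.
  have hq : asin q \in `[(- (pi / 2)), (pi / 2)].
    rewrite in_itv /= asin_geNpi2 ?asin_lepi2//; by move: qin; rewrite in_itv.
  move: q1; rewrite !ler_norml => /andP[qa qb]; apply/andP; split; rewrite leNgt.
    by rewrite -(ltr_sin hq hN1) asinK// sinN -leNgt.
  by rewrite -(ltr_sin h1 hq) asinK// -leNgt.
have := sin_expanding a1 z1; rewrite asinK// => H.
have sz : `|sin z| <= sin 1.
  have hz : z \in `[(- (pi / 2)), (pi / 2)].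
    by rewrite in_itv /=; move: z1; rewrite ler_norml => /andP[? ?]; lra.
  rewrite ler_norml -sinN; apply/andP; split; rewrite leNgt.
    by rewrite (ltr_sin hz hN1) -leNgt; move: z1; rewrite ler_norml => /andP[].
  by rewrite (ltr_sin h1 hz) -leNgt; move: z1; rewrite ler_norml => /andP[].
have := le_trans H (clamp_near (2 * u - 1) sz) => H2.
rewrite yz -mulrBr normrM (gtr0_norm A0) distrC.
rewrite -(ler_pM2l c1).
have -> : cos 1 * (2 * A / cos 1 * `|u - (1 + sin z) / 2|) =
    A * `|2 * (u - (1 + sin z) / 2)|.
  by rewrite normrM ger0_norm//; field; rewrite gt_eqF.
rewrite mulrCA ler_pM2l//; apply: le_trans H2 _.
by rewrite le_eqVlt; apply/orP; left; apply/eqP; congr (`|_|); field.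
Qed.

Context {m : nat}.

Lemma norm_trmx_le (v : 'rV[R]_m) : `|v^T| <= `|v|.
Proof.
apply: norm_le_coord => // j; rewrite mxE [leRHS]/Num.norm /= mx_normrE.
by apply/bigmax_geP; right => /=; exists (0, j).
Qed.

Lemma uniform_continuity_box (f : 'cV[R]_m -> R) (A e : R) : continuous f -> 0 < e ->
  exists2 dl : R, 0 < dl & forall x y : 'cV[R]_m, `|x| <= A -> `|x - y| < dl ->
    `|f x - f y| <= e.
Proof.
move=> cf e0.
pose K := [set v : 'rV[R]_m | forall i, v ord0 i \in `[- A, A]].
have cK : compact K.
  apply: (@rV_compact _ _ (fun=> `[- A, A]%classic)) => i; exact: segment_compact.
have e2 : 0 < e / 2 by rewrite divr_gt0.
have := (compact_near_coveringP K).1 cK R (0 : R)^'+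
  (fun dl v => forall y : 'cV[R]_m, `|v^T - y| < dl -> `|f v^T - f y| <= e) _ _.
case.
  move=> v Kv; have /cvgrPdist_lt /(_ _ e2) := cf (v^T).
  move=> /nbhs_ballP[r /= r0 rf].
  have r2 : 0 < r / 2 by rewrite divr_gt0.
  exists (ball v (r / 2), [set i : R | i < r / 2]) => /=.
    split; first exact: nbhsx_ballx.
    exact: nbhs_right_lt.
  move=> [v' i] [/= vv' ir] y v'y.
  have hv : `|v^T - v'^T| < r / 2.
    rewrite -linearB /=; apply: le_lt_trans (norm_trmx_le _) _.
    by move: vv'; rewrite -ball_normE.
  have h1 : `|f v^T - f v'^T| < e / 2.
    apply: rf; rewrite -ball_normE /=; apply: lt_trans hv _.
    by rewrite ltr_pdivrMr// ltr_pMr// ltr1n.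
  have h2 : `|f v^T - f y| < e / 2.
    apply: rf; rewrite -ball_normE /=; apply: le_lt_trans (ler_distD v'^T _ _) _.
    by rewrite [r]splitr; apply: ltrD => //; apply: lt_trans v'y _.
  apply: le_trans (ler_distD (f v^T) _ _) _.
  by rewrite [e]splitr distrC; apply: lerD; exact: ltW.
move=> dl /= d0 H; exists (dl / 2); first by rewrite divr_gt0.
move=> x y xA xy; have := H (dl / 2); rewrite /= sub0r normrN gtr0_norm ?divr_gt0//.
rewrite ltr_pdivrMr// ltr_pMr// ltr1n => /(_ isT) /(_ _ x^T).
rewrite trmxK => /(_ isT); apply => // i; rewrite mxE in_itv /= -ler_norml.
exact: le_trans (coord_norm_le x i) xA.
Qed.

(** On a box the coordinates are recovered from the binomial parameters, so a
    Bernstein operator in these parameters approximates there; its values are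
    averages of values of the function, hence the global bound. *)
Theorem trig_approximation (f : 'cV[R]_m -> R) (M A e : R) :
  continuous f -> (forall x, `|f x| <= M) -> 0 < A -> 0 < e ->
  exists g, [/\ is_trig g, forall x, `|g x| <= M &
    forall x, `|x| <= A -> `|g x - f x| <= e].
Proof.
move=> cf fM A0 e0.
have M0 : 0 <= M by apply: le_trans (fM 0).
have e2 : 0 < e / 2 by rewrite divr_gt0.
have [dl d0 fd] := uniform_continuity_box A cf e2.
have c1 : 0 < cos (1 : R) := cos1_gt0 R.
(* A binomial frequency within r of the parameter puts its node within dl / 2,
   as c is the Lipschitz constant of [node]. *)
pose c := 2 * A / cos 1; have c0 : 0 < c by rewrite divr_gt0// mulr_gt0.
pose r := dl / (2 * c); have r0 : 0 < r by rewrite divr_gt0// mulr_gt0.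
(* By Chebyshev, K times the variances bounds the contribution of the other
   frequencies; the variances are at most 1 / (4 N), so this N leaves e / 2. *)
pose K := 2 * M / r ^+ 2; have K0 : 0 <= K by apply: divr_ge0; [exact: mulr_ge0|exact: sqr_ge0].
pose N := (Num.truncn (K * m%:R / (2 * e))).+1.
have N0 : 0 < N%:R :> R by rewrite ltr0n.
pose s x := fun j : 'I_m => prm A ((x : 'cV[R]_m) j 0).
have s01 x j : 0 <= s x j <= 1 by exact: prm01.
pose phi (k : 'I_m -> nat) : R := f (\col_j node A ((k j)%:R / N%:R)).
exists (fun x => bernsteins N (s x) (enum 'I_m) phi (fun=> 0%N)); split.
- apply: (@trig_bernsteins _ _ N (fun j x => s x j)) => j; rewrite /s /prm.
  have := trigM (trigD (trig_cst 1) (trig_sin A^-1 j)) (trig_cst 2^-1).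
  by [].
- by move=> x; apply: bernsteins_norm => // k; exact: fM.
move=> x xA.
pose Q (k : 'I_m -> nat) : R := \sum_(j <- enum 'I_m) ((k j)%:R / N%:R - s x j) ^+ 2.
have Q0 k : 0 <= Q k by apply: sumr_ge0 => j _; exact: sqr_ge0.
have bound k : `|phi k - f x| <= e / 2 + K * Q k.
  have [H|/existsNP[j]] := pselect (forall j, `|(k j)%:R / N%:R - s x j| < r).
    apply: (@le_trans _ _ (e / 2)); last by rewrite lerDl mulr_ge0.
    rewrite distrC; apply: fd => //.
    apply: (@le_lt_trans _ _ (dl / 2)); last by rewrite ltr_pdivrMr// ltr_pMr// ltr1n.
    apply: norm_le_coord => [|j]; first by rewrite divr_ge0// ltW.
    rewrite !mxE; apply: le_trans (node_near _ A0 _) _.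
      exact: le_trans (coord_norm_le x j) xA.
    rewrite -/c (_ : dl / 2 = c * r); last by rewrite /r; field; rewrite !gt_eqF.
    by rewrite ler_pM2l//; exact: ltW (H j).
  move=> /negP; rewrite -leNgt => H.
  apply: (@le_trans _ _ (2 * M)).
    apply: le_trans (ler_normB _ _) _; rewrite mulr_natl mulr2n.
    by apply: lerD; exact: fM.
  apply: (@le_trans _ _ (K * r ^+ 2)); last first.
    apply: ler_wpDl; first exact: ltW.
    apply: ler_wpM2l => //.
    rewrite /Q (bigD1_seq j) ?mem_enum ?enum_uniq//=.
    apply: ler_wpDr; first by apply: sumr_ge0 => i _; exact: sqr_ge0.
    by rewrite -(real_normK (num_real (_ - _))) ler_pXn2r// ?nnegrE// ltW.
  by rewrite /K divfK// gt_eqF// exprn_gt0.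
have -> : bernsteins N (s x) (enum 'I_m) phi (fun=> 0%N) - f x =
    bernsteins N (s x) (enum 'I_m) (fun k => phi k + (- f x)) (fun=> 0%N).
  by rewrite bernsteinsD bernsteins_cst.
have up : bernsteins N (s x) (enum 'I_m) (fun k => e / 2 + K * Q k) (fun=> 0%N) <= e.
  rewrite bernsteinsD bernsteins_cst bernsteinsZ /Q bernsteins_sum.
  rewrite [leRHS]splitr lerD2l.
  apply: (@le_trans _ _ (K * (m%:R * (4 * N%:R)^-1))).
    apply: ler_wpM2l => //.
    apply: (@le_trans _ _ (\sum_(j <- enum 'I_m) (4 * N%:R)^-1)); last first.
      by rewrite big_enum sumr_const card_ord -[_ *+ m]mulr_natl.
    apply: ler_sum => j _.
    rewrite (@bernsteins_coord _ _ _ _ _ _ (fun i => (i%:R / N%:R - s x j) ^+ 2)) ?mem_enum//.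
    rewrite (_ : (fun i => _) = (fun i : nat => N%:R ^- 2 * (i%:R - N%:R * s x j) ^+ 2)); last first.
      by apply/funext => i; field; rewrite gt_eqF.
    rewrite bernsteinZ bernstein_sqr subrr expr0n addr0.
    have -> : N%:R ^- 2 * (N%:R * (s x j * (1 - s x j))) = (4 * N%:R)^-1 * (4 * (s x j * (1 - s x j))).
      by field; rewrite gt_eqF.
    rewrite -[leRHS]mulr1 ler_pM2l ?invr_gt0 ?mulr_gt0//.
    have := sqr_ge0 (2 * s x j - 1); nra.
  have : K * m%:R / (2 * e) < N%:R by exact: truncnS_gt.
  rewrite ltr_pdivrMr ?mulr_gt0// => h.
  rewrite (_ : K * _ = K * m%:R / (4 * N%:R)); last by rewrite mulrA.
  rewrite ler_pdivrMr ?mulr_gt0//; apply: le_trans (ltW h) _.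
  by rewrite le_eqVlt; apply/orP; left; apply/eqP; field.
rewrite ler_norml; apply/andP; split.
  rewrite lerNl -mulN1r -bernsteinsZ; apply: le_trans up; apply: le_bernsteins => // k.
  rewrite mulN1r; apply: le_trans (bound k); rewrite -normrN; exact: ler_norm.
apply: le_trans up; apply: le_bernsteins => // k.
by apply: le_trans (bound k); exact: ler_norm.
Qed.

End trigonometric_approximation.

(** * Convergence in law from characteristic functions *)

Section bounded_continuous.
Context {R : realType} {m : nat}.

Lemma measurable_normv : measurable_fun setT (fun x : rvec R m => `|(x : 'cV[R]_m)|).
Proof. apply: continuous_measurable_rvec; exact: norm_continuous. Qed.

Lemma measurable_norm_gev (A : R) : measurable [set x : rvec R m | A <= `|(x : 'cV[R]_m)|].
Proof.
have := measurable_normv measurableT (measurable_itv `[A, +oo[); rewrite setTI.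
by congr measurable; apply/seteqP; split => t /=; rewrite in_itv /= andbT.
Qed.

(** Continuity from above along the complements of the balls. *)
Lemma probability_tight (nu : probability (rvec R m) R) (e : R) : 0 < e ->
  exists2 A : R, 0 < A & (nu [set x | (A <= `|(x : 'cV[R]_m)|)%R] <= e%:E)%E.
Proof.
move=> e0.
have : (fun n : nat => mean nu \1_[set x : rvec R m | n%:R <= `|(x : 'cV[R]_m)|])
    @ \oo --> mean nu (fun=> 0 : R).
  apply: (@mean_dominated_cvg _ _ _ _ _ (fun=> 1)) => //.
  - by move=> n; apply: measurable_indic; exact: measurable_norm_gev.
  - move=> x; apply: cvg_near_cst.
    exists (Num.truncn `|(x : 'cV[R]_m)|).+1 => // n /= nx.
    rewrite indicE memNset//= => H.
    have := le_lt_trans H (truncnS_gt _); rewrite ltr_nat ltnS leqNgt.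
    by rewrite nx.
  - exact: L1_cst.
  - move=> n x; rewrite indicE; case: (_ \in _); by rewrite ?normr1 ?normr0.
rewrite mean_cst => /cvgr0Pnorm_le /(_ _ e0) [n _ /(_ n.+1 (leqnSn n)) /= H].
exists n.+1%:R => //; rewrite -mean_indic; last exact: measurable_norm_gev.
by rewrite lee_fin; apply: le_trans (ler_norm _) H.
Qed.

End bounded_continuous.

Section convergence_in_law.
Context (R : realType) (d : measure_display) (T : measurableType d)
  (P : probability T R) (m : nat).
Context (Z : nat -> T -> rvec R m) (nu : probability (rvec R m) R).
Hypothesis mZ : forall n, measurable_fun setT (Z n).
Hypothesis tight : forall e : R, 0 < e -> exists2 A : R, 0 < A &
  \forall n \near \oo, (P [set t | (A <= `|(Z n t : 'cV[R]_m)|)%R] <= e%:E)%E.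
Hypothesis cosZ : forall (a : R) (l : 'cV[R]_m),
  (fun n => mean P (fun t => cos (a + dotp l (Z n t)))) @ \oo -->
  mean nu (fun x => cos (a + dotp l x)).

Let measurable_cos_dotp (a : R) (l : 'cV[R]_m) :
  measurable_fun setT (fun x : rvec R m => cos (a + dotp l x)).
Proof.
apply: (measurableT_comp (f := @cos R)).
  by apply: continuous_measurable_fun; exact: continuous_cos.
apply: measurable_funD => //; exact: measurable_dotp.
Qed.

Let trig_mean (g : 'cV[R]_m -> R) : is_trig g ->
  (fun n => mean P (fun t => g (Z n t))) @ \oo --> mean nu g.
Proof.
move=> [r /funext ->]; rewrite /trigpoly.
have H : forall (d' : measure_display) (S : measurableType d') (Q : probability S R)
    (U : S -> rvec R m), measurable_fun setT U -> forall (q : R * R * 'cV[R]_m),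
    L1 Q (fun t => cos (q.1.2 + dotp q.2 (U t))).
  move=> d' S Q U mU q; apply: (@L1_bounded _ _ _ _ _ 1) => [|t]; last exact: cos_max.
  exact: (measurableT_comp (measurable_cos_dotp q.1.2 q.2) mU).
have E : forall (d' : measure_display) (S : measurableType d') (Q : probability S R)
    (U : S -> rvec R m), measurable_fun setT U ->
    mean Q (fun t => \sum_(q <- r) q.1.1 * cos (q.1.2 + dotp q.2 (U t))) =
    \sum_(q <- r) q.1.1 * mean Q (fun t => cos (q.1.2 + dotp q.2 (U t))).
  move=> d' S Q U mU; rewrite mean_sum; last by move=> q _; apply: L1Z; exact: H.
  by apply: eq_bigr => q _; rewrite meanZ//; exact: H.
under eq_fun => n do rewrite (E _ _ _ _ (mZ n)).
rewrite (E _ _ nu (fun x => x)); last exact: measurable_id.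
by apply: cvg_sum => q; apply: cvgM; [exact: cvg_cst|exact: cosZ].
Qed.

(** The functions differ by at most e on the box, and by at most 2M outside, an
    event of probability at most e'. *)
Lemma mean_close (d' : measure_display) (S : measurableType d') (Q : probability S R)
    (U : S -> rvec R m) (f g : 'cV[R]_m -> R) (M A e e' : R) : 0 <= e -> measurable_fun setT U ->
  continuous f -> continuous g -> (forall x, `|f x| <= M) -> (forall x, `|g x| <= M) ->
  (forall x, `|x| <= A -> `|g x - f x| <= e) ->
  (Q [set t | (A <= `|(U t : 'cV[R]_m)|)%R] <= e'%:E)%E ->
  `|mean Q (fun t => f (U t)) - mean Q (fun t => g (U t))| <= e + 2 * M * e'.
Proof.
move=> e0 mU cf cg fM gM fg QA.
have M0 : 0 <= M by apply: le_trans (fM 0).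
have mf := measurableT_comp (continuous_measurable_rvec cf) mU.
have mg := measurableT_comp (continuous_measurable_rvec cg) mU.
have jf : L1 Q (fun t => f (U t)) by apply: (L1_bounded Q mf) => t; exact: fM.
have jg : L1 Q (fun t => g (U t)) by apply: (L1_bounded Q mg) => t; exact: gM.
set B := [set t | _] in QA.
have mB : measurable B.
  have := mU measurableT _ (measurable_norm_gev A); by rewrite setTI.
rewrite -meanB//; apply: le_trans (norm_mean _) _; first exact: L1B.
have iB := L1_indic Q mB.
apply: (@le_trans _ _ (mean Q (fun t => e + (2 * M) * \1_B t))).
  apply: le_mean; first by apply: L1_norm; exact: L1B.
    by apply: L1D; [exact: L1_cst|exact: L1Z].
  move=> t; rewrite indicE; have [BT|BT] := boolP (t \in B).
    rewrite mulr1 (@le_trans _ _ (2 * M))//.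
      apply: le_trans (ler_normB _ _) _; rewrite mulr_natl mulr2n.
      by apply: lerD; [exact: fM|exact: gM].
    by rewrite lerDr.
  rewrite mulr0 addr0 distrC; apply: fg; apply: ltW; rewrite ltNge; apply/negP => H.
  by move: BT; rewrite notin_setE; exact.
rewrite meanD ?mean_cst; [|exact: L1_cst|exact: L1Z].
rewrite meanZ// lerD2l; apply: ler_wpM2l; first exact: mulr_ge0.
by rewrite -lee_fin mean_indic.
Qed.

(** The test function is replaced by a trigonometric polynomial with the same
    bound that is close to it on a box; tightness makes the complement of the
    box negligible for all large n and for the limit. *)
Theorem cvg_in_law_of_cos : cvg_in_law P Z nu.
Proof.
move=> f cf [M fM].
have M0 : 0 <= M by apply: le_trans (fM 0).
have mf := continuous_measurable_rvec cf.
have jf : L1 nu f by apply: (L1_bounded nu mf) => t; exact: fM.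
suff H : (fun n => mean P (fun t => f (Z n t))) @ \oo --> mean nu f.
  have -> : (fun n => 'E_P[fun o => f (Z n o)]%E) =
      (fun n => (mean P (fun t => f (Z n t)))%:E).
    apply/funext => n; rewrite /mean fineK// unlock integrable_fin_num//.
    apply: (L1_bounded P (measurableT_comp mf (mZ n))) => t; exact: fM.
  by rewrite -EFin_mean//; apply: cvg_EFin; [exact: nearW|exact: H].
apply: cvg_from0; apply/cvgr0Pnorm_le => e e0.
(* Two replacements cost 2 e1 each, one e1 on the box and one e1 outside; the
   fifth e1 is the convergence of the trigonometric means. *)
pose e1 := e / 5; have e10 : 0 < e1 by rewrite divr_gt0.
pose e2 := e1 / (2 * M + 1).
have M10 : 0 < 2 * M + 1 by rewrite ltr_pwDr// mulr_ge0.
have e20 : 0 < e2 by rewrite divr_gt0.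
have Me2 : 2 * M * e2 <= e1.
  by rewrite /e2 mulrA ler_pdivrMr// mulrC ler_pM2l// lerDl.
have [A1 A10 PA1] := tight e20; have [A2 A20 nuA2] := probability_tight nu e20.
pose A := Num.max A1 A2; have A0 : 0 < A by rewrite lt_max A10.
have [g [tg gM gf]] := trig_approximation cf fM A0 e10.
have cg := trig_continuous tg.
have /cvgr0Pnorm_le /(_ _ e10) Hg : (fun n => mean P (fun t => g (Z n t)) - mean nu g)
    @ \oo --> (0 : R) by apply: cvg_to0; exact: trig_mean.
near=> n.
have nA : (P [set t | (A <= `|(Z n t : 'cV[R]_m)|)%R] <= e2%:E)%E.
  apply: (@le_trans _ _ (P [set t | (A1 <= `|(Z n t : 'cV[R]_m)|)%R])); last by near: n.
  have mA c : measurable [set t | (c <= `|(Z n t : 'cV[R]_m)|)%R].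
    by have := mZ n measurableT (measurable_norm_gev c); rewrite setTI.
  apply: le_measure; rewrite ?inE//.
  by move=> t /=; apply: le_trans; rewrite le_max lexx.
have nuA : (nu [set x | (A <= `|(x : 'cV[R]_m)|)%R] <= e2%:E)%E.
  apply: le_trans nuA2; apply: le_measure; rewrite ?inE//; try exact: measurable_norm_gev.
  by move=> t /=; apply: le_trans; rewrite le_max lexx orbT.
have h1 := mean_close (ltW e10) (mZ n) cf cg fM gM gf nA.
have h2 := mean_close (ltW e10) (@measurable_id _ _ setT) cf cg fM gM gf nuA.
have h3 : `|mean P (fun t => g (Z n t)) - mean nu g| <= e1 by near: n.
have -> : mean P (fun t => f (Z n t)) - mean nu f =
  (mean P (fun t => f (Z n t)) - mean P (fun t => g (Z n t)))
  + (mean P (fun t => g (Z n t)) - mean nu g) - (mean nu f - mean nu g) by ring.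
apply: le_trans (ler_normB _ _) _.
have := ler_normD (mean P (fun t => f (Z n t)) - mean P (fun t => g (Z n t)))
  (mean P (fun t => g (Z n t)) - mean nu g).
move: h1 h2 h3; rewrite /e1; move: Me2; rewrite /e1; lra.
Unshelve. all: by end_near. Qed.

End convergence_in_law.

(** * The characteristic function of the normal law *)

Lemma measurable_lebesgue_id (R : realType) :
  measurable_fun setT (fun x : measurableTypeR R => x : R).
Proof. by move=> _ A mA; rewrite setTI. Qed.

(** The centered normal law on the canonical measurable structure of the line,
    which differs from the one that carries Lebesgue measure by its display. *)
Definition normal_law (R : realType) (s : R) : probability R R :=
  @law R _ _ (measurableTypeR R) R (normal_prob 0 s) _ (@measurable_lebesgue_id R).

Section normal_law.
Context {R : realType}.
Variable s : R.
Hypothesis s0 : s != 0.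
Local Notation mu := (@lebesgue_measure R).
Local Notation N0 := (normal_prob 0 s).
Local Notation pdf := (normal_pdf 0 s).
Local Notation N := (normal_law s).

Let dom := @normal_prob_dominates R 0 s.

Let RN_normal : ae_eq mu setT (Radon_Nikodym_SigmaFinite.f N0 mu) (EFin \o pdf).
Proof.
apply: integral_ae_eq => //=.
- exact: Radon_Nikodym_SigmaFinite.f_integrable.
- by apply/measurableT_comp => //; exact: measurable_normal_pdf.
- by move=> E _ mE; rewrite -Radon_Nikodym_SigmaFinite.f_integral.
Qed.

Let mpdf : measurable_fun setT pdf. Proof. exact: measurable_normal_pdf. Qed.

Lemma ge0_integral_normal (f : R -> R) : measurable_fun setT f ->
  (forall x, 0 <= f x) ->
  (\int[N]_x (f x)%:E = \int[mu]_x (f x * pdf x)%:E)%E.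
Proof.
move=> mf f0; rewrite ge0_integral_law; last 2 first.
- exact/measurable_EFinP.
- by move=> y; rewrite lee_fin.
have mfE : measurable_fun setT (EFin \o f : measurableTypeR R -> _) by exact/measurable_EFinP.
rewrite -(Radon_Nikodym_SigmaFinite.change_of_variables dom)//.
apply: ae_eq_integral => //.
- apply: emeasurable_funM => //.
  exact: measurable_int (Radon_Nikodym_SigmaFinite.f_integrable dom).
- by apply/measurable_EFinP; exact: measurable_funM.
- by apply: filterS RN_normal => x /= /(_ I) ->; rewrite EFinM.
Qed.

Lemma L1_normal (f : R -> R) : measurable_fun setT f ->
  L1 N f <-> L1 mu (fun x => f x * pdf x).
Proof.
move=> mf; have mfp : measurable_fun setT (fun x => f x * pdf x) by exact: measurable_funM.
have mnf : measurable_fun setT (fun x => `|f x|) by exact: measurableT_comp.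
have E : (\int[N]_x `|(f x)%:E| = \int[mu]_x `|(f x * pdf x)%:E|)%E.
  rewrite (ge0_integral_normal mnf)//; apply: eq_integral => x _.
  by rewrite /= normrM (ger0_norm (normal_pdf_ge0 _ _ _)).
by split=> /integrableP[_ fin]; apply/integrableP; split;
  [exact/measurable_EFinP| rewrite /= -E |exact/measurable_EFinP|rewrite /= E].
Qed.

Lemma mean_normal (f : R -> R) : L1 N f ->
  (mean N f)%:E = (\int[mu]_x (f x * pdf x)%:E)%E.
Proof.
move=> jf; have mf := L1_measurable jf; rewrite EFin_mean//.
rewrite integralE.
have mpos : measurable_fun setT (fun x => Num.max (f x) 0) by exact: measurable_maxr.
have mneg : measurable_fun setT (fun x => Num.max (- f x) 0).
  by apply: measurable_maxr => //; exact: measurableT_comp.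
have -> : (\int[N]_x ((fun x => (f x)%:E)^\+ x) = \int[N]_x (Num.max (f x) 0)%:E)%E.
  by apply: eq_integral => x _; rewrite funeposE -EFin_max.
have -> : (\int[N]_x ((fun x => (f x)%:E)^\- x) = \int[N]_x (Num.max (- f x) 0)%:E)%E.
  by apply: eq_integral => x _; rewrite funenegE -EFinN -EFin_max.
rewrite !ge0_integral_normal//; try by move=> x; rewrite le_max lexx orbT.
rewrite [RHS]integralE; congr (_ - _)%E; apply: eq_integral => x _.
- rewrite !funeposE -!EFin_max; congr EFin.
  by rewrite maxr_pMl ?mul0r// normal_pdf_ge0.
- rewrite !funenegE -!EFinN -!EFin_max; congr EFin.
  by rewrite maxr_pMl ?mul0r ?mulNr// normal_pdf_ge0.
Qed.

Let v := s ^+ 2.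
Let v0 : 0 < v. Proof. by rewrite exprn_even_gt0. Qed.

Let pdfE x : pdf x = normal_peak s * expR (- (x ^+ 2) / (2 * v)).
Proof. by rewrite normal_pdfE// /normal_fun subr0 mulr_natl. Qed.

Let is_derive_pdf x : is_derive x (1 : R) pdf (- (x * pdf x / v)).
Proof.
have -> : pdf = fun x => normal_peak s * expR (- (x ^+ 2) / (2 * v)).
  by apply/funext => y; rewrite pdfE.
apply: is_derive_eq; rewrite /GRing.scale /=.
by field; rewrite gt_eqF.
Qed.

Lemma normal_sqr_L1 : L1 N (fun x => x ^+ 2).
Proof.
have m2 : measurable_fun setT (fun x : R => x ^+ 2) by exact: measurable_sqr.
apply/L1_normal => //.
pose s' := Num.sqrt 2 * s.
have s'0 : s' != 0 by rewrite mulf_neq0// sqrtr_eq0 -ltNge.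
have s'2 : s' ^+ 2 = 2 * v by rewrite exprMn sqr_sqrtr.
have i' := @integrable_normal_pdf R 0 s'.
pose c := 4 * v * normal_peak s / normal_peak s'.
have p'0 := normal_peak_gt0 s'0.
have p0 := normal_peak_ge0 s.
have := integrableZl measurableT c i'.
apply: le_integrable => //.
  by apply/measurable_EFinP; exact: measurable_funM.
move=> x _ /=; rewrite lee_fin !ger0_norm; last 2 first.
- apply: mulr_ge0; last exact: normal_pdf_ge0.
  apply: divr_ge0; last exact: ltW.
  by apply: mulr_ge0 => //; apply: mulr_ge0 => //; exact: ltW.
- by apply: mulr_ge0; [exact: sqr_ge0|exact: normal_pdf_ge0].
rewrite pdfE (normal_pdfE _ s'0) /normal_fun subr0 s'2.
set u := x ^+ 2 / (4 * v).
have -> : - x ^+ 2 / (2 * v) = - u - u by rewrite /u; field; rewrite gt_eqF.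
have -> : - x ^+ 2 / ((2 * v) *+ 2) = - u by rewrite /u -mulr_natl; field; rewrite gt_eqF.
have xu : x ^+ 2 = 4 * v * u by rewrite /u; field; rewrite gt_eqF.
have u0 : 0 <= u by rewrite divr_ge0 ?sqr_ge0// mulr_ge0// ltW.
rewrite xu /c expRD.
have -> : 4 * v * normal_peak s / normal_peak s' * (normal_peak s' * expR (- u))
   = 4 * v * normal_peak s * expR (- u) by field; rewrite gt_eqF.
have ue : u * expR (- u) <= 1.
  rewrite expRN ler_pdivrMr ?expR_gt0// mul1r.
  by apply: le_trans (expR_ge1Dx u); rewrite lerDr.
have e0 := expR_ge0 (- u).
have -> : 4 * v * u * (normal_peak s * (expR (- u) * expR (- u))) =
  (4 * v * normal_peak s * expR (- u)) * (u * expR (- u)) by ring.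
apply: ler_piMr => //; apply: mulr_ge0 => //; apply: mulr_ge0 => //.
by apply: mulr_ge0 => //; exact: ltW.
Qed.

(** Stein's identity: the integrand times the density is the derivative of
    - v sin(a + t z) pdf(z), which vanishes at infinity. *)
Let mean_stein_zero (a t : R) :
  mean N (fun z => z * sin (a + t * z) - v * t * cos (a + t * z)) = 0.
Proof.
set k := fun z : R => _.
have ck : continuous k.
  have cl : continuous (fun z : R => a + t * z).
    by move=> z; apply: cvgD; [exact: cvg_cst|apply: cvgM; [exact: cvg_cst|exact: cvg_id]].
  move=> z; apply: cvgB; apply: cvgM.
  - exact: cvg_id.
  - by apply: continuous_comp; [exact: cl|exact: continuous_sin].
  - exact: cvg_cst.
  - by apply: continuous_comp; [exact: cl|exact: continuous_cos].
have mk : measurable_fun setT k by exact: continuous_measurable_fun.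
have jz : L1 N id by apply: L1_of_sqr normal_sqr_L1; exact: measurable_id.
have kb z : `|k z| <= `|z| + `|v * t|.
  apply: le_trans (ler_normB _ _) _; rewrite !normrM; apply: lerD.
    by rewrite ler_piMr// sin_max.
  by rewrite ler_piMr ?mulr_ge0// cos_max.
have jb : L1 N (fun z => `|z| + `|v * t|) by apply: L1D; [exact: L1_norm|exact: L1_cst].
pose H z := - v * sin (a + t * z) * pdf z.
have dH z : is_derive z (1 : R) H (k z * pdf z).
  have dp := is_derive_pdf z; rewrite /H.
  apply: is_derive_eq; rewrite /GRing.scale /= /k.
  by field; rewrite gt_eqF.
have cH : continuous H.
  by move=> z; apply: differentiable_continuous; apply/derivable1_diffP; have [] := dH z.
pose kn (n : nat) z : R := k z * \1_(`[- n.+1%:R, n.+1%:R]%classic) z.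
have mkn n : measurable_fun setT (kn n).
  by apply: measurable_funM => //; apply: measurable_indic.
have knb n z : `|kn n z| <= `|z| + `|v * t|.
  apply: le_trans (kb z); rewrite /kn normrM ler_piMr// indicE.
  by case: (_ \in _); rewrite ?normr1 ?normr0.
have c1 : (fun n => mean N (kn n)) @ \oo --> mean N k.
  apply: (@mean_dominated_cvg R _ R N kn (fun z => `|z| + `|v * t|) k) => //.
  move=> z; apply: cvg_near_cst.
  exists (Num.truncn `|z|).+1 => // n /= zn; rewrite /kn indicE mem_set ?mulr1//=.
  rewrite in_itv /= -ler_norml; apply: ltW; apply: lt_le_trans (truncnS_gt _) _.
  by rewrite ler_nat; apply: leq_trans zn _.
have knE n : mean N (kn n) = H n.+1%:R - H (- n.+1%:R).
  apply: EFin_inj; rewrite mean_normal; last by apply: L1_le jb.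
  have nn : - n.+1%:R < n.+1%:R :> R by rewrite gtrN.
  rewrite EFinB -(@continuous_FTC2 _ (fun z => k z * pdf z) H _ _ nn).
  - rewrite [RHS]integral_mkcond; apply: eq_integral => z _.
    rewrite patchE /kn indicE; case: (_ \in _); first by rewrite mulr1.
    by rewrite mulr0 mul0r.
  - apply: continuous_subspaceT => z; apply: cvgM; first exact: ck.
    exact: continuous_normal_pdf.
  - split => [z _||]; first by have [] := dH z.
      by apply: cvg_at_right_filter; exact: cH.
    by apply: cvg_at_left_filter; exact: cH.
  - by move=> z _; rewrite derive1E; have [_ ->] := dH z.
have pdfN z : pdf (- z) = pdf z by rewrite !pdfE sqrrN.
have pdf_le n : pdf n.+1%:R <= normal_peak s * (2 * v) * n.+1%:R^-1.
  have n0 : 0 < n.+1%:R :> R by [].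
  rewrite pdfE -mulrA ler_pM2l ?normal_peak_gt0//.
  have a0 : 0 < 2 * v / n.+1%:R by rewrite divr_gt0// mulr_gt0.
  rewrite mulNr expRN -[leRHS]invrK lef_pV2 ?posrE ?expR_gt0 ?invr_gt0//.
  apply: le_trans (expR_ge1Dx _); rewrite invfM invrK.
  apply: (@le_trans _ _ (n.+1%:R ^+ 2 / (2 * v))); last by rewrite lerDr.
  rewrite [leLHS]mulrC; apply: ler_wpM2r; first by rewrite invr_ge0 mulr_ge0// ltW.
  by rewrite expr2 ler_peMl// ler1n.
have c0 : (fun n => mean N (kn n)) @ \oo --> (0 : R).
  apply/norm_cvg0P.
  apply: (squeeze_cvgr (f := fun=> 0)
    (h := fun n => 2 * v * (normal_peak s * (2 * v)) * n.+1%:R^-1)).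
  - apply: nearW => n; rewrite normr_ge0 /= knE.
    have Hb z : `|H z| <= v * pdf z.
      rewrite /H !normrM normrN (gtr0_norm v0) (ger0_norm (normal_pdf_ge0 _ _ _)).
      rewrite ler_wpM2r ?normal_pdf_ge0//.
      by rewrite ler_piMr ?(ltW v0)// sin_max.
    apply: le_trans (ler_normB _ _) _; apply: le_trans (lerD (Hb _) (Hb _)) _.
    have h := ler_wpM2l (ltW v0) (pdf_le n); rewrite pdfN.
    apply: le_trans (lerD h h) _; rewrite le_eqVlt; apply/orP; left.
    by apply/eqP; ring.
  - exact: cvg_cst.
  - rewrite -[X in _ --> X](mulr0 (2 * v * (normal_peak s * (2 * v)))).
    by apply: cvgM; [exact: cvg_cst|exact: cvg_harmonic].
exact: (cvg_unique _ c1 c0).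
Qed.

Let is_derive_quadratic (f : R -> R) (t D C : R) :
  (forall h, `|f (t + h) - f t - h * D| <= C * h ^+ 2) -> is_derive t (1 : R) f D.
Proof.
move=> H; have C0 : 0 <= C.
  by have := H 1; rewrite expr1n mulr1; apply: le_trans.
have C10 : 0 < C + 1 by rewrite ltr_wpDl.
have c : (fun h => h^-1 *: ((f \o shift t) (h *: (1 : R)) - f t)) @ (0 : R)^' --> D.
  apply/cvgrPdist_le => e e0; near=> h.
  have h0 : h != 0 by near: h; exact: nbhs_dnbhs_neq.
  rewrite /= /shift /GRing.scale /= mulr1 [h + t]addrC.
  have -> : D - h^-1 * (f (t + h) - f t) = - h^-1 * (f (t + h) - f t - h * D).
    by field.
  rewrite normrM normrN normfV ler_pdivrMl ?normr_gt0//.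
  apply: le_trans (H h) _; rewrite -(real_normK (num_real h)) expr2 mulrCA.
  rewrite ler_pM2l ?normr_gt0//.
  have hs : `|h| <= e / (C + 1).
    by near: h; apply: dnbhs0_le; rewrite divr_gt0.
  apply: le_trans (ler_wpM2l C0 hs) _; rewrite mulrA ler_pdivrMr//.
  by rewrite mulrC ler_pM2l// lerDl.
split; first by apply: cvgP c.
exact: cvg_lim c.
Unshelve. all: by end_near. Qed.

(** By Stein's identity the characteristic function solves a linear
    differential equation. *)
Lemma normal_cos (a t : R) :
  mean N (fun z => cos (a + t * z)) = expR (- (v * t ^+ 2 / 2)) * cos a.
Proof.
have jz : L1 N id by apply: L1_of_sqr normal_sqr_L1; exact: measurable_id.
have cl y : continuous (fun z : R => a + y * z).
  by move=> z; apply: cvgD; [exact: cvg_cst|apply: cvgM; [exact: cvg_cst|exact: cvg_id]].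
have mcos y : measurable_fun setT (fun z : R => cos (a + y * z)).
  apply: continuous_measurable_fun => z.
  by apply: continuous_comp; [exact: cl|exact: continuous_cos].
have msin y : measurable_fun setT (fun z : R => sin (a + y * z)).
  apply: continuous_measurable_fun => z.
  by apply: continuous_comp; [exact: cl|exact: continuous_sin].
have jcos y : L1 N (fun z => cos (a + y * z)).
  by apply: (L1_bounded N (mcos y)) => z; exact: cos_max.
have jzsin y : L1 N (fun z => z * sin (a + y * z)).
  apply: L1_le (L1_norm jz) => [|z].
    by apply: measurable_funM => //; exact: measurable_id.
  by rewrite normrM ler_piMr// sin_max.
pose phi y := mean N (fun z => cos (a + y * z)).
have dphi y : is_derive y (1 : R) phi (- (v * y * phi y)).
  have -> : - (v * y * phi y) = - mean N (fun z => z * sin (a + y * z)).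
    congr (- _); apply/eqP; rewrite eq_sym -subr_eq0 -meanZ// -meanB//.
      by rewrite mean_stein_zero.
    exact: L1Z.
  apply: (is_derive_quadratic (C := mean N (fun z => z ^+ 2))) => h.
  rewrite mulrN opprK -meanZ// /phi -meanB// -meanD; last 2 first.
  - exact: L1B.
  - exact: L1Z.
  apply: le_trans (norm_mean _) _.
    by apply: L1D; [exact: L1B|exact: L1Z].
  rewrite mulrC -meanZ; last exact: normal_sqr_L1.
  apply: le_mean.
  - by apply: L1_norm; apply: L1D; [exact: L1B|exact: L1Z].
  - by apply: L1Z; exact: normal_sqr_L1.
  move=> z; set b := a + y * z; set u := h * z.
  have -> : a + (y + h) * z = b + u by rewrite /b /u; ring.
  have -> : cos (b + u) - cos b + h * (z * sin b) =
      sin b * (u - sin u) - cos b * (1 - cos u) by rewrite cosD /u; ring.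
  apply: le_trans (ler_normB _ _) _; rewrite !normrM.
  have h1 : `|sin b| * `|u - sin u| <= u ^+ 2 / 2.
    by apply: le_trans (sin_quadratic u); rewrite ler_piMl// sin_max.
  have h2 : `|cos b| * `|1 - cos u| <= u ^+ 2 / 2.
    by apply: le_trans (cos_quadratic u); rewrite ler_piMl// cos_max.
  by apply: le_trans (lerD h1 h2) _; rewrite /u exprMn -splitr.
pose psi y := phi y * expR (v * y ^+ 2 / 2).
have dpsi y : is_derive y (1 : R) psi 0.
  apply: is_derive_eq; rewrite /GRing.scale /=.
  by field.
have := @is_derive_0_is_cst _ psi t 0 dpsi.
rewrite /psi expr0n mulr0 mul0r expR0 mulr1.
have -> : phi 0 = cos a.
  by rewrite /phi; under eq_mean do rewrite mul0r addr0; rewrite mean_cst.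
by rewrite -/(phi t) expRN => <-; rewrite mulrC mulfK// gt_eqF// expR_gt0.
Qed.

End normal_law.

(** * Gaussian vectors *)

Section uniqueness.
Context {R : realType}.
Variables mu1 mu2 : probability R R.
Hypothesis cos12 : forall a t : R,
  mean mu1 (fun z => cos (a + t * z)) = mean mu2 (fun z => cos (a + t * z)).

Let j (x : R) : rvec R 1 := (const_mx x : 'cV[R]_1).

Let mj : measurable_fun setT j.
Proof.
apply: measurable_rvec => i; under eq_fun do rewrite mxE; exact: measurable_id.
Qed.

Let dotp_j l x : dotp l (j x) = l 0 0 * x.
Proof. by rewrite dotpE big_ord1 mxE. Qed.

(** Convergence in law of the constant sequence [mu1] to [mu2]. *)
Let mean_bounded_continuous (F : R -> R) (M : R) : continuous F ->
  (forall x, `|F x| <= M) -> mean mu1 F = mean mu2 F.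
Proof.
move=> cF FM.
have mcos a t : measurable_fun setT (fun z : R => cos (a + t * z)).
  apply: continuous_measurable_fun => z.
  apply: continuous_comp; last exact: continuous_cos.
  by apply: cvgD; [exact: cvg_cst|apply: cvgM; [exact: cvg_cst|exact: cvg_id]].
have mcosl (a : R) (l : 'cV[R]_1) :
    measurable_fun setT (fun x : rvec R 1 => cos (a + dotp l x)).
  apply: (measurableT_comp (f := @cos R)).
    by apply: continuous_measurable_fun; exact: continuous_cos.
  by apply: measurable_funD => //; exact: measurable_dotp.
have jcos (mu : probability R R) a t : L1 mu (fun z : R => cos (a + t * z)).
  by apply: (L1_bounded mu (mcos a t)) => z; exact: cos_max.
have tight : forall e : R, 0 < e -> exists2 A : R, 0 < A &
    \forall n \near \oo, (mu1 [set t | (A <= `|(j t : 'cV[R]_1)|)%R] <= e%:E)%E.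
  move=> e e0; have [A A0 H] := probability_tight (law mu1 mj) e0.
  by exists A => //; apply: nearW => n; exact: H.
have cosZ (a : R) l : (fun n : nat => mean mu1 (fun t => cos (a + dotp l (j t))))
    @ \oo --> mean (law mu2 mj) (fun x => cos (a + dotp l x)).
  have dE (mu : probability R R) : mean mu (fun t => cos (a + dotp l (j t))) =
      mean mu (fun t => cos (a + l 0 0 * t)).
    by apply: eq_mean => t; rewrite dotp_j.
  rewrite (mean_law mj (mcosl a l)) ?dE ?cos12; first exact: cvg_cst.
  by under eq_fun do rewrite dotp_j; exact: jcos.
pose f (x : 'cV[R]_1) := F (x 0 0).
have cf : continuous f.
  by move=> x; apply: continuous_comp; [exact: coord_continuous|exact: cF].
have fM : exists M : R, forall x, `|f x| <= M by exists M => x; exact: FM.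
have H := cvg_in_law_of_cos (fun=> mj) tight cosZ cf fM.
have mF : measurable_fun setT F by exact: continuous_measurable_fun.
have mf : measurable_fun setT (f : rvec R 1 -> R) by exact: continuous_measurable_rvec.
have jF (mu : probability R R) : L1 mu F by apply: (L1_bounded mu mF).
have fj x : f (j x) = F x by rewrite /f mxE.
have jfj : L1 mu2 (fun x => f (j x)) by under eq_fun do rewrite fj.
have E1 : 'E_mu1[fun t => f (j t)]%E = (mean mu1 F)%:E.
  by rewrite EFin_mean// unlock; apply: eq_integral => x _; rewrite fj.
have E2 : (\int[law mu2 mj]_x (f x)%:E)%E = (mean mu2 F)%:E.
  rewrite -EFin_mean; last by apply/L1_law.
  by rewrite (mean_law mj mf jfj); congr EFin; apply: eq_mean.
apply: EFin_inj; rewrite -E1 -E2.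
by rewrite -(cvg_lim _ H)// lim_cst.
Qed.

Let ray c : mu1 `]c, +oo[%classic = mu2 `]c, +oo[%classic.
Proof.
pose F (k : nat) (x : R) : R := Num.min 1 (k%:R * Num.max 0 (x - c)).
have cF k : continuous (F k).
  move=> x; apply: (@continuous_min _ _ (fun=> 1) (fun x => k%:R * Num.max 0 (x - c))).
    exact: cvg_cst.
  apply: cvgM; first exact: cvg_cst.
  apply: (@continuous_max _ _ (fun=> 0) (fun x => x - c)); first exact: cvg_cst.
  by apply: cvgB; [exact: cvg_id|exact: cvg_cst].
have F0 k x : 0 <= F k x by rewrite /F le_min ler01 /= mulr_ge0// le_max lexx.
have F1 k x : F k x <= 1 by rewrite /F ge_min lexx.
have Fn k x : `|F k x| <= 1 by rewrite ger0_norm.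
have lim (mu : probability R R) : (fun k => mean mu (F k)) @ \oo -->
    mean mu \1_(`]c, +oo[%classic).
  apply: (@mean_dominated_cvg R _ R mu F (fun=> 1) \1_(`]c, +oo[%classic)) => //.
  - by move=> k; exact: continuous_measurable_fun.
  - move=> x; apply: cvg_near_cst.
    have [xc|cx] := leP x c.
      apply: nearW => k; rewrite indicE memNset; last first.
        by rewrite /= in_itv/= andbT; apply/negP; rewrite -leNgt.
      by rewrite /F max_l ?subr_le0// mulr0 min_r.
    exists (Num.truncn (x - c)^-1).+1 => // k /= kx.
    have xc0 : 0 < x - c by rewrite subr_gt0.
    rewrite indicE mem_set/=; last by rewrite in_itv/= andbT.
    rewrite /F max_r ?(ltW xc0)// min_l// -ler_pdivrMr// mul1r.
    by apply: ltW; apply: lt_le_trans (truncnS_gt _) _; rewrite ler_nat.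
  - exact: L1_cst.
have := lim mu2; under eq_fun do rewrite -(mean_bounded_continuous (cF _) (Fn _)).
move=> h; have E := cvg_unique _ (lim mu1) h.
by rewrite -!mean_indic ?E.
Qed.

(** Half-lines are limits of bounded continuous functions, and they generate
    the Borel sets. *)
Lemma measure_eq_of_cos (B : set R) : measurable B -> mu1 B = mu2 B.
Proof.
move=> mB; apply: (@measure_unique _ R R [set A | exists c : R, A = `]c, +oo[%classic]
  (fun n => `]- n%:R, +oo[%classic) _ _ _ _ mu1 mu2) => //.
- exact: RGenOInfty.measurableE.
- move=> _ _ [a ->] [b ->]; exists (Num.max a b).
  by apply/seteqP; split => x /=; rewrite !in_itv/= !andbT gt_max => /andP.
- by move=> n; exists (- n%:R).
- apply/seteqP; split => // x _; exists (Num.truncn `|x|).+1 => //=.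
  rewrite in_itv /= andbT ltrNl; apply: le_lt_trans (truncnS_gt _).
  by rewrite -normrN ler_norm.
- by move=> _ [c ->]; exact: ray.
- move=> n; apply: le_lt_trans (ltry 1); exact: probability_le1.
Qed.

End uniqueness.

Section positive_semidefinite.
Context {R : realType} {m : nat}.
Implicit Types S : 'M[R]_m.

Definition psd S := forall t : 'cV[R]_m, 0 <= dotp t (S *m t).

Lemma dotp_mulmx S (u t : 'cV[R]_m) : S^T = S -> dotp u (S *m t) = dotp t (S *m u).
Proof.
by move=> St; rewrite dotpC /dotp trmx_mul St mulmxA.
Qed.

Lemma dotp_quadratic S (t e : 'cV[R]_m) c : S^T = S ->
  dotp (t + c *: e) (S *m (t + c *: e)) =
  dotp t (S *m t) + 2 * c * dotp t (S *m e) + c ^+ 2 * dotp e (S *m e).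
Proof.
move=> St; rewrite mulmxDr -scalemxAr !dotpDl !dotpDr !dotpZl !dotpZr.
by rewrite (dotp_mulmx e t St); ring.
Qed.

Lemma dotp_sub_square S (v t : 'cV[R]_m) :
  dotp t ((S - v *m v^T) *m t) = dotp t (S *m t) - dotp t v ^+ 2.
Proof.
rewrite mulmxBl dotpC dotpBl dotpC; congr (_ - _).
rewrite -mulmxA (_ : v^T *m t = (dotp v t)%:M); last by rewrite [LHS]mx11_scalar.
by rewrite mul_mx_scalar dotpZl (dotpC v).
Qed.

(** One step of the Cholesky decomposition: subtract the square that carries
    the row and the column of one index. *)
Lemma psd_reduce S (k : 'I_m) : S^T = S -> psd S -> exists v : 'cV[R]_m,
  [/\ (S - v *m v^T)^T = S - v *m v^T, psd (S - v *m v^T),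
      forall j, (S - v *m v^T) k j = 0 &
      forall i, (forall j, S i j = 0) -> forall j, (S - v *m v^T) i j = 0].
Proof.
move=> St pS; pose e := basisv R k.
have Sij i j : S i j = S j i by rewrite -{1}St mxE.
have Se i : (S *m e) i 0 = S i k.
  rewrite mxE (bigD1 k)//= big1 ?addr0; first by rewrite mxE !eqxx mulr1.
  by move=> l lk; rewrite mxE (negbTE lk) mulr0.
have See : dotp e (S *m e) = S k k by rewrite dotp_basis Se.
have sym (v : 'cV[R]_m) : (S - v *m v^T)^T = S - v *m v^T.
  by rewrite linearB /= trmx_mul trmxK St.
have vv (v : 'cV[R]_m) i j : (S - v *m v^T) i j = S i j - v i 0 * v j 0.
  by rewrite !mxE big_ord1 mxE.
have qv := dotp_sub_square S.
have [Skk|Skk] := eqVneq (S k k) 0.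
  have b0 t : dotp t (S *m e) = 0.
    apply/eqP; apply: contraT => b0.
    (* If t^T S e were not zero, the quadratic form would take the value -1 here. *)
    have := pS (t + (- (dotp t (S *m t) + 1) / (2 * dotp t (S *m e))) *: e).
    rewrite dotp_quadratic// See Skk mulr0 addr0.
    have -> : 2 * (- (dotp t (S *m t) + 1) / (2 * dotp t (S *m e))) * dotp t (S *m e)
      = - (dotp t (S *m t) + 1) by field.
    by rewrite opprD addNKr ler0N1.
  have Sk j : S j k = 0 by rewrite -Se -dotp_basis b0.
  exists 0; split.
  - exact: sym.
  - by move=> t; rewrite qv [dotp t 0]dotpC dotp0l expr0n subr0; exact: pS.
  - by move=> j; rewrite vv !mxE mul0r subr0 Sij.
  - by move=> i Si j; rewrite vv !mxE mul0r subr0.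
have Skk0 : 0 < S k k by rewrite lt_neqAle eq_sym Skk -See pS.
have sk0 : Num.sqrt (S k k) != 0 by rewrite gt_eqF// sqrtr_gt0.
pose v := (Num.sqrt (S k k))^-1 *: (S *m e).
have vE i : v i 0 = (Num.sqrt (S k k))^-1 * S i k by rewrite mxE Se.
have sk2 : (Num.sqrt (S k k))^-1 * (Num.sqrt (S k k))^-1 = (S k k)^-1.
  by rewrite -expr2 exprVn sqr_sqrtr// ltW.
exists v; split.
- exact: sym.
- move=> t; rewrite qv /v dotpZr exprMn exprVn sqr_sqrtr ?(ltW Skk0)//.
  have := pS (t + (- dotp t (S *m e) / S k k) *: e).
  rewrite dotp_quadratic// See; congr (_ <= _); by field.
- move=> j; rewrite vv !vE mulrACA sk2 mulrA mulVf// mul1r.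
  by rewrite (Sij j k) subrr.
- by move=> i Si j; rewrite vv !vE !Si mulr0 mul0r subr0.
Qed.

Lemma psd_sum_of_squares S : S^T = S -> psd S -> exists vs : seq 'cV[R]_m,
  forall t, dotp t (S *m t) = \sum_(v <- vs) dotp t v ^+ 2.
Proof.
suff H : forall l : seq 'I_m, forall S, S^T = S -> psd S ->
    (forall i, i \notin l -> forall j, S i j = 0) ->
    exists vs : seq 'cV[R]_m, forall t, dotp t (S *m t) = \sum_(v <- vs) dotp t v ^+ 2.
  move=> St pS; apply: (H (enum 'I_m)) => // i; by rewrite mem_enum.
elim => [|k l IH] {}S St pS Sl.
  exists [::] => t; rewrite big_nil (_ : S = 0) ?mul0mx; first by rewrite dotpC dotp0l.
  by apply/matrixP => i j; rewrite mxE Sl.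
have [v [h1 h2 h3 h4]] := psd_reduce k St pS.
have [|vs H] := IH _ h1 h2.
  move=> i il j; have [->|ik] := eqVneq i k; first exact: h3.
  by apply: h4 => j'; apply: Sl; rewrite inE negb_or ik.
exists (v :: vs) => t; rewrite big_cons -H dotp_sub_square; ring.
Qed.

End positive_semidefinite.

Section gaussian_vectors.
Context {R : realType} {m : nat}.

Let measurable_cos_dotp (a : R) (t : 'cV[R]_m) :
  measurable_fun setT (fun x : rvec R m => cos (a + dotp t x)).
Proof.
apply: (measurableT_comp (f := @cos R)).
  by apply: continuous_measurable_fun; exact: continuous_cos.
apply: measurable_funD => //; exact: measurable_dotp.
Qed.

(** The law of a sum of independent standard normal multiples of vectors. *)
Lemma gaussian_sum_exists (vs : seq 'cV[R]_m) :
  exists nu : probability (rvec R m) R, forall a t,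
    mean nu (fun x => cos (a + dotp t x)) =
    expR (- ((\sum_(v <- vs) dotp t v ^+ 2) / 2)) * cos a.
Proof.
elim: vs => [|v vs [nu H]].
  exists (dirac (0 : rvec R m)) => a t; rewrite big_nil mul0r oppr0 expR0 mul1r.
  rewrite meanE integral_dirac//; last by apply/measurable_EFinP.
  by rewrite diracT mul1e /= dotpC dotp0l addr0.
have n1 : (1 : R) != 0 by exact: oner_neq0.
pose Q : probability (R * rvec R m)%type R := (normal_law 1 \x nu)%E.
pose f (z : R * rvec R m) : rvec R m := (z.1 *: v + (z.2 : 'cV[R]_m) : 'cV[R]_m).
have mf : measurable_fun setT f.
  apply: measurable_rvec => j; under eq_fun do rewrite /f !mxE.
  apply: measurable_funD; first by apply: measurable_funM => //; exact: measurable_fst.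
  exact: (measurableT_comp (@measurable_coord R m j) measurable_snd).
exists (law Q mf) => a t.
pose h (z : R * rvec R m) : R := cos (a + dotp t (f z)).
have mh : measurable_fun setT h.
  exact: (measurableT_comp (measurable_cos_dotp a t) mf).
have jh : L1 Q h by apply: (L1_bounded Q mh) => z; exact: cos_max.
rewrite (mean_law mf (measurable_cos_dotp a t))//.
apply: EFin_inj; rewrite EFin_mean// -integral12_prod_meas1//.
rewrite big_cons; set q := \sum_(_ <- _) _.
transitivity (\int[normal_law 1]_z (expR (- (q / 2)) * cos (a + dotp t v * z))%:E)%E.
  apply: eq_integral => z _; rewrite /fubini_F -H EFin_mean; last first.
    by apply: (L1_bounded nu (measurable_cos_dotp _ _)) => x; exact: cos_max.
  apply: eq_integral => x _; congr (cos _)%:E.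
  by rewrite /f /= dotpDr dotpZr addrA [z * _]mulrC.
have mc : measurable_fun setT (fun z : R => cos (a + dotp t v * z)).
  apply: continuous_measurable_fun => z.
  apply: continuous_comp; last exact: continuous_cos.
  by apply: cvgD; [exact: cvg_cst|apply: cvgM; [exact: cvg_cst|exact: cvg_id]].
have jc : L1 (normal_law 1) (fun z => cos (a + dotp t v * z)).
  by apply: (L1_bounded _ mc) => x; exact: cos_max.
rewrite -EFin_mean ?meanZ//; last exact: L1Z.
rewrite normal_cos// expr1n mul1r mulrA -expRD; congr (expR _ * _)%:E.
by field.
Qed.

Lemma normal0_law (v : R) : 0 <= v -> exists mu : probability R R,
  (forall B, measurable B -> mu B = normal0 v B) /\
  forall a t, mean mu (fun z => cos (a + t * z)) = expR (- (v * t ^+ 2 / 2)) * cos a.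
Proof.
move=> v0; rewrite /normal0; have [->|vn0] := eqVneq v 0.
  exists (dirac (0 : R)); split => // a t.
  rewrite meanE integral_dirac//; last first.
    apply/measurable_EFinP; apply: continuous_measurable_fun => z.
    apply: continuous_comp; last exact: continuous_cos.
    by apply: cvgD; [exact: cvg_cst|apply: cvgM; [exact: cvg_cst|exact: cvg_id]].
  by rewrite diracT mul1e /= mulr0 addr0 !mul0r oppr0 expR0 mul1r.
exists (normal_law (Num.sqrt v)); split => // a t.
rewrite normal_cos ?sqr_sqrtr// sqrtr_eq0 -ltNge.
by rewrite lt_neqAle eq_sym vn0.
Qed.

(** The squares in the decomposition of the quadratic form are the directions of
    independent standard normal variables; a law on the line is identified
    through its cosine means. *)
Theorem gaussian_exists (S : 'M[R]_m) : S^T = S -> psd S ->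
  exists nu : probability (rvec R m) R, centered_normal S nu /\
    forall a t, mean nu (fun x => cos (a + dotp t x)) =
      expR (- (dotp t (S *m t) / 2)) * cos a.
Proof.
move=> St pS; have [vs Hvs] := psd_sum_of_squares St pS.
have [nu Hnu] := gaussian_sum_exists vs.
have nucos a t : mean nu (fun x => cos (a + dotp t x)) =
    expR (- (dotp t (S *m t) / 2)) * cos a by rewrite Hnu Hvs.
exists nu; split => // t B mB.
have [mu [<- // mucos]] := normal0_law (pS t).
have mt := measurable_dotp t.
rewrite -[LHS]/(law nu mt B); apply: measure_eq_of_cos => // a s.
rewrite mucos mean_law; last 2 first.
- apply: continuous_measurable_fun => z.
  apply: continuous_comp; last exact: continuous_cos.
  by apply: cvgD; [exact: cvg_cst|apply: cvgM; [exact: cvg_cst|exact: cvg_id]].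
- under eq_fun do rewrite -dotpZl.
  by apply: (L1_bounded nu (measurable_cos_dotp _ _)) => x; exact: cos_max.
under eq_mean do rewrite -dotpZl; rewrite nucos; congr (expR (- _) * _).
by rewrite -scalemxAr dotpZl dotpZr; field.
Qed.

End gaussian_vectors.

(** * The central limit theorem for vectors *)

Section whp_consequences.
Context (R : realType) (d : measure_display) (T : measurableType d)
  (P : probability T R).

(** Bounded convergence. *)
Lemma whp_mean (f : nat -> T -> R) (M : R) : (forall n, measurable_fun setT (f n)) ->
  (forall n t, `|f n t| <= M) -> (fun x => f x.1 x.2) @ whp P --> (0 : R) ->
  (fun n => mean P (f n)) @ \oo --> (0 : R).
Proof.
move=> mf fM f0; apply/cvgr0Pnorm_le => e e0.
have M0 : 0 <= M by apply: le_trans (normr_ge0 _) (fM 0%N point).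
have e2 : 0 < e / 2 by rewrite divr_gt0.
have M1 : 0 < M + 1 by rewrite ltr_wpDl.
have eta0 : 0 < e / 2 / (M + 1) by rewrite divr_gt0.
have /cvgr0Pnorm_le /(_ _ e2) /(_ _ eta0) [F [mF PF H]] := f0.
near=> n.
have jf : L1 P (f n) by apply: (L1_bounded P (mf n)) => t; exact: fM.
have jF := L1_indic P (mF n).
apply: le_trans (norm_mean jf) _.
apply: (@le_trans _ _ (mean P (fun t => e / 2 + (M + 1) * \1_(F n) t))).
  apply: le_mean; first exact: L1_norm.
    by apply: L1D; [exact: L1_cst|exact: L1Z].
  move=> t; rewrite indicE; have [tF|tF] := boolP (t \in F n).
    rewrite mulr1; apply: le_trans (fM n t) _.
    by have := ltW e2; lra.
  rewrite mulr0 addr0; apply: (H n t); by rewrite notin_setE in tF.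
rewrite meanD ?mean_cst; [|exact: L1_cst|exact: L1Z].
rewrite meanZ// [leRHS]splitr lerD2l.
have : mean P \1_(F n) <= e / 2 / (M + 1).
  rewrite -lee_fin mean_indic//; near: n; exact: PF.
by rewrite ler_pdivlMr// mulrC.
Unshelve. all: by end_near. Qed.

Context {m : nat}.

Lemma cvg_vec (I : Type) (F : set_system I) (FF : Filter F) (f : I -> 'cV[R]_m)
  (c : 'cV[R]_m) : (forall j, (fun x => f x j 0) @ F --> c j 0) -> f @ F --> c.
Proof.
move=> H; apply/cvgrPdist_le => e e0.
have : \forall x \near F, forall j, `|c j 0 - f x j 0| <= e.
  apply: filter_forall => j; have /cvgrPdist_le := H j; exact.
apply: filterS => x Hx; apply: norm_le_coord; first exact: ltW.
by move=> j; rewrite !mxE; exact: Hx.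
Qed.

Lemma whp_cvg_in_prob (Z : nat -> T -> 'cV[R]_m) (c : 'cV[R]_m) :
  (forall n, measurable_fun setT (Z n : T -> rvec R m)) ->
  (fun x => Z x.1 x.2) @ whp P --> c -> cvg_in_prob P Z c.
Proof.
move=> mZ Zc e e0.
have mA n : measurable [set t | e <= `|Z n t - c|].
  have mcn : measurable_fun setT (fun x : rvec R m => `|(x : 'cV[R]_m) - c|).
    apply: continuous_measurable_rvec => x; apply: (@cvg_norm _ _ _ (nbhs x)).
    by apply: (@cvgB _ _ _ (nbhs x)); [exact: cvg_id|exact: cvg_cst].
  have := measurableT_comp mcn (mZ n) measurableT (measurable_itv `[e, +oo[).
  rewrite setTI; congr measurable; apply/seteqP.
  by split => t /=; rewrite in_itv /= andbT.
apply/fine_cvgP; split; first by apply: nearW => n; exact: fin_num_measure.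
apply/cvgr0Pnorm_le => eta eta0.
have /cvgrPdist_lt /(_ _ e0) /(_ _ eta0) [F [mF PF H]] := Zc.
near=> n; rewrite ger0_norm ?fine_ge0// -lee_fin fineK ?fin_num_measure//.
apply: (@le_trans _ _ (P (F n))); last by near: n.
apply: le_measure; [by rewrite inE; exact: mA|by rewrite inE|].
move=> t /=; apply: contraPP => /H /=; rewrite distrC => h.
by apply/negP; rewrite -ltNge.
Unshelve. all: by end_near. Qed.

End whp_consequences.

Section vector_clt.
Context (R : realType) (d d1 : measure_display) (T : measurableType d)
  (S : measurableType d1) (P : probability T R) (m : nat).
Context (Zs : nat -> T -> S) (Z : T -> S).
Context (mZs : forall i, measurable_fun setT (Zs i)) (mZ : measurable_fun setT Z)
  (iid : iid_copies P Zs Z).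
Context (xi : S -> 'cV[R]_m).
Hypothesis mxi : forall j, measurable_fun setT (fun z => xi z j 0).
Hypothesis xi0 : forall j, mean P (fun t => xi (Z t) j 0) = 0.
Hypothesis xi2 : forall j, L1 P (fun t => xi (Z t) j 0 ^+ 2).
Context (U : nat -> T -> 'cV[R]_m).
Hypothesis mU : forall n, measurable_fun setT (U n : T -> rvec R m).

Let W (n : nat) (t : T) : 'cV[R]_m := \col_j root_sum Zs (fun z => xi z j 0) (n, t).

Hypothesis UW : forall j, (fun x => U x.1 x.2 j 0 - W x.1 x.2 j 0) @ whp P --> (0 : R).

Let mdotxi l : measurable_fun setT (fun z => dotp l (xi z)).
Proof.
under eq_fun do rewrite dotpE; apply: measurable_sum => j.
exact: measurable_funM.
Qed.

Let mxiZ j : measurable_fun setT (fun t => xi (Z t) j 0).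
Proof. exact: (measurableT_comp (mxi j) mZ). Qed.

Let ixi j : L1 P (fun t => xi (Z t) j 0).
Proof. exact: L1_of_sqr. Qed.

Let dotp_W l n t : dotp l (W n t) = root_sum Zs (fun z => dotp l (xi z)) (n, t).
Proof.
rewrite dotpE /root_sum /=.
under eq_bigr => j _ do rewrite mxE /root_sum /= mulrCA mulr_sumr.
rewrite -mulr_sumr exchange_big /=; congr (_ * _); apply: eq_bigr => i _.
by rewrite dotpE.
Qed.

Let Sig : 'M[R]_m := \matrix_(j, k) mean P (fun t => xi (Z t) j 0 * xi (Z t) k 0).

Let ijk j k : L1 P (fun t => xi (Z t) j 0 * xi (Z t) k 0).
Proof. exact: L1M_of_sqr. Qed.

Let dotp_Sig l : dotp l (Sig *m l) = mean P (fun t => dotp l (xi (Z t)) ^+ 2).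
Proof.
have -> : (fun t => dotp l (xi (Z t)) ^+ 2) =
    fun t => \sum_j \sum_k l j 0 * l k 0 * (xi (Z t) j 0 * xi (Z t) k 0).
  apply/funext => t; rewrite dotpE expr2 big_distrl /=; apply: eq_bigr => j _.
  by rewrite big_distrr /=; apply: eq_bigr => k _; ring.
rewrite mean_sum; last by move=> j _; apply: L1_sum => k _; exact: L1Z.
rewrite dotpE; apply: eq_bigr => j _.
rewrite mean_sum; last by move=> k _; exact: L1Z.
rewrite mxE mulr_sumr; apply: eq_bigr => k _.
by rewrite meanZ// mxE; ring.
Qed.

Let Sig_sym : Sig^T = Sig.
Proof. by apply/matrixP => j k; rewrite !mxE; apply: eq_mean => t; rewrite mulrC. Qed.

Let Sig_psd : psd Sig.
Proof. by move=> l; rewrite dotp_Sig; apply: mean_ge0 => t; exact: sqr_ge0. Qed.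

Let W_cos a l : (fun n => mean P (fun t => cos (a + dotp l (W n t)))) @ \oo -->
  expR (- (dotp l (Sig *m l) / 2)) * cos a.
Proof.
under eq_fun => n.
  under eq_mean do rewrite dotp_W.
  over.
rewrite dotp_Sig.
apply: (cos_clt mZs mZ iid (mdotxi l)).
- rewrite (_ : mean P _ = mean P (fun t => \sum_j l j 0 * xi (Z t) j 0)).
    rewrite mean_sum; last by move=> j _; exact: L1Z.
    by rewrite big1// => j _; rewrite meanZ// xi0 mulr0.
  by apply: eq_mean => t; rewrite dotpE.
- under eq_fun do rewrite dotpE.
  apply: L1_sum_sqr => j; first exact: measurable_funM.
  exact: L1Z_sqr.
Qed.

Let mdotU n l : measurable_fun setT (fun t => dotp l (U n t)).
Proof. exact: (measurableT_comp (measurable_dotp l) (mU n)). Qed.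

Let mdotW n l : measurable_fun setT (fun t => dotp l (W n t)).
Proof.
by under eq_fun do rewrite dotp_W; exact: (measurable_root_sum mZs n (mdotxi l)).
Qed.

Let mcosD (f : T -> R) a : measurable_fun setT f ->
  measurable_fun setT (fun t => cos (a + f t)).
Proof.
move=> mf; apply: (measurableT_comp (f := @cos R)); last exact: measurable_funD.
by apply: continuous_measurable_fun; exact: continuous_cos.
Qed.

Let cos_lipschitz (x y : R) : `|cos x - cos y| <= `|x - y|.
Proof.
wlog xy : x y / y <= x.
  move=> H; have [xy|/ltW xy] := leP y x; first exact: H.
  by rewrite distrC [leRHS]distrC; exact: H.
have cc : {within `[y, x], continuous (@cos R)}.
  by apply: continuous_subspaceT; exact: continuous_cos.
have [c _ ->] := MVT_segment xy (fun z _ => is_derive_cos z) cc.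
by rewrite normrM normrN ler_piMl// sin_max.
Qed.

Let U_cos a l : (fun n => mean P (fun t => cos (a + dotp l (U n t)))) @ \oo -->
  expR (- (dotp l (Sig *m l) / 2)) * cos a.
Proof.
have jc (f : T -> R) : measurable_fun setT f -> L1 P (fun t => cos (a + f t)).
  by move=> mf; apply: (L1_bounded P (mcosD a mf)) => t; exact: cos_max.
have dUW : (fun x => dotp l (U x.1 x.2) - dotp l (W x.1 x.2)) @ whp P --> (0 : R).
  have -> : (fun x => dotp l (U x.1 x.2) - dotp l (W x.1 x.2)) =
      (fun x => \sum_j l j 0 * (U x.1 x.2 j 0 - W x.1 x.2 j 0)).
    apply/funext => x; rewrite !dotpE -sumrB; apply: eq_bigr => j _; ring.
  rewrite [X in _ --> X](_ : _ = \sum_(j < m) l j 0 * 0); last first.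
    by rewrite big1// => j _; rewrite mulr0.
  by apply: cvg_sum => j; apply: cvgM; [exact: cvg_cst|exact: UW].
have H : (fun n => mean P (fun t => cos (a + dotp l (U n t)) - cos (a + dotp l (W n t))))
    @ \oo --> (0 : R).
  apply: (@whp_mean _ _ _ _ (fun n t => cos (a + dotp l (U n t)) - cos (a + dotp l (W n t))) 2).
  - by move=> n; apply: measurable_funB; exact: mcosD.
  - move=> n t; apply: le_trans (ler_normB _ _) _.
    by rewrite (natrD _ 1 1); apply: lerD; exact: cos_max.
  apply/norm_cvg0P.
  apply: (squeeze_cvgr (f := fun=> 0)
    (h := fun x : nat * T => `|dotp l (U x.1 x.2) - dotp l (W x.1 x.2)|)).
  - apply: nearW => x; rewrite normr_ge0 /=; apply: le_trans (cos_lipschitz _ _) _.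
    by rewrite opprD addrACA subrr add0r.
  - exact: cvg_cst.
  - exact/norm_cvg0P.
rewrite (_ : (fun n => mean P (fun t => cos (a + dotp l (U n t)))) =
 (fun n => mean P (fun t => cos (a + dotp l (U n t)) - cos (a + dotp l (W n t)))) \+
 (fun n => mean P (fun t => cos (a + dotp l (W n t))))); last first.
  by apply/funext => n /=; rewrite meanB ?subrK//; exact: jc.
by rewrite -[X in _ --> X]add0r; apply: cvgD; [exact: H|exact: W_cos].
Qed.

Let tight (e : R) : 0 < e -> exists2 A : R, 0 < A &
  \forall n \near \oo, (P [set t | (A <= `|U n t|)%R] <= e%:E)%E.
Proof.
move=> e0; have e2 : 0 < e / 2 by rewrite divr_gt0.
pose V := \sum_j mean P (fun t => xi (Z t) j 0 ^+ 2).
pose q n t := \sum_j W n t j 0 ^+ 2.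
have jW n j : L1 P (fun t => W n t j 0 ^+ 2) /\
    mean P (fun t => W n t j 0 ^+ 2) <= mean P (fun t => xi (Z t) j 0 ^+ 2).
  have := root_sum_L2 mZs mZ iid n (mxi j) (xi0 j) (xi2 j).
  by rewrite (_ : (fun t => W n t j 0 ^+ 2) =
    (fun t => root_sum Zs (fun z => xi z j 0) (n, t) ^+ 2)) //;
    apply/funext => t; rewrite mxE.
have jq n : L1 P (q n) by apply: L1_sum => j _; have [] := jW n j.
have qV n : mean P (q n) <= V.
  rewrite mean_sum; last by move=> j _; have [] := jW n j.
  by apply: ler_sum => j _; have [] := jW n j.
have q0 n t : 0 <= q n t by apply: sumr_ge0 => j _; exact: sqr_ge0.
have V0 : 0 <= V by apply: sumr_ge0 => j _; apply: mean_ge0 => t; exact: sqr_ge0.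
(* By Markov, the sum of squares exceeds B with probability at most V / B,
   hence at most e / 2. *)
pose B := 2 * V / e + 1; have B1 : 1 <= B by rewrite lerDr divr_ge0 ?mulr_ge0// ltW.
have B0 : 0 < B by apply: lt_le_trans B1.
exists (B + 1); first by rewrite addr_gt0.
have whpj j := UW j.
have : \forall x \near whp P, forall j, `|U x.1 x.2 j 0 - W x.1 x.2 j 0| < 1.
  by apply: filter_forall => j; have /cvgr0Pnorm_lt /(_ _ ltr01) := UW j.
move=> /(_ _ e2) [F [mF PF H]].
near=> n.
have mq : measurable [set t | B <= q n t].
  have := L1_measurable (jq n) measurableT (measurable_itv `[B, +oo[); rewrite setTI.
  by congr measurable; apply/seteqP; split => t /=; rewrite in_itv /= andbT.
have mA : measurable [set t | B + 1 <= `|U n t|].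
  have := mU n measurableT (measurable_norm_gev (B + 1)); by rewrite setTI.
apply: (@le_trans _ _ (P (F n `|` [set t | B <= q n t]))).
  apply: le_measure; rewrite ?inE//; first exact: measurableU.
  move=> t /= BU; have [|tF] := pselect (F n t); [by left|right].
  have UWn := H _ _ tF.
  have [j Bj] : exists j, B <= `|W n t j 0|.
    apply: contrapT => /forallNP Hj.
    have : `|U n t| < B + 1.
      apply: (@le_lt_trans _ _ (\big[Num.max/0]_j `|U n t j 0|)).
        apply: norm_le_coord; first exact: bigmax_ge_id.
        by move=> j; apply: le_bigmax_cond.
      apply/bigmax_ltP; split; first by rewrite addr_gt0.
      move=> j _; rewrite -(subrK (W n t j 0) (U n t j 0)).
      apply: le_lt_trans (ler_normD _ _) _; rewrite addrC; apply: ltr_leD.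
        by rewrite ltNge; apply/negP; exact: Hj.
      by apply: ltW; exact: UWn.
    by rewrite ltNge BU.
  rewrite /q (bigD1 j)//=; apply: ler_wpDr; first by apply: sumr_ge0 => k _; exact: sqr_ge0.
  rewrite -(real_normK (num_real (W n t j 0))); have W1 := le_trans B1 Bj.
  by apply: le_trans Bj _; rewrite expr2 ler_peMr.
apply: le_trans (measureU2 _ _ _) _ => //.
rewrite [e]splitr EFinD; apply: leeD; first by near: n.
apply: le_trans (markov_L1 B0 (jq n) (q0 n)) _.
rewrite lee_fin ler_pdivrMr//; apply: le_trans (qV n) _.
rewrite /B mulrDr mulr1 -[leLHS]addr0; apply: lerD; last exact: ltW.
by rewrite le_eqVlt; apply/orP; left; apply/eqP; field; rewrite gt_eqF.
Unshelve. all: by end_near. Qed.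

(** Every linear form of U differs by a negligible term from a normalized sum,
    to which [cos_clt] applies; second moments of the normalized sums give
    tightness. *)
Theorem vector_clt : asymptotically_normal P U
  (\matrix_(j, k) mean P (fun t => xi (Z t) j 0 * xi (Z t) k 0)).
Proof.
have [nu [cn nucos]] := gaussian_exists Sig_sym Sig_psd.
exists nu; split => //; apply: (@cvg_in_law_of_cos _ _ _ P m U nu mU tight) => a l.
by rewrite nucos; exact: U_cos.
Qed.

End vector_clt.

(** * Functions of a linear form and gradients *)

Section ridge_functions.
Context (R : realType).
Context (q q1 q2 : R -> R).
Hypothesis dq : forall t : R, is_derive t 1 q (q1 t).
Hypothesis dq1 : forall t : R, is_derive t 1 q1 (q2 t).

Lemma is_derive_affine (f f1 : R -> R) (a r s : R) :
  (forall t : R, is_derive t 1 f (f1 t)) ->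
  is_derive s 1 (fun s => f (a + s * r)) (f1 (a + s * r) * r).
Proof.
move=> df; have da : is_derive s 1 (fun s => a + s * r) r.
  by apply: is_derive_eq; rewrite /GRing.scale /=; ring.
exact: (is_derive1_comp (f := f) (g := fun s => a + s * r)).
Qed.

Lemma mvt_affine (f f1 : R -> R) (a r s : R) : 0 <= s ->
  (forall t : R, is_derive t 1 f (f1 t)) ->
  exists2 u, 0 <= u <= s & f (a + s * r) - f a = f1 (a + u * r) * r * s.
Proof.
move=> s0 df; have cf : {within `[0, s], continuous (fun s => f (a + s * r))}.
  apply: derivable_within_continuous => t _.
  by have [] := is_derive_affine a r t df.
have [u us e] := MVT_segment s0 (fun t _ => is_derive_affine a r t df) cf.
exists u; first by move: us; rewrite in_itv.
by move: e; rewrite mul0r addr0 subr0.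
Qed.

(** The mean value theorem applied to q and then to q1. *)
Lemma taylor2_le (a r c K : R) :
  (forall s, 0 <= s <= 1 -> `|q2 (a + s * r) * r ^+ 2 * c| <= K) ->
  `|q (a + r) * c - q a * c - q1 a * r * c| <= K.
Proof.
move=> H; have [u /andP[u0 u1]] := mvt_affine a r ler01 dq.
rewrite !mulr1 mul1r => e.
have [v /andP[v0 vu]] := mvt_affine a r u0 dq1 => e1.
have -> : q (a + r) * c - q a * c - q1 a * r * c =
    u * (q2 (a + v * r) * r ^+ 2 * c).
  rewrite -mulrBl e -mulrBl -mulrBl e1; ring.
have Hv : `|q2 (a + v * r) * r ^+ 2 * c| <= K by rewrite H// v0 (le_trans vu).
rewrite normrM ger0_norm//; apply: le_trans Hv.
by rewrite ler_piMl.
Qed.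

Context (m : nat).
Implicit Types (l v x : 'cV[R]_m).

Lemma is_derive_ridge l v x c :
  is_derive l v (fun l => q (dotp l x) * c) (q1 (dotp l x) * dotp v x * c).
Proof.
have E : (fun h : R => h^-1 *: (((fun l => q (dotp l x) * c) \o shift l) (h *: v) - q (dotp l x) * c)) =
  fun h : R => h^-1 *: (((fun s => q (dotp l x + s * dotp v x) * c) \o shift 0) (h *: 1)
     - q (dotp l x + 0 * dotp v x) * c).
  apply/funext => h /=; congr (_ *: (q _ * _ - q _ * _)).
    by rewrite dotpDl dotpZl addr0 [h *: 1]mulr1 addrC.
  by rewrite mul0r addr0.
have d0 : is_derive (0 : R) 1 (fun s => q (dotp l x + s * dotp v x) * c)
    (q1 (dotp l x) * dotp v x * c).
  have d1 := is_derive_affine (dotp l x) (dotp v x) 0 dq.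
  apply: is_derive_eq; rewrite mul0r addr0 /GRing.scale /=; ring.
have [d1 d2] := d0; split.
  by move: d1; rewrite /derivable -E.
by rewrite -d2 /derive -E.
Qed.

End ridge_functions.

Section gradients.
Context (R : realType) (m : nat).
Implicit Types (f g : 'cV[R]_m -> R) (l u c e : 'cV[R]_m).

Fact dotp_is_linear c : linear (dotp c).
Proof. by move=> a u v; rewrite dotpDr dotpZr. Qed.

HB.instance Definition _ c := GRing.isLinear.Build R 'cV[R]_m R *:%R (dotp c) (dotp_is_linear c).

Definition has_gradient f l c := is_diff l f (dotp c).

Lemma has_gradientD f g l c e : has_gradient f l c -> has_gradient g l e ->
  has_gradient (fun l => f l + g l) l (c + e).
Proof.
move=> fc ge; apply: (@is_diff_eq _ _ _ _ (dotp c \+ dotp e)); first exact: is_diffD.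
by apply/funext => u /=; rewrite dotpDl.
Qed.

Lemma has_gradientM f g l c e : has_gradient f l c -> has_gradient g l e ->
  has_gradient (fun l => f l * g l) l (f l *: e + g l *: c).
Proof.
move=> fc ge; apply: (is_diff_eq (is_diffM fc ge)).
by apply/funext => u /=; rewrite dotpDl !dotpZl.
Qed.

Lemma has_gradient_cst (a : R) l : has_gradient (fun=> a) l 0.
Proof.
apply: (is_diff_eq (is_diff_cst _ _)).
by apply/funext => u /=; rewrite dotp0l.
Qed.

Lemma has_gradientZ a f l c : has_gradient f l c ->
  has_gradient (fun l => a * f l) l (a *: c).
Proof.
move=> fc; have := has_gradientM (has_gradient_cst a l) fc.
by rewrite scaler0 addr0.
Qed.

Lemma has_gradientV f l c : f l != 0 -> has_gradient f l c ->
  has_gradient (fun l => (f l)^-1) l (- (f l) ^- 2 *: c).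
Proof.
move=> f0 [df fc]; split; first exact: differentiableV.
by rewrite diffV// fc; apply/funext => u /=; rewrite dotpZl.
Qed.

Lemma has_gradient_coord j l : has_gradient (fun l => l j 0) l (basisv R j).
Proof.
have -> : (fun l : 'cV[R]_m => l j 0) = dotp (basisv R j).
  by apply/funext => u; rewrite dotp_basis.
split; first by apply: linear_differentiable; exact: continuous_dotp.
by apply: diff_lin; exact: continuous_dotp.
Qed.

Lemma has_gradientE f l c : has_gradient f l c -> gradient f l = c.
Proof.
move=> [df fc]; apply/matrixP => j i; rewrite (ord1 i) mxE deriveE//.
by rewrite fc dotpC dotp_basis.
Qed.

Lemma has_gradient_quadratic f l c (r K : R) : 0 < r ->
  (forall u, `|u| < r -> `|f (l + u) - f l - dotp c u| <= (\sum_j `|u j 0|) ^+ 2 * K) ->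
  has_gradient f l c.
Proof.
move=> r0 H.
have E : f \o shift l = cst (f l) + dotp c +o_ (0 : 'cV[R]_m) id.
  apply/eqaddoP => e e0 /=.
  pose M := (m%:R ^+ 2 * `|K| + 1 : R).
  have M0 : 0 < M by rewrite ltr_wpDl// mulr_ge0// sqr_ge0.
  have : 0 < Num.min r (e / M) by rewrite lt_min r0 divr_gt0.
  move=> /(nbhs0_lt (V := 'cV[R]_m)); apply: filterS => u.
  rewrite lt_min => /andP[ur ue] /=.
  rewrite -[(_ - _) u]/(f (u + l) - (f l + dotp c u)) [u + l]addrC opprD addrA.
  apply: le_trans (H _ ur) _.
  have s0 : 0 <= \sum_j `|u j 0| by apply: sumr_ge0.
  have : \sum_j `|u j 0| <= m%:R * `|u|.
    rewrite mulr_natl -[X in _ *+ X](card_ord m) -sumr_const.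
    by apply: ler_sum => j _; exact: coord_norm_le.
  move=> su; have u0 := normr_ge0 u; have K0 := ler_norm K; have K1 := normr_ge0 K.
  apply: (@le_trans _ _ ((m%:R * `|u|) ^+ 2 * `|K|)).
    apply: (@le_trans _ _ ((\sum_j `|u j 0|) ^+ 2 * `|K|)).
      by rewrite ler_wpM2l// sqr_ge0.
    by rewrite ler_wpM2r// ler_pXn2r// nnegrE mulr_ge0.
  have ue' : `|u| * M <= e by move: ue; rewrite ltr_pdivlMr// => /ltW.
  rewrite exprMn (expr2 `|u|) [leLHS](_ : _ = `|u| * (m%:R ^+ 2 * `|K|) * `|u|); last by ring.
  rewrite ler_wpM2r//; apply: le_trans ue'.
  by rewrite ler_wpM2l// lerDl.
have D : 'd f l = dotp c :> (_ -> _).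
  by apply: diff_unique => //; exact: continuous_dotp.
split=> //; apply/diff_locallyP; rewrite D; split => //; exact: continuous_dotp.
Qed.

End gradients.

(** * Averages at a random parameter *)

Section ae_domination.
Context (R : realType) (d : measure_display) (T : measurableType d)
  (P : probability T R).
Implicit Types f g : T -> R.

Let trunc f g x : R := Num.max (- `|g x|) (Num.min (f x) `|g x|).

Let measurable_trunc f g : measurable_fun setT f -> measurable_fun setT g ->
  measurable_fun setT (trunc f g).
Proof.
move=> mf mg; have mn : measurable_fun setT (fun x => `|g x|) by exact: measurableT_comp.
apply: measurable_maxr; last exact: measurable_minr.
exact: (measurable_funN mn).
Qed.

Let trunc_le f g x : `|trunc f g x| <= `|g x|.
Proof.
rewrite ler_norml /trunc le_max lexx /= ge_max ge_min lexx orbT andbT.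
by rewrite ge0_cp// normr_ge0.
Qed.

Let truncE f g x : `|f x| <= g x -> trunc f g x = f x.
Proof.
move=> fg; have g0 : 0 <= g x by apply: le_trans fg.
move: fg; rewrite ler_norml => /andP[h1 h2].
by rewrite /trunc ger0_norm// min_l// max_r.
Qed.

(** Truncating f at the level of g turns an almost sure bound into a pointwise
    one. *)
Lemma L1_ae_le f g : measurable_fun setT f -> {ae P, forall x, `|f x| <= g x} ->
  L1 P g -> L1 P f.
Proof.
move=> mf fg ig; have mg := L1_measurable ig.
apply: (@ae_L1 _ _ _ _ (trunc f g)) => //.
  by apply: filterS fg => x /truncE.
apply: (L1_le (measurable_trunc mf mg) (trunc_le f g)); exact: L1_norm.
Qed.

Lemma norm_mean_ae_le f g : measurable_fun setT f -> {ae P, forall x, `|f x| <= g x} ->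
  L1 P g -> `|mean P f| <= mean P g.
Proof.
move=> mf fg ig; have mg := L1_measurable ig.
have it : L1 P (trunc f g).
  by apply: (L1_le (measurable_trunc mf mg) (trunc_le f g)); exact: L1_norm.
rewrite -(@ae_mean _ _ _ _ (trunc f g) f)//; last 2 first.
- exact: measurable_trunc.
- by apply: filterS fg => x /truncE.
rewrite -(@ae_mean _ _ _ _ (fun x => `|g x|) g)//; last 2 first.
- exact: measurableT_comp.
- by apply: filterS fg => x fg; rewrite ger0_norm//; apply: le_trans fg.
apply: le_trans (norm_mean it) _; apply: le_mean; [exact: L1_norm|exact: L1_norm|].
exact: trunc_le.
Qed.

End ae_domination.

Section local_domination.
Context (R : realType) (d : measure_display) (T : measurableType d)
  (P : probability T R) (m : nat).
Let S := (rvec R m * R)%type.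
Context (Zs : nat -> T -> S) (Z : T -> S).
Context (mZs : forall i, measurable_fun setT (Zs i)) (mZ : measurable_fun setT Z)
  (iid : iid_copies P Zs Z).
Context (q q1 q2 : R -> R).
Hypothesis dq : forall t : R, is_derive t 1 q (q1 t).
Hypothesis dq1 : forall t : R, is_derive t 1 q1 (q2 t).
Hypothesis cq2 : continuous q2.
Context (b : nat) (l0 : 'cV[R]_m) (U : set 'cV[R]_m) (G : S -> R).

Definition ridge (f : R -> R) (l : 'cV[R]_m) (z : S) : R := f (dotp l z.1) * z.2 ^+ b.

Definition ridge_grad (z : S) : 'cV[R]_m := (q1 (dotp l0 z.1) * z.2 ^+ b) *: (z.1 : 'cV_m).

Definition ridge_hess (l : 'cV[R]_m) (z : S) : 'M[R]_m :=
  \matrix_(j, k) (q2 (dotp l z.1) * (z.1 : 'cV_m) j 0 * (z.1 : 'cV_m) k 0 * z.2 ^+ b).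

Hypothesis oU : open_nbhs l0 U.
Hypothesis mG : measurable_fun setT G.
Hypothesis iG : L1 P (fun t => G (Z t)).
Hypothesis dom0 : {ae P, forall t, forall l, U l -> `|ridge q l (Z t)| <= G (Z t)}.
Hypothesis dom1 : {ae P, forall t j, `|ridge_grad (Z t) j 0| <= G (Z t)}.
Hypothesis dom2 : {ae P, forall t l, U l -> forall j k, `|ridge_hess l (Z t) j k| <= G (Z t)}.

Let continuous_of_derive (f f1 : R -> R) : (forall t : R, is_derive t 1 f (f1 t)) ->
  continuous f.
Proof. by move=> df t; apply: differentiable_continuous; apply/derivable1_diffP; have [] := df t. Qed.

Let cq := continuous_of_derive dq.
Let cq1 := continuous_of_derive dq1.

Let mridge f l : continuous f -> measurable_fun setT (ridge f l).
Proof.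
move=> cf; apply: measurable_funM.
  apply: (measurableT_comp (f := f)); first exact: continuous_measurable_fun.
  by apply: (measurableT_comp (measurable_dotp l)); exact: measurable_fst.
by apply: measurable_funX; exact: measurable_snd.
Qed.

Lemma measurable_ridge l : measurable_fun setT (ridge q l).
Proof. exact: mridge. Qed.

Let mcoord j : measurable_fun setT (fun z : S => (z.1 : 'cV_m) j 0).
Proof. by apply: (measurableT_comp (measurable_coord j)); exact: measurable_fst. Qed.

Lemma measurable_ridge_grad j : measurable_fun setT (fun z => ridge_grad z j 0).
Proof.
under eq_fun do rewrite mxE; apply: measurable_funM; last exact: mcoord.
exact: mridge.
Qed.

Let mhess l j k : measurable_fun setT (fun z => ridge_hess l z j k).
Proof.
rewrite (_ : (fun z => _) = fun z => ridge q2 l z * ((z.1 : 'cV_m) j 0 * (z.1 : 'cV_m) k 0)).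
  apply: measurable_funM; first exact: mridge.
  by apply: measurable_funM; exact: mcoord.
by apply/funext => z; rewrite mxE /ridge; ring.
Qed.

Let chess z j k : continuous (fun l => ridge_hess l z j k).
Proof.
move=> l; under eq_fun do rewrite mxE.
do 3! (apply: (@cvgM _ _ (nbhs l)); last exact: cvg_cst).
under eq_fun do rewrite dotpC.
rewrite dotpC; apply: (cvg_comp (dotp z.1) q2); first exact: continuous_dotp.
exact: cq2.
Qed.

(** The domination is assumed almost surely for the generic observation and has
    to be inherited by each observation of the sample, which is possible only
    for a measurable set of values. Rational parameters make the set measurable,
    and the continuity of the second derivatives extends the bound to all
    parameters. *)
Let good : set S := \bigcap_(s : 'cV[rat]_m)
  (if `[< U (map_mx ratr s) >]
   then \bigcap_(jk : 'I_m * 'I_m) [set z | `|ridge_hess (map_mx ratr s) z jk.1 jk.2| <= G z]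
   else setT).

Let mgood : measurable good.
Proof.
rewrite /good -[X in measurable X]setCK setC_bigcap; apply: measurableC.
apply: countable_bigcupT_measurable => // s; apply: measurableC; case: ifP => // _.
rewrite -[X in measurable X]setCK setC_bigcap; apply: measurableC.
apply: countable_bigcupT_measurable => // -[j k] /=; apply: measurableC.
have mn : measurable_fun setT (fun z => G z - `|ridge_hess (map_mx ratr s) z j k|).
  by apply: measurable_funB => //; apply: measurableT_comp => //; exact: mhess.
have := mn measurableT _ (measurable_itv `[0, +oo[); rewrite setTI.
by congr measurable; apply/seteqP; split => z /=; rewrite in_itv /= andbT subr_ge0.
Qed.

Let good_hess z l : good z -> U l -> forall j k, `|ridge_hess l z j k| <= G z.
Proof.
move=> gz Ul j k; rewrite leNgt; apply/negP => Gh.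
have oV : open (U `&` [set l | G z < `|ridge_hess l z j k|]).
  apply: openI; first by case: oU.
  rewrite (_ : [set l | _] = (fun l => `|ridge_hess l z j k|) @^-1` [set x | G z < x])//.
  apply: open_comp; last exact: open_gt.
  move=> x _; apply: (@cvg_norm _ _ _ (nbhs x)); exact: chess.
have [s [n [h1 h2]]] := open_rat_ball oV (conj Ul Gh).
have r0 : 0 < n.+1%:R^-1 :> R by rewrite invr_gt0.
have [Us /=] := h2 _ (ballxx _ r0).
by rewrite ltNge; have := gz s I; case: asboolP => // _ /(_ (j, k) I) /= ->.
Qed.

Let ae_good : {ae P, forall t, good (Z t)}.
Proof. by apply: filterS dom2 => t H s _; case: asboolP => // Us -[j k] _; exact: H. Qed.

Let ball_U : exists2 r : R, 0 < r & forall u : 'cV[R]_m, `|u| < r -> U (l0 + u).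
Proof.
have := open_nbhs_nbhs oU; rewrite -filter_from_ballE => -[r /= r0 H].
exists r => // u ur; apply: H; rewrite -ball_normE /= opprD addrA subrr sub0r normrN//.
Qed.

Let taylor z u : good z -> (forall s, 0 <= s <= 1 -> U (l0 + s *: u)) ->
  `|ridge q (l0 + u) z - ridge q l0 z - dotp (ridge_grad z) u| <= (\sum_j `|u j 0|) ^+ 2 * G z.
Proof.
move=> gz Us; rewrite /ridge dotpDl /ridge_grad dotpZl (dotpC z.1) mulrAC.
apply: (taylor2_le dq dq1) => s s01.
have -> : q2 (dotp l0 z.1 + s * dotp u z.1) * dotp u z.1 ^+ 2 * z.2 ^+ b =
    \sum_j \sum_k u j 0 * u k 0 * ridge_hess (l0 + s *: u) z j k.
  rewrite -dotpZl -dotpDl; set h := q2 _.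
  rewrite dotpE expr2 big_distrl /= mulr_sumr mulr_suml; apply: eq_bigr => j _.
  rewrite big_distrr /= mulr_sumr mulr_suml; apply: eq_bigr => k _.
  by rewrite mxE -/h; ring.
apply: le_trans (ler_norm_sum _ _ _) _; rewrite expr2 big_distrl /= mulr_suml.
apply: ler_sum => j _; apply: le_trans (ler_norm_sum _ _ _) _.
rewrite big_distrr /= mulr_suml; apply: ler_sum => k _.
rewrite !normrM ler_wpM2l ?mulr_ge0//; apply: good_hess => //; exact: Us.
Qed.

Let ball_taylor : exists2 r : R, 0 < r & forall u : 'cV[R]_m, `|u| < r -> U (l0 + u) /\
  forall z, good z -> `|ridge q (l0 + u) z - ridge q l0 z - dotp (ridge_grad z) u| <= (\sum_j `|u j 0|) ^+ 2 * G z.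
Proof.
have [r r0 rU] := ball_U; exists r => // u ur; split=> [|z gz]; first exact: rU.
apply: taylor => // s /andP[s0 s1]; apply: rU; apply: le_lt_trans ur.
by rewrite normrZ ger0_norm// ler_piMl.
Qed.

Lemma L1_ridge l : U l -> L1 P (fun t => ridge q l (Z t)).
Proof.
move=> Ul; apply: (L1_ae_le _ _ iG).
  by apply: (measurableT_comp (measurable_ridge l) mZ).
by apply: filterS dom0 => t /(_ l Ul).
Qed.

Lemma L1_ridge_grad j : L1 P (fun t => ridge_grad (Z t) j 0).
Proof.
apply: (L1_ae_le _ _ iG).
  by apply: (measurableT_comp (measurable_ridge_grad j) mZ).
by apply: filterS dom1 => t /(_ j).
Qed.

Let grad : 'cV[R]_m := \col_j mean P (fun t => ridge_grad (Z t) j 0).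

Let L1_dotp_grad u : L1 P (fun t => dotp (ridge_grad (Z t)) u).
Proof.
under eq_fun do rewrite dotpC dotpE; apply: L1_sum => j _; apply: L1Z.
exact: L1_ridge_grad.
Qed.

Lemma mean_ridge_gradient : has_gradient (fun l => mean P (fun t => ridge q l (Z t))) l0 grad.
Proof.
have [r r0 H] := ball_taylor; have Ul0 : U l0 by case: oU.
apply: (@has_gradient_quadratic _ _ _ _ _ r (mean P (fun t => G (Z t)))) => // u ur.
have [Uu Hu] := H _ ur.
have -> : dotp grad u = mean P (fun t => dotp (ridge_grad (Z t)) u).
  under [RHS]eq_mean do rewrite dotpC dotpE.
  rewrite mean_sum; last by move=> j _; apply: L1Z; exact: L1_ridge_grad.
  rewrite dotpC dotpE; apply: eq_bigr => j _; rewrite meanZ ?mxE//; exact: L1_ridge_grad.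
rewrite -meanB; [|exact: L1_ridge|exact: L1_ridge].
rewrite -meanB; [|by apply: L1B; exact: L1_ridge|exact: L1_dotp_grad].
rewrite -meanZ//; apply: norm_mean_ae_le.
- apply: L1_measurable; apply: L1B; last exact: L1_dotp_grad.
  by apply: L1B; exact: L1_ridge.
- by apply: filterS ae_good => t; exact: Hu.
- exact: L1Z.
Qed.

(** The Taylor remainder is at most the squared size of delta times the average
    of G, which is negligible after multiplication by the root of n; the
    gradients are averaged at the fixed point l0, where the weak law applies. *)
Lemma average_ridge_expansion (delta : nat * T -> 'cV[R]_m) :
  (forall j, (fun x => delta x j 0) @ whp P --> (0 : R)) ->
  (forall j, bounded_prob P (fun x => Num.sqrt x.1%:R * delta x j 0)) ->
  (fun x => Num.sqrt x.1%:R * (average Zs (ridge q (l0 + delta x)) x - average Zs (ridge q l0) x)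
    - Num.sqrt x.1%:R * dotp grad (delta x)) @ whp P --> (0 : R).
Proof.
move=> d0 bd; have [r r0 H] := ball_taylor.
pose s x := \sum_j `|delta x j 0|.
have s0 : s @ whp P --> (0 : R).
  rewrite [X in _ --> X](_ : _ = \sum_(j < m) 0); last by rewrite big1.
  by apply: cvg_sum => j; apply/norm_cvg0P; exact: d0.
have bs : bounded_prob P (fun x => Num.sqrt x.1%:R * s x).
  move=> a a0.
  have -> : (fun x => a x * (Num.sqrt x.1%:R * s x)) =
      fun x => \sum_j a x * `|Num.sqrt x.1%:R * delta x j 0|.
    apply/funext => x; rewrite mulr_sumr mulr_sumr; apply: eq_bigr => j _.
    by rewrite normrM ger0_norm// sqrtr_ge0.
  rewrite [X in _ --> X](_ : _ = \sum_(j < m) 0); last by rewrite big1.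
  apply: cvg_sum => j; apply/norm_cvg0P.
  have -> : (fun x => `|a x * `|Num.sqrt x.1%:R * delta x j 0| |) =
      fun x => `|a x * (Num.sqrt x.1%:R * delta x j 0)|.
    by apply/funext => x; rewrite !normrM !normr_id.
  apply/norm_cvg0P; exact: bd.
(* A1 is the fluctuation of the averaged gradients, A3 the Taylor remainder, and
   A2 dominates A3. *)
pose A1 x := \sum_j (average Zs (fun z => ridge_grad z j 0) x - grad j 0) *
  (Num.sqrt x.1%:R * delta x j 0).
have A10 : A1 @ whp P --> (0 : R).
  rewrite [X in _ --> X](_ : _ = \sum_(j < m) 0); last by rewrite big1.
  apply: cvg_sum => j; apply: bd; apply: cvg_to0.
  rewrite mxE; apply: (weak_law mZs mZ iid); first exact: measurable_ridge_grad.
  exact: L1_ridge_grad.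
pose A2 x := s x * average Zs G x * (Num.sqrt x.1%:R * s x).
have A20 : A2 @ whp P --> (0 : R).
  apply: bs; apply: (cvgM_to s0 (weak_law mZs mZ iid mG iG)); by rewrite mul0r.
pose A3 x := Num.sqrt x.1%:R * (average Zs (ridge q (l0 + delta x)) x - average Zs (ridge q l0) x
   - average Zs (fun z => dotp (ridge_grad z) (delta x)) x).
have A30 : A3 @ whp P --> (0 : R).
  have gs : \forall x \near whp P, forall i : nat, good (Zs i x.2).
    apply: (@whp_ae _ _ _ _ (fun n t => forall i, good (Zs i t))) => n.
    have gi i : {ae P, forall t, good (Zs i t)} := iid_ae mZs mZ iid mgood ae_good i.
    have := ae_foralln gi; exact.
  have ds : \forall x \near whp P, `|delta x| < r.
    have : delta @ whp P --> (0 : 'cV[R]_m) by apply: cvg_vec => j; rewrite mxE; exact: d0.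
    by move/cvgr0Pnorm_lt => /(_ _ r0).
  apply/norm_cvg0P; apply: (squeeze_cvgr (f := fun=> 0) (h := A2)).
  - move: gs ds; apply: filterS2 => x gs ds; rewrite normr_ge0 /=.
    rewrite /A3 /A2 normrM ger0_norm ?sqrtr_ge0//.
    rewrite [leRHS](_ : _ = Num.sqrt x.1%:R * (s x ^+ 2 * average Zs G x)); last by ring.
    rewrite ler_wpM2l ?sqrtr_ge0// /average -!mulrBr normrM ger0_norm ?invr_ge0//.
    rewrite mulrCA ler_wpM2l ?invr_ge0// -!sumrB mulr_sumr.
    apply: le_trans (ler_norm_sum _ _ _) _; apply: ler_sum => i _.
    by have [_] := H _ ds; apply; exact: gs.
  - exact: cvg_cst.
  - exact: A20.
have -> : (fun x => Num.sqrt x.1%:R * (average Zs (ridge q (l0 + delta x)) x -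
      average Zs (ridge q l0) x) - Num.sqrt x.1%:R * dotp grad (delta x)) =
    fun x => A3 x + A1 x.
  apply/funext => x; rewrite /A3 /A1.
  have -> : average Zs (fun z => dotp (ridge_grad z) (delta x)) x =
      \sum_j average Zs (fun z => ridge_grad z j 0) x * delta x j 0.
    rewrite /average; under eq_bigr do rewrite dotpE.
    rewrite exchange_big /= mulr_sumr; apply: eq_bigr => j _.
    by rewrite -mulr_suml mulrA.
  have -> : \sum_j (average Zs (fun z => ridge_grad z j 0) x - grad j 0) *
      (Num.sqrt x.1%:R * delta x j 0) =
      Num.sqrt x.1%:R * \sum_j average Zs (fun z => ridge_grad z j 0) x * delta x j 0
      - Num.sqrt x.1%:R * dotp grad (delta x).
    by rewrite dotpE !mulr_sumr -sumrB; apply: eq_bigr => j _; ring.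
  by ring.
by apply: (cvgD_to A30 A10); rewrite addr0.
Qed.

End local_domination.

(** * Calculus of asymptotic expansions *)

Section expansions.
Context (R : realType) (d d1 : measure_display) (T : measurableType d)
  (S : measurableType d1) (P : probability T R) (m : nat).
Context (Zs : nat -> T -> S) (Z : T -> S).
Context (mZs : forall i, measurable_fun setT (Zs i)) (mZ : measurable_fun setT Z)
  (iid : iid_copies P Zs Z).
Context (l0 : 'cV[R]_m) (lhat : nat * T -> 'cV[R]_m).
Implicit Types (Q : nat * T -> R) (q : 'cV[R]_m -> R) (phi : S -> R).

Let delta x := lhat x - l0.
Let rt (x : nat * T) : R := Num.sqrt x.1%:R.

Hypothesis b_delta : forall j, bounded_prob P (fun x => rt x * delta x j 0).

Lemma cvg_root_inv : (fun x : nat * T => (Num.sqrt x.1%:R : R)^-1) @ whp P --> (0 : R).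
Proof.
apply: (@whp_cvg_nat _ _ _ P _ (fun n => (Num.sqrt n%:R : R)^-1)).
apply/cvgr0Pnorm_lt => e e0; near=> n.
have n0 : 0 < n%:R :> R by rewrite ltr0n; near: n; exists 1%N.
rewrite ger0_norm ?invr_ge0 ?sqrtr_ge0// invf_plt ?posrE ?sqrtr_gt0//.
rewrite -(ger0_norm (ltW _ : 0 <= e^-1)) ?invr_gt0// -sqrtr_sqr ltr_sqrt//.
near: n; exact: nbhs_infty_gtr.
Unshelve. all: by end_near. Qed.

Lemma whp_pos : \forall x \near whp P, (0 < x.1)%N.
Proof. by apply: (@whp_near_nat _ _ _ P (fun n => (0 < n)%N)); exists 1%N. Qed.

Lemma whp_cvg_near Q Q' (c : R) : (\forall x \near whp P, Q x = Q' x) ->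
  Q @ whp P --> c -> Q' @ whp P --> c.
Proof.
by move=> QQ'; apply: cvg_trans; exact: (@near_eq_cvg _ _ (whp P) _ Q Q' QQ').
Qed.

Lemma cvg_of_root_bounded Q (c : R) : bounded_prob P (fun x => rt x * (Q x - c)) ->
  Q @ whp P --> c.
Proof.
move=> /(_ _ cvg_root_inv) H; apply: cvg_from0; apply: whp_cvg_near H.
apply: (filterS _ whp_pos) => x x0.
by rewrite mulrA mulVf ?mul1r// gt_eqF// sqrtr_gt0 ltr0n.
Qed.

(** The sequence Q estimates q(l0) by a formula evaluated at lhat: phi is the
    influence of one observation when l0 is known, and the gradient carries the
    effect of estimating l0. *)
Record expansion Q q phi : Prop := Expansion {
  expansion_gradient : has_gradient q l0 (gradient q l0);
  expansion_measurable : measurable_fun setT phi;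
  expansion_mean0 : mean P (fun t => phi (Z t)) = 0;
  expansion_L2 : L1 P (fun t => phi (Z t) ^+ 2);
  expansion_remainder : (fun x => rt x * (Q x - q l0) - root_sum Zs phi x
    - rt x * dotp (gradient q l0) (delta x)) @ whp P --> (0 : R) }.

Let b_dotp c : bounded_prob P (fun x => rt x * dotp c (delta x)).
Proof.
have -> : (fun x => rt x * dotp c (delta x)) =
    fun x => \sum_j c j 0 * (rt x * delta x j 0).
  by apply/funext => x; rewrite dotpE mulr_sumr; apply: eq_bigr => j _; ring.
move=> r r0; rewrite (_ : (fun x => _) =
  fun x => \sum_j r x * (c j 0 * (rt x * delta x j 0))); last first.
  by apply/funext => x; rewrite mulr_sumr.
rewrite [X in _ --> X](_ : _ = \sum_(j < m) 0); last by rewrite big1.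
apply: cvg_sum => j; rewrite (_ : (fun x => _) =
  fun x => r x * c j 0 * (rt x * delta x j 0)); last by apply/funext => x; rewrite mulrA.
by apply: b_delta; rewrite -[X in _ --> X](mul0r (c j 0)); apply: cvgM => //; exact: cvg_cst.
Qed.

Lemma expansion_bounded Q q phi : expansion Q q phi ->
  bounded_prob P (fun x => rt x * (Q x - q l0)).
Proof.
move=> [_ mphi phi0 phi2 H].
have -> : (fun x => rt x * (Q x - q l0)) = fun x =>
    (rt x * (Q x - q l0) - root_sum Zs phi x - rt x * dotp (gradient q l0) (delta x))
    + (root_sum Zs phi x + rt x * dotp (gradient q l0) (delta x)).
  by apply/funext => x; ring.
apply: bounded_probD; first exact: bounded_prob_cvg H.
apply: bounded_probD; last exact: b_dotp.
exact: (root_sum_bounded mZs mZ iid).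
Qed.

Lemma expansion_cvg Q q phi : expansion Q q phi -> Q @ whp P --> q l0.
Proof. by move=> /expansion_bounded; exact: cvg_of_root_bounded. Qed.

Lemma expansion_intro Q q phi c : has_gradient q l0 c -> measurable_fun setT phi ->
  mean P (fun t => phi (Z t)) = 0 -> L1 P (fun t => phi (Z t) ^+ 2) ->
  (fun x => rt x * (Q x - q l0) - root_sum Zs phi x
    - rt x * dotp c (delta x)) @ whp P --> (0 : R) -> expansion Q q phi.
Proof. by move=> qc; have qE := has_gradientE qc; rewrite -qE in qc *; split. Qed.

Lemma eq_expansion Q Q' q q' phi phi' : (\forall x \near whp P, Q x = Q' x) ->
  q =1 q' -> phi =1 phi' -> expansion Q q phi -> expansion Q' q' phi'.
Proof.
move=> QQ' /funext <- /funext <- [? ? ? ? H]; split => //.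
by apply: whp_cvg_near H; apply: (filterS _ QQ') => x ->.
Qed.

Lemma root_sum_comb (a c : R) phi psi x :
  root_sum Zs (fun z => a * phi z + c * psi z) x =
  a * root_sum Zs phi x + c * root_sum Zs psi x.
Proof.
rewrite /root_sum big_split /= -!mulr_sumr; ring.
Qed.

Let sqr_comb (a c : R) phi (psi : S -> R) : measurable_fun setT phi -> measurable_fun setT psi ->
  L1 P (fun t => phi (Z t) ^+ 2) -> L1 P (fun t => psi (Z t) ^+ 2) ->
  [/\ measurable_fun setT (fun z => a * phi z + c * psi z),
    L1 P (fun t => phi (Z t)), L1 P (fun t => psi (Z t)) &
    L1 P (fun t => (a * phi (Z t) + c * psi (Z t)) ^+ 2)].
Proof.
move=> mp mq ip iq; have mpZ := measurableT_comp mp mZ; have mqZ := measurableT_comp mq mZ.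
split.
- by apply: measurable_funD; exact: measurable_funM.
- exact: L1_of_sqr.
- exact: L1_of_sqr.
- apply: (@L1D_sqr _ _ _ P (fun t => a * phi (Z t)) (fun t => c * psi (Z t))).
  + exact: measurable_funM.
  + exact: measurable_funM.
  + exact: L1Z_sqr.
  + exact: L1Z_sqr.
Qed.

(** Sums, products and inverses all amount to a linear combination of known
    expansions up to a negligible term. *)
Lemma expansion_comb (a c : R) Q1 q1 phi1 Q2 q2 phi2 Q q :
  expansion Q1 q1 phi1 -> expansion Q2 q2 phi2 ->
  has_gradient q l0 (a *: gradient q1 l0 + c *: gradient q2 l0) ->
  (fun x => rt x * (Q x - q l0) - (a * (rt x * (Q1 x - q1 l0)) + c * (rt x * (Q2 x - q2 l0))))
    @ whp P --> (0 : R) ->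
  expansion Q q (fun z => a * phi1 z + c * phi2 z).
Proof.
move=> [_ mp p0 ip Hp] [_ mq q0 iq Hq] gq HQ.
have [m12 i1 i2 i12] := sqr_comb a c mp mq ip iq.
apply: (expansion_intro gq) => //.
  by rewrite meanD ?meanZ ?p0 ?q0 ?mulr0 ?addr0//; exact: L1Z.
have -> : (fun x => rt x * (Q x - q l0) - root_sum Zs (fun z => a * phi1 z + c * phi2 z) x
    - rt x * dotp (a *: gradient q1 l0 + c *: gradient q2 l0) (delta x)) =
  fun x => (rt x * (Q x - q l0) - (a * (rt x * (Q1 x - q1 l0)) + c * (rt x * (Q2 x - q2 l0)))) +
    (a * (rt x * (Q1 x - q1 l0) - root_sum Zs phi1 x - rt x * dotp (gradient q1 l0) (delta x)) +
     c * (rt x * (Q2 x - q2 l0) - root_sum Zs phi2 x - rt x * dotp (gradient q2 l0) (delta x))).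
  by apply/funext => x; rewrite root_sum_comb dotpDl !dotpZl; ring.
apply: (cvgD_to HQ (b := 0)); last by rewrite addr0.
apply: (cvgD_to (a := 0) (b := 0)); last by rewrite addr0.
  by apply: (cvgM_to (cvg_cst a) Hp); rewrite mulr0.
by apply: (cvgM_to (cvg_cst c) Hq); rewrite mulr0.
Qed.

Lemma expansionB Q1 q1 phi1 Q2 q2 phi2 :
  expansion Q1 q1 phi1 -> expansion Q2 q2 phi2 ->
  expansion (fun x => Q1 x - Q2 x) (fun l => q1 l - q2 l) (fun z => phi1 z - phi2 z).
Proof.
move=> e1 e2; have g1 := expansion_gradient e1; have g2 := expansion_gradient e2.
have H : expansion (fun x => Q1 x - Q2 x) (fun l => q1 l - q2 l)
    (fun z => 1 * phi1 z + -1 * phi2 z).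
  apply: (expansion_comb e1 e2).
    rewrite scale1r; have := has_gradientD g1 (has_gradientZ (-1) g2).
    by under eq_fun do rewrite mulN1r.
  by apply: (whp_cvg_near _ (cvg_cst 0)); apply: nearW => x; ring.
apply: eq_expansion H => //; first exact: nearW.
by move=> z; ring.
Qed.

Lemma expansionM Q1 q1 phi1 Q2 q2 phi2 :
  expansion Q1 q1 phi1 -> expansion Q2 q2 phi2 ->
  expansion (fun x => Q1 x * Q2 x) (fun l => q1 l * q2 l)
    (fun z => q2 l0 * phi1 z + q1 l0 * phi2 z).
Proof.
move=> e1 e2; have g1 := expansion_gradient e1; have g2 := expansion_gradient e2.
apply: (expansion_comb e1 e2).
  by rewrite addrC; exact: has_gradientM.
have -> : (fun x => rt x * (Q1 x * Q2 x - q1 l0 * q2 l0) - (q2 l0 * (rt x * (Q1 x - q1 l0)) +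
  q1 l0 * (rt x * (Q2 x - q2 l0)))) = fun x => (Q2 x - q2 l0) * (rt x * (Q1 x - q1 l0)).
  by apply/funext => x; ring.
apply: (expansion_bounded e1); apply: cvg_to0; exact: expansion_cvg e2.
Qed.

Lemma expansionV Q q phi : expansion Q q phi -> q l0 != 0 ->
  expansion (fun x => (Q x)^-1) (fun l => (q l)^-1) (fun z => - q l0 ^- 2 * phi z).
Proof.
move=> e q0; have g := expansion_gradient e; have Qq := expansion_cvg e.
have H : expansion (fun x => (Q x)^-1) (fun l => (q l)^-1)
    (fun z => - q l0 ^- 2 * phi z + 0 * phi z).
  apply: (expansion_comb e e).
    by rewrite scale0r addr0; exact: has_gradientV.
  have : (fun x => (- ((Q x)^-1 * (q l0)^-1) + q l0 ^- 2) * (rt x * (Q x - q l0))) @ whp P --> (0 : R).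
    apply: (expansion_bounded e).
    apply: (cvgD_to (a := - q l0 ^- 2) (b := q l0 ^- 2)); last by rewrite addrC subrr.
      apply: cvgN; apply: (cvgM_to (cvgV q0 Qq) (cvg_cst (q l0)^-1)).
      by rewrite -invfM expr2.
    exact: cvg_cst.
  apply: whp_cvg_near.
  have Qn0 : \forall x \near whp P, Q x != 0.
    exact: cvgr_neq0 Qq q0.
  by apply: (filterS _ Qn0) => x Q0; field; rewrite Q0 q0.
apply: eq_expansion H => //; first exact: nearW.
by move=> z; rewrite mul0r addr0.
Qed.

Lemma expansion_coord j : expansion (fun x => lhat x j 0) (fun l => l j 0) (fun=> 0).
Proof.
apply: (expansion_intro (has_gradient_coord j l0)).
- exact: measurable_cst.
- exact: mean_cst.
- by under eq_fun do rewrite expr0n; exact: L1_cst.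
- apply: (whp_cvg_near _ (cvg_cst 0)); apply: nearW => x.
  by rewrite dotp_basis /root_sum big1// mulr0 subr0 /delta !mxE subrr.
Qed.

End expansions.

(** * The second stage *)

Section lambda3_expansion.
Context (R : realType) (d d1 : measure_display) (T : measurableType d)
  (S : measurableType d1) (P : probability T R) (m : nat).
Context (Zs : nat -> T -> S) (Z : T -> S).
Context (mZs : forall i, measurable_fun setT (Zs i)) (mZ : measurable_fun setT Z)
  (iid : iid_copies P Zs Z).
Context (l0 : 'cV[R]_m) (lhat : nat * T -> 'cV[R]_m).
Hypothesis b_delta : forall j,
  bounded_prob P (fun x => Num.sqrt x.1%:R * (lhat x - l0) j 0).
Context (M : nat * T -> (R -> R -> R) -> R) (N : 'cV[R]_m -> (R -> R -> R) -> R)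
  (phi : nat -> nat -> S -> R).
Local Notation exp := (expansion P Zs Z l0 lhat).
Hypothesis Mphi : forall jk, jk \in moment_exponents ->
  exp (fun x => avg (M x) jk.1 jk.2) (fun l => avg (N l) jk.1 jk.2) (phi jk.1 jk.2).

Let mu j k := avg (N l0) j k.
Let phi_a1 z := phi 4 0 z - (mu 2 0 * phi 2 0 z + mu 2 0 * phi 2 0 z).
Let phi_a2 z := phi 3 0 z - (mu 2 0 * phi 1 0 z + mu 1 0 * phi 2 0 z).
Let phi_a3 z := phi 2 0 z - (mu 1 0 * phi 1 0 z + mu 1 0 * phi 1 0 z).
Let phi_b1 z := phi 1 2 z - (mu 0 2 * phi 1 0 z + mu 1 0 * phi 0 2 z).
Let phi_b2 z := phi 2 2 z - (mu 0 2 * phi 2 0 z + mu 2 0 * phi 0 2 z).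
Let phi_g3 z := (a3 (N l0) * phi_a1 z + a1 (N l0) * phi_a3 z)
  - (a2 (N l0) * phi_a2 z + a2 (N l0) * phi_a2 z).
Let phi_num z := (b2 (N l0) * phi_a3 z + a3 (N l0) * phi_b2 z)
  - (b1 (N l0) * phi_a2 z + a2 (N l0) * phi_b1 z).
Definition lambda3_phi (z : S) : R := (g3 (N l0))^-1 * phi_num z +
  (a3 (N l0) * b2 (N l0) - a2 (N l0) * b1 (N l0)) * (- g3 (N l0) ^- 2 * phi_g3 z).

Let E40 := Mphi (isT : (4, 0)%N \in moment_exponents).
Let E30 := Mphi (isT : (3, 0)%N \in moment_exponents).
Let E20 := Mphi (isT : (2, 0)%N \in moment_exponents).
Let E10 := Mphi (isT : (1, 0)%N \in moment_exponents).
Let E02 := Mphi (isT : (0, 2)%N \in moment_exponents).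
Let E12 := Mphi (isT : (1, 2)%N \in moment_exponents).
Let E22 := Mphi (isT : (2, 2)%N \in moment_exponents).

Let Ea1 : exp (fun x => a1 (M x)) (fun l => a1 (N l)) phi_a1.
Proof. exact: (expansionB mZ E40 (expansionM mZs mZ iid b_delta E20 E20)). Qed.
Let Ea2 : exp (fun x => a2 (M x)) (fun l => a2 (N l)) phi_a2.
Proof. exact: (expansionB mZ E30 (expansionM mZs mZ iid b_delta E10 E20)). Qed.
Let Ea3 : exp (fun x => a3 (M x)) (fun l => a3 (N l)) phi_a3.
Proof. exact: (expansionB mZ E20 (expansionM mZs mZ iid b_delta E10 E10)). Qed.
Let Eb1 : exp (fun x => b1 (M x)) (fun l => b1 (N l)) phi_b1.
Proof. exact: (expansionB mZ E12 (expansionM mZs mZ iid b_delta E10 E02)). Qed.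
Let Eb2 : exp (fun x => b2 (M x)) (fun l => b2 (N l)) phi_b2.
Proof. exact: (expansionB mZ E22 (expansionM mZs mZ iid b_delta E20 E02)). Qed.
Let Eg3 : exp (fun x => g3 (M x)) (fun l => g3 (N l)) phi_g3.
Proof.
exact: (expansionB mZ (expansionM mZs mZ iid b_delta Ea1 Ea3) (expansionM mZs mZ iid b_delta Ea2 Ea2)).
Qed.
Let Enum : exp (fun x => a3 (M x) * b2 (M x) - a2 (M x) * b1 (M x))
  (fun l => a3 (N l) * b2 (N l) - a2 (N l) * b1 (N l)) phi_num.
Proof.
exact: (expansionB mZ (expansionM mZs mZ iid b_delta Ea3 Eb2) (expansionM mZs mZ iid b_delta Ea2 Eb1)).
Qed.

Lemma lambda3_expansion : g3 (N l0) != 0 ->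
  exp (fun x => lambda3_of (M x)) (fun l => lambda3_of (N l)) lambda3_phi.
Proof.
move=> g0; have EV := expansionV mZs mZ iid b_delta Eg3 g0.
exact: (expansionM mZs mZ iid b_delta Enum EV).
Qed.

(** When the mean of Y^2 is exactly quadratic in eta, the moments that involve
    Y^2 are linear combinations of moments of eta. The fluctuations of the
    latter then cancel in the influence function, and only the residual of Y^2
    remains. *)
Section influence_value.
Context (alpha la2 la3 W w0 e y : R) (z : S).
Hypothesis W0 : W != 0.
Hypothesis g0 : g3 (N l0) != 0.
Hypothesis m02 : mu 0 2 = alpha + la2 * mu 1 0 + la3 * mu 2 0.
Hypothesis m12 : mu 1 2 = alpha * mu 1 0 + la2 * mu 2 0 + la3 * mu 3 0.
Hypothesis m22 : mu 2 2 = alpha * mu 2 0 + la2 * mu 3 0 + la3 * mu 4 0.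
Hypothesis phiE : forall jk, jk \in moment_exponents ->
  phi jk.1 jk.2 z = W^-1 * ((e ^+ jk.1 * y ^+ jk.2 - mu jk.1 jk.2) * w0).

Let b1E : b1 (N l0) = la2 * a3 (N l0) + la3 * a2 (N l0).
Proof. by rewrite /b1 /a3 /a2 -!/(mu _ _) m02 m12; ring. Qed.

Let b2E : b2 (N l0) = la2 * a2 (N l0) + la3 * a1 (N l0).
Proof. by rewrite /b2 /a1 /a2 -!/(mu _ _) m02 m22; ring. Qed.

(** Cramer's rule for the slope of eta^2 in a regression of Y^2 on eta and
    eta^2. *)
Lemma lambda3_of_slope : lambda3_of (N l0) = la3.
Proof.
rewrite /lambda3_of b1E b2E; have := g0; rewrite /g3 => h; field; exact: h.
Qed.

Lemma lambda3_phiE : lambda3_phi z = (g3 (N l0) * W)^-1 * w0 *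
  (a3 (N l0) * ((e ^+ 2 - mu 2 0) * (y ^+ 2 - (alpha + la2 * e + la3 * e ^+ 2))) -
   a2 (N l0) * ((e - mu 1 0) * (y ^+ 2 - (alpha + la2 * e + la3 * e ^+ 2)))).
Proof.
have num : a3 (N l0) * b2 (N l0) - a2 (N l0) * b1 (N l0) = la3 * g3 (N l0).
  by rewrite b1E b2E /g3; ring.
rewrite /lambda3_phi num.
have -> : phi_num z = phi_num z - la3 * phi_g3 z + la3 * phi_g3 z by ring.
have -> : phi_num z - la3 * phi_g3 z = W^-1 * w0 *
  (a3 (N l0) * ((e ^+ 2 - mu 2 0) * (y ^+ 2 - (alpha + la2 * e + la3 * e ^+ 2))) -
   a2 (N l0) * ((e - mu 1 0) * (y ^+ 2 - (alpha + la2 * e + la3 * e ^+ 2)))).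
  rewrite /phi_num /phi_g3 b1E b2E /phi_a1 /phi_a2 /phi_a3 /phi_b1 /phi_b2.
  have := phiE (isT : (4, 0)%N \in moment_exponents); rewrite /= => ->.
  have := phiE (isT : (3, 0)%N \in moment_exponents); rewrite /= => ->.
  have := phiE (isT : (2, 0)%N \in moment_exponents); rewrite /= => ->.
  have := phiE (isT : (1, 0)%N \in moment_exponents); rewrite /= => ->.
  have := phiE (isT : (0, 2)%N \in moment_exponents); rewrite /= => ->.
  have := phiE (isT : (1, 2)%N \in moment_exponents); rewrite /= => ->.
  have := phiE (isT : (2, 2)%N \in moment_exponents); rewrite /= => ->.
  rewrite m02 m12 m22 !expr0 !mulr1 expr1 /a1 /a2 /a3 -!/(mu _ _).
  by ring.
by field; rewrite g0 W0.
Qed.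

End influence_value.

End lambda3_expansion.

Section weighted_powers.
Context (R : realType) (w : R -> R).
Hypothesis dw : forall t : R, derivable w t 1.
Hypothesis dw1 : forall t : R, derivable (derive1 w) t 1.
Hypothesis cw2 : continuous (derive1n 2 w).

Definition wpow (a : nat) (t : R) : R := t ^+ a * w t.
Definition wpow1 (a : nat) (t : R) : R := a%:R * t ^+ a.-1 * w t + t ^+ a * derive1 w t.
Definition wpow2 (a : nat) (t : R) : R :=
  a%:R * (a.-1%:R * t ^+ a.-2 * w t + t ^+ a.-1 * derive1 w t) +
  (a%:R * t ^+ a.-1 * derive1 w t + t ^+ a * derive1n 2 w t).

Let is_w (t : R) : is_derive t 1 w (derive1 w t).
Proof. by rewrite derive1E; apply: derivableP; exact: dw. Qed.

Let is_w1 (t : R) : is_derive t 1 (derive1 w) (derive1n 2 w t).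
Proof. by rewrite derive1nS derive1n1 derive1E; apply: derivableP; exact: dw1. Qed.

Let is_pow n (t : R) : is_derive t 1 (fun t : R => t ^+ n) (n%:R * t ^+ n.-1).
Proof.
split; first exact: exprn_derivable.
by rewrite -derive1E exp_derive1.
Qed.

Lemma is_derive_wpow a (t : R) : is_derive t 1 (wpow a) (wpow1 a t).
Proof.
have h1 := is_pow a t; have h2 := is_w t.
by apply: is_derive_eq; rewrite /wpow1 /GRing.scale /=; ring.
Qed.

Lemma is_derive_wpow1 a (t : R) : is_derive t 1 (wpow1 a) (wpow2 a t).
Proof.
have h1 := is_pow a t; have h2 := is_w t; have h3 := is_w1 t; have h4 := is_pow a.-1 t.
by apply: is_derive_eq; rewrite /wpow2 /GRing.scale /=; ring.
Qed.

Lemma continuous_wpow2 a : continuous (wpow2 a).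
Proof.
have cw : continuous w.
  by move=> t; apply: differentiable_continuous; apply/derivable1_diffP; exact: dw.
have cw1 : continuous (derive1 w).
  by move=> t; apply: differentiable_continuous; apply/derivable1_diffP; exact: dw1.
have cx n : continuous (fun t : R => t ^+ n) by move=> t; exact: exprn_continuous.
move=> t; apply: (@cvgD _ _ _ (nbhs t)).
  apply: (@cvgM _ _ (nbhs t)); first exact: cvg_cst.
  apply: (@cvgD _ _ _ (nbhs t)).
    apply: (@cvgM _ _ (nbhs t)); last exact: cw.
    by apply: (@cvgM _ _ (nbhs t)); [exact: cvg_cst|exact: cx].
  by apply: (@cvgM _ _ (nbhs t)); [exact: cx|exact: cw1].
apply: (@cvgD _ _ _ (nbhs t)).
  apply: (@cvgM _ _ (nbhs t)); last exact: cw1.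
  by apply: (@cvgM _ _ (nbhs t)); [exact: cvg_cst|exact: cx].
by apply: (@cvgM _ _ (nbhs t)); [exact: cx|exact: cw2].
Qed.

End weighted_powers.

Section weighted_moments.
Context (R : realType) (d : measure_display) (T : measurableType d)
  (P : probability T R) (m : nat).
Let S := (rvec R m * R)%type.
Context (X : T -> rvec R m) (Y : T -> R) (Xs : nat -> T -> rvec R m) (Ys : nat -> T -> R).
Let Z t : S := (X t, Y t).
Let Zs i t : S := (Xs i t, Ys i t).
Context (mZs : forall i, measurable_fun setT (Zs i)) (mZ : measurable_fun setT Z)
  (iid : iid_copies P Zs Z).
Context (w : R -> R) (l0 : 'cV[R]_m) (lhat : nat * T -> 'cV[R]_m).
Hypothesis dw : forall t : R, derivable w t 1.
Hypothesis dw1 : forall t : R, derivable (derive1 w) t 1.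
Hypothesis cw2 : continuous (derive1n 2 w).
Hypothesis b_delta : forall j,
  bounded_prob P (fun x => Num.sqrt x.1%:R * (lhat x - l0) j 0).

(** The summand eta^j Y^k w(eta), as a function of the parameter and of one
    observation. *)
Definition wmom (j k : nat) (l : 'cV[R]_m) (z : S) : R :=
  ridge (m := m) k (wpow w j) l z.

Section one_moment.
Context (a b : nat).
Hypothesis dom : locally_dominated P X Y l0 (fun e y => e ^+ a * y ^+ b * w e).
Hypothesis sqr : L1 P (fun t => (dotp l0 (X t) ^+ a * Y t ^+ b * w (dotp l0 (X t))) ^+ 2).

Let F l := mean P (fun t => wmom a b l (Z t)).

Let ho (x : 'cV[R]_m) (y : R) :
  (fun l => dotp l x ^+ a * y ^+ b * w (dotp l x)) = (fun l => wpow w a (dotp l x) * y ^+ b).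
Proof. by apply/funext => l; rewrite /wpow mulrAC. Qed.

Let D1 (x : 'cV[R]_m) (y : R) j :
  'D_(basisv R j) (fun l : 'cV[R]_m => dotp l x ^+ a * y ^+ b * w (dotp l x)) =
  (fun l : 'cV[R]_m => wpow1 w a (dotp l x) * (x j 0 * y ^+ b)).
Proof.
rewrite ho; apply/funext => l; have [_ ->] := is_derive_ridge (is_derive_wpow dw a) l (basisv R j) x (y ^+ b).
by rewrite dotp_basis mulrA.
Qed.

Let D2 (x : 'cV[R]_m) (y : R) j k l :
  'D_(basisv R k) ('D_(basisv R j)
    (fun l : 'cV[R]_m => dotp l x ^+ a * y ^+ b * w (dotp l x))) l =
  wpow2 w a (dotp l x) * x k 0 * (x j 0 * y ^+ b).
Proof.
rewrite D1; have [_ ->] := is_derive_ridge (is_derive_wpow1 dw dw1 a) l (basisv R k) x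
  (x j 0 * y ^+ b).
by rewrite dotp_basis.
Qed.

Lemma moment_expansion : expansion P Zs Z l0 lhat
  (fun x => average Zs (wmom a b (lhat x)) x) F (fun z => wmom a b l0 z - F l0).
Proof.
have [U [G [oU mG iG ae]]] := dom.
have Ul0 : U l0 by case: oU.
have dom0 : {ae P, forall t, forall l, U l -> `|wmom a b l (Z t)| <= G (Z t)}.
  by apply: filterS ae => t H l /H [+ _ _]; rewrite /wmom /ridge /wpow mulrAC.
have dom1 : {ae P, forall t j, `|ridge_grad (wpow1 w a) b l0 (Z t) j 0| <= G (Z t)}.
  apply: filterS ae => t /(_ _ Ul0) /= [_ H _] j; have := H j.
  have /= -> := congr1 (fun f : 'cV[R]_m -> R => f l0) (D1 (X t) (Y t) j).
  by rewrite mxE; congr (`| _ | <= _) => /=; ring.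
have dom2 : {ae P, forall t l, U l -> forall j k, `|ridge_hess (wpow2 w a) b l (Z t) j k| <= G (Z t)}.
  apply: filterS ae => t H l /H /= [_ _ {}H] j k; have := H j k.
  by rewrite (D2 (X t) (Y t) j k l) mxE; congr (`| _ | <= _) => /=; ring.
have dq := is_derive_wpow dw a; have dq1 := is_derive_wpow1 dw dw1 a.
have cq2 := continuous_wpow2 dw dw1 cw2 (a := a).
have mH : measurable_fun setT (wmom a b l0) := measurable_ridge dq b l0.
have iH := L1_ridge mZ dq iG dom0 Ul0.
have mHZ := measurableT_comp mH mZ.
have gF : has_gradient F l0 _ := mean_ridge_gradient mZ dq dq1 cq2 oU iG dom0 dom1 dom2.
apply: (expansion_intro gF).
- exact: measurable_funB.
- rewrite meanB//; last exact: L1_cst.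
  by rewrite mean_cst subrr.
- apply: (@L1D_sqr _ _ _ P (fun t => wmom a b l0 (Z t)) (fun=> - F l0)) => //.
  + have -> : (fun t => wmom a b l0 (Z t) ^+ 2) =
      (fun t => (dotp l0 (X t) ^+ a * Y t ^+ b * w (dotp l0 (X t))) ^+ 2) => //.
    by apply/funext => t; rewrite /wmom /ridge /wpow mulrAC.
  + exact: L1_cst.
- have d0 j : (fun x => (lhat x - l0) j 0) @ whp P --> (0 : R).
    apply: cvg_of_root_bounded.
    rewrite (_ : (fun x => _) = fun x => Num.sqrt x.1%:R * (lhat x - l0) j 0)//.
    by apply/funext => x; rewrite subr0.
  have E := average_ridge_expansion mZs mZ iid dq dq1 cq2 oU mG iG dom1 dom2 d0 b_delta.
  apply: (whp_cvg_near _ E).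
  apply: (filterS _ (whp_pos P)) => x x0; congr (_ - _).
  rewrite subrKC /root_sum /average -/(wmom a b).
  have n0 : Num.sqrt x.1%:R != 0 :> R by rewrite gt_eqF// sqrtr_gt0 ltr0n.
  have nE := sqr_sqrtr (ler0n R x.1); move: n0 nE.
  set s := Num.sqrt x.1%:R => n0 nE.
  rewrite sumrB sumr_const card_ord -(mulr_natr (F l0)) -!nE /wmom; field.
  exact: n0.
Qed.

End one_moment.

Hypothesis domw : locally_dominated P X Y l0 (fun e _ => w e).
Hypothesis dom : forall jk, jk \in moment_exponents ->
  locally_dominated P X Y l0 (fun e y => e ^+ jk.1 * y ^+ jk.2 * w e).
Hypothesis sqr : forall jk, jk \in (0%N, 0%N) :: moment_exponents ->
  L1 P (fun t => (dotp l0 (X t) ^+ jk.1 * Y t ^+ jk.2 * w (dotp l0 (X t))) ^+ 2).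
Hypothesis Pw_neq0 : Pw P w X l0 != 0.

Let dom00 : locally_dominated P X Y l0 (fun e y => e ^+ 0 * y ^+ 0 * w e).
Proof.
rewrite (_ : (fun e y => _) = fun e _ => w e)//.
by apply/funext => e; apply/funext => y; rewrite !expr0 !mul1r.
Qed.

Lemma Pw_wmom l : Pw P w X l = mean P (fun t => wmom 0 0 l (Z t)).
Proof. by apply: eq_mean => t; rewrite /wmom /ridge /wpow !expr0 mul1r mulr1. Qed.

Lemma Pfw_wmom j k l : Pfw P w X Y l (fun e y => e ^+ j * y ^+ k) =
  mean P (fun t => wmom j k l (Z t)).
Proof. by apply: eq_mean => t; rewrite /wmom /ridge /wpow mulrAC. Qed.

Lemma Pn_wE n (t : T) l j k : (0 < n)%N ->
  avg (Pn_w w n (fun i => Xs i t) (fun i => Ys i t) l) j k =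
  average Zs (wmom j k l) (n, t) * (average Zs (wmom 0 0 l) (n, t))^-1.
Proof.
move=> n0; rewrite /avg /Pn_w /average /= invfM invrK mulrACA mulVf ?mul1r; last first.
  by rewrite pnatr_eq0 -lt0n.
congr (_ / _); apply: eq_bigr => i _; rewrite /wmom /ridge /wpow /= ?expr0.
  by rewrite mulrAC.
by rewrite mul1r mulr1.
Qed.

(** A weighted average is a quotient of two averages once n is positive. *)
Lemma avg_expansion jk : jk \in moment_exponents -> expansion P Zs Z l0 lhat
  (fun x => avg (Pn_w w x.1 (fun i => Xs i x.2) (fun i => Ys i x.2) (lhat x)) jk.1 jk.2)
  (fun l => avg (P_w P w X Y l) jk.1 jk.2)
  (fun z => (Pw P w X l0)^-1 *
    ((dotp l0 z.1 ^+ jk.1 * z.2 ^+ jk.2 - avg (P_w P w X Y l0) jk.1 jk.2) * w (dotp l0 z.1))).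
Proof.
move=> mjk; have E1 := moment_expansion (dom mjk) (sqr _).
have E0 := moment_expansion dom00 (@sqr (0, 0)%N isT).
have F0 : mean P (fun t => wmom 0 0 l0 (Z t)) != 0 by rewrite -Pw_wmom.
have EV := expansionV mZs mZ iid b_delta E0 F0.
have H := expansionM mZs mZ iid b_delta (E1 _) EV.
apply: (eq_expansion _ _ _ (H _)) => [|l|z|]; last by rewrite inE mjk orbT.
- apply: (filterS _ (whp_pos P)) => -[n t] /= n0; by rewrite Pn_wE.
- by rewrite /avg /P_w Pfw_wmom Pw_wmom.
- rewrite /avg /P_w Pfw_wmom Pw_wmom /=.
  rewrite /wmom /ridge /wpow !expr0 !mul1r !mulr1 -/(wpow _ _).
  set c := mean _ _; have c0 : c != 0 := F0; set f := mean _ _.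
  by field.
Qed.

Lemma lambda3_lim_expansion : g3 (P_w P w X Y l0) != 0 ->
  expansion P Zs Z l0 lhat
  (fun x => lambda3_of (Pn_w w x.1 (fun i => Xs i x.2) (fun i => Ys i x.2) (lhat x)))
  (lambda3_lim P w X Y)
  (lambda3_phi l0 (P_w P w X Y) (fun j k (z : S) => (Pw P w X l0)^-1 *
    ((dotp l0 z.1 ^+ j * z.2 ^+ k - avg (P_w P w X Y l0) j k) * w (dotp l0 z.1)))).
Proof. exact: (lambda3_expansion mZs mZ iid b_delta avg_expansion). Qed.

End weighted_moments.

(** * Orthogonality of residuals and transfer of conditional expectations *)

Section taking_out_what_is_known.
Context (R : realType) (d : measure_display) (T : measurableType d)
  (P : probability T R).
Implicit Types (U h : T -> R).

Let L1_indicM (A : set T) U : measurable A -> L1 P U -> L1 P (fun t => \1_A t * U t).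
Proof.
move=> mA iU; apply: L1_le (L1_norm iU) => [|t].
  by apply: measurable_funM; [exact: measurable_indic|exact: (L1_measurable iU)].
rewrite normrM indicE; case: (_ \in _); last by rewrite normr0 mul0r.
by rewrite normr1 mul1r.
Qed.

(** Layer cake: u counts, up to one unit, the positive integers below it. *)
Lemma layer_count (u : R) (n : nat) : 0 <= u <= n%:R ->
  0 <= u - \sum_(k < n) (k.+1%:R <= u)%R%:R <= 1.
Proof.
elim: n => [|n IH] /andP[u0 un].
  by rewrite big_ord0 subr0 u0 /= (le_trans un).
rewrite big_ord_recr /=; have [un'|un'] := leP u n%:R.
  have -> : (n.+1%:R <= u) = false.
    by apply/negbTE; rewrite -ltNge; apply: le_lt_trans un' _; rewrite ltr_nat.
  by rewrite addr0; apply: IH; rewrite u0.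
rewrite (_ : \sum_(k < n) _ = n%:R); last first.
  rewrite (eq_bigr (fun=> 1)) ?sumr_const ?card_ord// => k _.
  by rewrite (le_trans _ (ltW un'))// ler_nat.
rewrite -natr1 in un *; have [|] := leP (n%:R + 1) u => h /=; apply/andP; split; lra.
Qed.

Let bounded_orthogonal U h (K : R) : L1 P U -> measurable_fun setT h ->
  (forall t, `|h t| <= K) ->
  (forall B, measurable B -> mean P (fun t => \1_B (h t) * U t) = 0) ->
  mean P (fun t => h t * U t) = 0.
Proof.
move=> iU mh hK H; have mU := L1_measurable iU.
have K0 : 0 <= K by apply: le_trans (hK point).
have iUh : L1 P (fun t => h t * U t).
  apply: L1_le (L1Z K (L1_norm iU)) => [|t]; first exact: measurable_funM.
  by rewrite normrM ler_wpM2r.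
have mU0 : mean P U = 0.
  have := H setT measurableT; rewrite (_ : mean P _ = mean P U)//.
  by apply: eq_mean => t; rewrite indicT mul1r.
suff HN (N : nat) : N%:R * `|mean P (fun t => h t * U t)| <= mean P (fun t => `|U t|).
  apply/eqP/negP => /negP n0; set c := `|mean P _| in HN *.
  have c0 : 0 < c by rewrite normr_gt0.
  have := HN (Num.truncn (mean P (fun t => `|U t|) / c)).+1.
  by rewrite -ler_pdivlMr// leNgt truncnS_gt.
(* The layer count of u errs by at most one and is orthogonal to U, whence
   N |E(h U)| <= E|U| for every N. *)
pose u t := N%:R * (h t + K); pose M := (Num.truncn (N%:R * (K + K))).+1.
have uM t : 0 <= u t <= M%:R.
  have := hK t; rewrite ler_norml => /andP[h1 h2]; apply/andP; split.
    by rewrite mulr_ge0// -lerBlDr sub0r.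
  by apply: le_trans (ltW (truncnS_gt _)); rewrite ler_wpM2l// lerD2r.
pose L t := \sum_(k < M) (k.+1%:R <= u t)%R%:R : R.
have mB (k : nat) : measurable [set x : R | k.+1%:R <= N%:R * (x + K)].
  have : measurable_fun setT (fun x : R => N%:R * (x + K)) by
    apply: measurable_funM => //; apply: measurable_funD.
  move=> /(_ measurableT _ (measurable_itv `[k.+1%:R, +oo[)); rewrite setTI.
  by congr measurable; apply/seteqP; split => x /=; rewrite in_itv /= andbT.
have LE t : L t * U t = \sum_(k < M) \1_[set x : R | k.+1%:R <= N%:R * (x + K)] (h t) * U t.
  rewrite mulr_suml; apply: eq_bigr => k _; rewrite indicE /u; congr (_%:R * _).
  by congr nat_of_bool; apply/idP/idP; rewrite inE.
have iB (k : nat) : L1 P (fun t => \1_[set x : R | k.+1%:R <= N%:R * (x + K)] (h t) * U t).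
  apply: (L1_indicM (A := h @^-1` [set x : R | k.+1%:R <= N%:R * (x + K)])) => //.
  by rewrite -[X in measurable X]setTI; exact: mh.
have iL : L1 P (fun t => L t * U t).
  by under eq_fun do rewrite LE; apply: L1_sum => k _; exact: iB.
have L0 : mean P (fun t => L t * U t) = 0.
  rewrite (eq_mean (g := _) _ LE) mean_sum; last by move=> k _; exact: iB.
  by rewrite big1// => k _; exact: H.
have iuU : L1 P (fun t => u t * U t).
  have := L1D (L1Z N%:R iUh) (L1Z (N%:R * K) iU); congr (L1 P _).
  by apply/funext => t; rewrite /u; ring.
have -> : N%:R * `|mean P (fun t => h t * U t)| = `|mean P (fun t => (u t - L t) * U t)|.
  rewrite -(normr_nat R N) -normrM -meanZ//; congr `| _ |.
  rewrite [RHS](_ : _ = mean P (fun t => u t * U t - L t * U t)); last first.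
    by apply: eq_mean => t; rewrite mulrBl.
  rewrite meanB// L0 subr0.
  rewrite [RHS](_ : _ = mean P (fun t => N%:R * (h t * U t) + N%:R * K * U t)); last first.
    by apply: eq_mean => t; rewrite /u; ring.
  by rewrite meanD; [|exact: L1Z|exact: L1Z]; rewrite [X in _ + X]meanZ// mU0 mulr0 addr0.
have iD : L1 P (fun t => (u t - L t) * U t).
  by under eq_fun do rewrite mulrBl; exact: L1B.
apply: le_trans (norm_mean iD) _; apply: le_mean; [exact: L1_norm|exact: L1_norm|].
move=> t; rewrite normrM ler_piMl//.
by have /layer_count := uM t => /andP[l0 l1]; rewrite ger0_norm.
Qed.

(** A bounded function of the conditioning variable is, after rescaling, within
    distance one of a finite sum of indicators of its level sets; truncation
    reduces the general case to the bounded one. *)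
Lemma mean_orthogonal U h : L1 P U -> measurable_fun setT h ->
  L1 P (fun t => h t * U t) ->
  (forall B, measurable B -> mean P (fun t => \1_B (h t) * U t) = 0) ->
  mean P (fun t => h t * U t) = 0.
Proof.
move=> iU mh iUh H; have mU := L1_measurable iU.
pose tr (n : nat) (x : R) := \1_[set y : R | `|y| <= n%:R] x * x.
have mI (n : nat) : measurable [set y : R | `|y| <= n%:R].
  have : measurable_fun setT (fun y : R => `|y|) by exact: measurableT_comp.
  move=> /(_ measurableT _ (measurable_itv `]-oo, n%:R])); rewrite setTI.
  by congr measurable; apply/seteqP; split => x /=; rewrite in_itv.
have mtr n : measurable_fun setT (tr n).
  by apply: measurable_funM => //; exact: measurable_indic.
have tr_le n x : `|tr n x| <= `|x|.
  rewrite normrM indicE; case: (_ \in _); last by rewrite normr0 mul0r.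
  by rewrite normr1 mul1r.
have trn n : mean P (fun t => tr n (h t) * U t) = 0.
  apply: (@bounded_orthogonal _ (fun t => tr n (h t)) n%:R) => //.
  - exact: measurableT_comp.
  - move=> t; rewrite /tr indicE; have [|_] := boolP (h t \in _).
    + by rewrite inE /= => hn; rewrite mul1r.
    + by rewrite mul0r normr0.
  - move=> B mB; have mtB : measurable (tr n @^-1` B).
      by rewrite -[X in measurable X]setTI; exact: mtr.
    by rewrite -[RHS](H _ mtB).
have : (fun n => mean P (fun t => tr n (h t) * U t)) @ \oo --> mean P (fun t => h t * U t).
  apply: (@mean_dominated_cvg R _ _ P (fun n t => tr n (h t) * U t)
    (fun t => `|h t * U t|) (fun t => h t * U t)).
  - by move=> n; apply: measurable_funM => //; exact: measurableT_comp.
  - exact: measurable_funM.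
  - move=> t; apply: cvgMl; apply: cvg_near_cst; near=> n.
    rewrite /tr indicE mem_set ?mul1r//=; apply: ltW; near: n; exact: nbhs_infty_gtr.
  - exact: L1_norm.
  - by move=> n t; rewrite normrM [leRHS]normrM; apply: ler_wpM2r => //; exact: tr_le.
rewrite (_ : (fun n => _) = fun=> 0); last by apply/funext.
by move=> /(cvg_unique _); apply; [exact: norm_hausdorff|exact: cvg_cst].
Unshelve. all: by end_near. Qed.

End taking_out_what_is_known.

Section conditional_expectation_versions.
Context (R : realType) (d d1 : measure_display) (T : measurableType d)
  (S : measurableType d1) (P : probability T R).
Implicit Types (V : T -> S) (Z : T -> R) (g : S -> R).

Lemma is_condE_fun V Z g : measurable_fun setT V -> measurable_fun setT g ->
  L1 P Z -> L1 P (fun t => g (V t)) ->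
  (forall B, measurable B -> mean P (fun t => \1_B (V t) * Z t) =
    mean P (fun t => \1_B (V t) * g (V t))) -> is_condE P V Z (fun t => g (V t)).
Proof.
move=> mV mg iZ ig H; apply: is_condE_indic => // _ B mB; rewrite setTI.
exists (g @^-1` B); first by rewrite -[X in measurable X]setTI; exact: mg.
by rewrite setTI.
Qed.

Lemma L1_indicV V Z B : measurable_fun setT V -> L1 P Z -> measurable B ->
  L1 P (fun t => \1_B (V t) * Z t).
Proof.
move=> mV iZ mB; apply: L1_le (L1_norm iZ) => [|t].
  apply: measurable_funM; last exact: (L1_measurable iZ).
  by apply: (measurableT_comp (f := \1_B : S -> R)) => //; exact: measurable_indic.
rewrite normrM indicE; case: (_ \in _); last by rewrite normr0 mul0r.
by rewrite normr1 mul1r.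
Qed.

(** Conditional expectation given V depends on V and Z only through their
    joint law. *)
Lemma is_condE_same_law d2 (S' : measurableType d2) (U U' : T -> S') (f : S' -> S)
  (h : S' -> R) g :
  measurable_fun setT U -> measurable_fun setT U' -> same_law P U' U ->
  measurable_fun setT f -> measurable_fun setT h -> measurable_fun setT g ->
  is_condE P (fun t => f (U t)) (fun t => h (U t)) (fun t => g (f (U t))) ->
  is_condE P (fun t => f (U' t)) (fun t => h (U' t)) (fun t => g (f (U' t))).
Proof.
move=> mU mU' UU' mf mh mg c.
have mgf : measurable_fun setT (fun s => g (f s)) by exact: measurableT_comp.
have [ih ig _ _] := c.
apply: is_condE_fun => //.
- exact: measurableT_comp.
- exact: (same_law_L1 mU' mU UU' mh).
- exact: (same_law_L1 mU' mU UU' mgf).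
move=> B mB; have mfU := measurableT_comp mf mU.
have mB1 : measurable_fun setT (fun s => \1_B (f s) : R).
  by apply: (measurableT_comp (f := \1_B : S -> R)) => //; exact: measurable_indic.
have := condE_indic mfU c mB.
rewrite -(same_law_mean mU' mU UU' (h := fun s => \1_B (f s) * h s)); last 2 first.
- exact: measurable_funM.
- exact: L1_indicV.
rewrite -(same_law_mean mU' mU UU' (h := fun s => \1_B (f s) * g (f s)))//.
- exact: measurable_funM.
- exact: L1_indicV.
Qed.

Lemma is_condE_embed d2 (S' : measurableType d2) V Z g (e : S -> S') (r : S' -> S) :
  measurable_fun setT V -> measurable_fun setT e -> measurable_fun setT r ->
  cancel e r -> measurable_fun setT g ->
  is_condE P V Z (fun t => g (V t)) ->
  is_condE P (fun t => e (V t)) Z (fun t => g (V t)).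
Proof.
move=> mV me mr er mg c; have [iZ ig _ _] := c.
have -> : (fun t => g (V t)) = fun t => g (r (e (V t))) by apply/funext => t; rewrite er.
apply: (@is_condE_indic _ _ _ _ _ _ (fun t => e (V t))) => //.
- exact: measurableT_comp.
- by under eq_fun do rewrite er.
- move=> _ B mB; rewrite setTI; exists ((g \o r) @^-1` B); last by rewrite setTI.
  by rewrite -[X in measurable X]setTI; exact: (measurableT_comp mg mr).
move=> B mB; have meB : measurable (e @^-1` B).
  by rewrite -[X in measurable X]setTI; exact: me.
under [RHS]eq_mean do rewrite er.
exact: (condE_indic mV c meB).
Qed.

End conditional_expectation_versions.

(** * The mixture model *)

Section moments_of_variance.
Context (R : realType) (d : measure_display) (T : measurableType d)
  (P : probability T R).

(** The variance is the integral of a nonnegative function, so its finiteness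
    already gives square integrability. *)
Lemma variance_finite (Z : T -> R) (mu v : R) : measurable_fun setT Z ->
  ('E_P[Z] = mu%:E)%E -> ('V_P[Z] = v%:E)%E ->
  [/\ L1 P Z, L1 P (fun t => Z t ^+ 2), mean P Z = mu &
    mean P (fun t => Z t ^+ 2) = v + mu ^+ 2].
Proof.
move=> mZ EZ; rewrite /variance covariance.unlock EZ /= expectation.unlock => VZ.
have mC : measurable_fun setT (fun t => Z t - mu) by exact: measurable_funB.
have iC2 : L1 P (fun t => (Z t - mu) ^+ 2).
  apply/integrableP; split; first by apply/measurable_EFinP; exact: measurable_sqr.
  rewrite (eq_integral (fun t => ((Z t - mu) * (Z t - mu))%:E)) => [|t _].
    by rewrite VZ ltry.
  by rewrite /= ger0_norm ?sqr_ge0// expr2.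
have VE : mean P (fun t => (Z t - mu) ^+ 2) = v.
  by rewrite meanE (eq_integral (fun t => ((Z t - mu) * (Z t - mu))%:E)) ?VZ// => t _.
have iC := L1_of_sqr mC iC2.
have iZ : L1 P Z.
  have := L1D iC (L1_cst P mu); congr (L1 P _); apply/funext => t; exact: subrK.
have muZ : mean P Z = mu by rewrite /mean EZ.
have iZ2 : L1 P (fun t => Z t ^+ 2).
  have := L1D_sqr mC (measurable_cst mu) iC2 (L1_cst P (mu ^+ 2)).
  by congr (L1 P _); apply/funext => t; rewrite /cst subrK.
split => //.
have -> : mean P (fun t => Z t ^+ 2) = mean P (fun t => (Z t - mu) ^+ 2 + (2 * mu * Z t - mu ^+ 2)).
  by apply: eq_mean => t; ring.
rewrite meanD//; last by apply: L1B; [exact: L1Z|exact: L1_cst].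
rewrite VE meanB ?mean_cst; [|exact: L1Z|exact: L1_cst].
by rewrite meanZ// muZ; ring.
Qed.

End moments_of_variance.

Section mixture.
Context (R : realType) (d : measure_display) (T : measurableType d)
  (P : probability T R) (m : nat).
Context (X : T -> rvec R m) (Y1 Y2 Y : T -> R) (B : T -> bool).
Context (p mu1 mu2 sigma1 sigma2 : R) (beta : 'cV[R]_m).
Hypothesis mX : measurable_fun setT X.
Hypothesis mY1 : measurable_fun setT Y1.
Hypothesis mY2 : measurable_fun setT Y2.
Hypothesis mB : measurable_fun setT B.
Hypothesis p01 : 0 < p < 1.
Hypothesis PB : P (B @^-1` [set true]) = p%:E.
Hypothesis YE : forall o, Y o = (B o)%:R * Y1 o + (1 - (B o)%:R) * Y2 o.
Hypothesis BXY : indep P B (fun o => (X o, Y1 o, Y2 o)).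
Hypothesis Y2X : indep P Y2 X.
Hypothesis cY1 : is_condE P X Y1 (fun o => mu1 + dotp beta (X o)).
Hypothesis vY1 : is_condV P X Y1 (cst (sigma1 ^+ 2)).
Hypothesis EY2 : ('E_P[Y2] = mu2%:E)%E.
Hypothesis VY2 : ('V_P[Y2] = (sigma2 ^+ 2)%:E)%E.
Hypothesis iXX : forall j k, L1 P (fun o => (Xtilde X o : 'cV_(1 + m)) j 0 *
  (Xtilde X o : 'cV_(1 + m)) k 0).

Definition mixture_mean (x : rvec R m) : R := p * (mu1 + dotp beta x) + (1 - p) * mu2.

Definition mixture_const : R :=
  p * (sigma1 ^+ 2 + mu1 ^+ 2) + (1 - p) * (sigma2 ^+ 2 + mu2 ^+ 2).

Definition mixture_sqr (x : rvec R m) : R :=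
  mixture_const + 2 * mu1 * dotp (p *: beta) x + p^-1 * dotp (p *: beta) x ^+ 2.

Let b o : R := (B o)%:R.

Let mb : measurable_fun setT b.
Proof. by apply: (measurableT_comp (f := fun c : bool => c%:R : R)) => //. Qed.

Let mean_b : mean P b = p.
Proof.
have mA : measurable (B @^-1` [set true]).
  by rewrite -[X in measurable X]setTI; exact: mB.
have -> : b = \1_(B @^-1` [set true]).
  apply/funext => o; rewrite indicE /b; congr (_%:R); congr nat_of_bool.
  by apply/idP/idP; rewrite inE.
by apply: EFin_inj; rewrite mean_indic.
Qed.

Let ib : L1 P b.
Proof. by apply: (L1_bounded P mb (M := 1)) => o; rewrite /b; case: (B o); rewrite ?normr1 ?normr0. Qed.

Let mXY : measurable_fun setT (fun o => (X o, Y1 o, Y2 o)).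
Proof. by apply: measurable_fun_pair => //; exact: measurable_fun_pair. Qed.

Let mean_bM (h : rvec R m * R * R -> R) : measurable_fun setT h ->
  L1 P (fun o => h (X o, Y1 o, Y2 o)) ->
  L1 P (fun o => b o * h (X o, Y1 o, Y2 o)) /\
  mean P (fun o => b o * h (X o, Y1 o, Y2 o)) = p * mean P (fun o => h (X o, Y1 o, Y2 o)).
Proof.
move=> mh ih; rewrite -mean_b; apply: indep_mul => //; first exact: measurableT_comp.
by apply: (indep_comp (f := fun c : bool => c%:R : R) (g := h) _ mh BXY).
Qed.

Let mean_mix (h1 h2 : rvec R m * R * R -> R) :
  measurable_fun setT h1 -> measurable_fun setT h2 ->
  L1 P (fun o => h1 (X o, Y1 o, Y2 o)) -> L1 P (fun o => h2 (X o, Y1 o, Y2 o)) ->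
  L1 P (fun o => b o * h1 (X o, Y1 o, Y2 o) + (1 - b o) * h2 (X o, Y1 o, Y2 o)) /\
  mean P (fun o => b o * h1 (X o, Y1 o, Y2 o) + (1 - b o) * h2 (X o, Y1 o, Y2 o)) =
  p * mean P (fun o => h1 (X o, Y1 o, Y2 o)) + (1 - p) * mean P (fun o => h2 (X o, Y1 o, Y2 o)).
Proof.
move=> mh1 mh2 ih1 ih2; have [i1 e1] := mean_bM mh1 ih1; have [i2 e2] := mean_bM mh2 ih2.
have -> : (fun o => b o * h1 (X o, Y1 o, Y2 o) + (1 - b o) * h2 (X o, Y1 o, Y2 o)) =
   (fun o => b o * h1 (X o, Y1 o, Y2 o) + (h2 (X o, Y1 o, Y2 o) - b o * h2 (X o, Y1 o, Y2 o))).
  by apply/funext => o; ring.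
split; first by apply: L1D => //; exact: L1B.
by rewrite meanD ?meanB ?e1 ?e2//; [ring|exact: L1B].
Qed.

Let iXj2 j : L1 P (fun o => (X o : 'cV_m) j 0 ^+ 2).
Proof.
have := iXX (rshift 1 j) (rshift 1 j); congr (L1 P _); apply/funext => o.
by rewrite /Xtilde /tilde col_mxEd expr2.
Qed.

Let mXj j : measurable_fun setT (fun o => (X o : 'cV_m) j 0).
Proof. exact: (measurableT_comp (measurable_coord j) mX). Qed.

Let mdotX l : measurable_fun setT (fun o => dotp l (X o)).
Proof. exact: (measurableT_comp (measurable_dotp l) mX). Qed.

Let idotX2 l : L1 P (fun o => dotp l (X o) ^+ 2).
Proof.
under eq_fun do rewrite dotpE.
by apply: L1_sum_sqr => j; [exact: measurable_funM|exact: L1Z_sqr].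
Qed.

Let g1 (x : rvec R m) : R := mu1 + dotp beta x.

Let mg1 : measurable_fun setT g1.
Proof. by apply: measurable_funD => //; exact: measurable_dotp. Qed.

Let mg1X : measurable_fun setT (fun o => g1 (X o)).
Proof. exact: measurableT_comp. Qed.

Let ig12 : L1 P (fun o => g1 (X o) ^+ 2).
Proof. by apply: (L1D_sqr (measurable_cst mu1) (mdotX beta)) => //; exact: (L1_cst P (mu1 ^+ 2)). Qed.

Let U o := Y1 o - g1 (X o).

Let mU : measurable_fun setT U.
Proof. exact: measurable_funB. Qed.

Let UE : {ae P, forall o, (Y1 o - condE P X Y1 o) ^+ 2 = U o ^+ 2}.
Proof. by apply: filterS (condE_ae mX cY1) => o /= ->. Qed.

Let mcond : measurable_fun setT (fun o => (Y1 o - condE P X Y1 o) ^+ 2).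
Proof. by apply: measurable_sqr; apply: measurable_funB => //; exact: (condE_measurable mX (condEP cY1)). Qed.

Let iU2 : L1 P (fun o => U o ^+ 2).
Proof. by apply: (ae_L1 _ UE); [exact: measurable_sqr|case: vY1]. Qed.

Let iU : L1 P U.
Proof. exact: L1_of_sqr. Qed.

Let iY1 : L1 P Y1.
Proof. by case: cY1. Qed.

Let iY12 : L1 P (fun o => Y1 o ^+ 2).
Proof.
have := L1D_sqr mU mg1X iU2 ig12; congr (L1 P _); apply/funext => o.
by rewrite /U subrK.
Qed.

Let mI (A : set (rvec R m)) : measurable A -> measurable_fun setT (\1_A : rvec R m -> R).
Proof. by move=> mA; exact: measurable_indic. Qed.

Let mIX (A : set (rvec R m)) : measurable A -> measurable_fun setT (fun o => \1_A (X o) : R).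
Proof. by move=> mA; exact: (measurableT_comp (mI mA) mX). Qed.

Let iI (A : set (rvec R m)) : measurable A -> L1 P (fun o => \1_A (X o)).
Proof.
by move=> mA; apply: (L1_bounded P (mIX mA) (M := 1)) => o; rewrite indicE; case: (_ \in _);
  rewrite ?normr1 ?normr0.
Qed.

Let mean_U A : measurable A -> mean P (fun o => \1_A (X o) * U o) = 0.
Proof.
move=> mA; have := condE_indic mX cY1 mA => e.
rewrite [LHS](_ : _ = mean P (fun o => \1_A (X o) * Y1 o - \1_A (X o) * g1 (X o))); last first.
  by apply: eq_mean => o; rewrite /U mulrBr.
have ig1 : L1 P (fun o => g1 (X o)) by exact: L1_of_sqr.
by rewrite meanB ?e ?subrr//; exact: L1_indicV.
Qed.

Let mean_U2 A : measurable A -> mean P (fun o => \1_A (X o) * U o ^+ 2) =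
  sigma1 ^+ 2 * mean P (fun o => \1_A (X o)).
Proof.
move=> mA; have := condE_indic mX vY1 mA; rewrite /cst.
rewrite [X in _ = X -> _](_ : _ = sigma1 ^+ 2 * mean P (fun o => \1_A (X o))); last first.
  by rewrite -meanZ ?iI//; apply: eq_mean => o; rewrite mulrC.
move=> <-; apply: ae_mean.
- by apply: measurable_funM; [exact: mIX|exact: measurable_sqr].
- by apply: measurable_funM; [exact: mIX|].
- by apply: filterS UE => o ->.
Qed.

(** The regression function of Y1 is unbounded, so this is not an instance of
    the definition of conditional expectation. *)
Let mean_gU A : measurable A -> mean P (fun o => \1_A (X o) * g1 (X o) * U o) = 0.
Proof.
move=> mA; have mh : measurable_fun setT (fun x => \1_A x * g1 x).
  by apply: measurable_funM => //; exact: mI.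
apply: (@mean_orthogonal _ _ _ P U (fun o => \1_A (X o) * g1 (X o))) => //.
- exact: (measurableT_comp mh mX).
- under eq_fun do rewrite -mulrA.
  by apply: L1_indicV => //; exact: L1M_of_sqr.
- move=> C mC; apply: (@mean_U ((fun x => \1_A x * g1 x) @^-1` C)).
  by rewrite -[X in measurable X]setTI; exact: mh.
Qed.

Let mean_Y12 A : measurable A -> mean P (fun o => \1_A (X o) * Y1 o ^+ 2) =
  mean P (fun o => \1_A (X o) * (sigma1 ^+ 2 + g1 (X o) ^+ 2)).
Proof.
move=> mA; have i1 := L1_indicV mX iU2 mA; have i2 := L1_indicV mX ig12 mA.
have i3 : L1 P (fun o => \1_A (X o) * g1 (X o) * U o).
  under eq_fun do rewrite -mulrA.
  by apply: L1_indicV => //; exact: L1M_of_sqr.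
have -> : mean P (fun o => \1_A (X o) * Y1 o ^+ 2) = mean P (fun o =>
    \1_A (X o) * U o ^+ 2 + (2 * (\1_A (X o) * g1 (X o) * U o) + \1_A (X o) * g1 (X o) ^+ 2)).
  by apply: eq_mean => o; rewrite /U; ring.
rewrite meanD ?meanD ?meanZ//; [|exact: L1Z|by apply: L1D => //; exact: L1Z].
rewrite mean_gU// mean_U2// mulr0 add0r -meanZ ?iI// -meanD//; last exact/L1Z/iI.
by apply: eq_mean => o; ring.
Qed.

Let Y2_moments := variance_finite mY2 EY2 VY2.

Let mean_Y2k (k : nat) A : measurable A -> L1 P (fun o => Y2 o ^+ k) ->
  mean P (fun o => \1_A (X o) * Y2 o ^+ k) =
  mean P (fun o => \1_A (X o)) * mean P (fun o => Y2 o ^+ k).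
Proof.
move=> mA iY; apply: indep_mean_mul => //.
- exact: mIX.
- exact: measurable_funX.
- apply: indepC; apply: (indep_comp (f := fun y : R => y ^+ k) (g := \1_A : _ -> R) _ (mI mA) Y2X).
  exact: exprn_measurable.
- exact: iI.
Qed.

Let Y_pow (k : nat) o : Y o ^+ k.+1 = b o * Y1 o ^+ k.+1 + (1 - b o) * Y2 o ^+ k.+1.
Proof. by rewrite YE /b; case: (B o); rewrite /= ?subrr ?subr0 ?mul1r ?mul0r ?addr0 ?add0r. Qed.

(** The indicator B selects the component, for Y as well as for its powers. *)
Let mix_cond (k : nat) (g : rvec R m -> R) (c : R) : measurable_fun setT g ->
  L1 P (fun o => Y1 o ^+ k.+1) -> L1 P (fun o => Y2 o ^+ k.+1) -> L1 P (fun o => g (X o)) ->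
  mean P (fun o => Y2 o ^+ k.+1) = c ->
  (forall A, measurable A -> mean P (fun o => \1_A (X o) * Y1 o ^+ k.+1) =
    mean P (fun o => \1_A (X o) * g (X o))) ->
  is_condE P X (fun o => Y o ^+ k.+1) (fun o => p * g (X o) + (1 - p) * c).
Proof.
move=> mg i1 i2 ig <- H.
have mp1 : measurable_fun setT (fun z : rvec R m * R * R => z.1.2).
  by apply: (measurableT_comp measurable_snd); exact: measurable_fst.
have mp0 : measurable_fun setT (fun z : rvec R m * R * R => z.1.1).
  by apply: (measurableT_comp measurable_fst); exact: measurable_fst.
have mh1 : measurable_fun setT (fun z : rvec R m * R * R => z.1.2 ^+ k.+1).
  exact: measurable_funX.
have mh2 : measurable_fun setT (fun z : rvec R m * R * R => z.2 ^+ k.+1).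
  exact: measurable_funX.
apply: (@is_condE_fun _ _ _ _ _ _ _ _ (fun x => p * g x + (1 - p) * _)) => //.
- by apply: measurable_funD; exact: measurable_funM.
- under eq_fun do rewrite Y_pow.
  by have [] := mean_mix mh1 mh2 i1 i2.
- by apply: L1D; [exact: L1Z|exact: L1_cst].
move=> A mA; have mIz : measurable_fun setT (fun z : rvec R m * R * R => \1_A z.1.1 : R).
  exact: (measurableT_comp (mI mA) mp0).
have := mean_mix (measurable_funM mIz mh1) (measurable_funM mIz mh2)
  (L1_indicV mX i1 mA) (L1_indicV mX i2 mA) => -[_ /=].
rewrite H// mean_Y2k// => e.
rewrite [LHS](_ : _ = mean P (fun o => b o * (\1_A (X o) * Y1 o ^+ k.+1) +
   (1 - b o) * (\1_A (X o) * Y2 o ^+ k.+1))); last first.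
  by apply: eq_mean => o; rewrite Y_pow; ring.
rewrite e; set c2 := mean P (fun o => Y2 o ^+ k.+1).
rewrite [RHS](_ : _ = mean P (fun o => p * (\1_A (X o) * g (X o)) + (1 - p) * c2 * \1_A (X o))).
  by rewrite meanD ?meanZ ?iI//; [ring|exact: L1_indicV|apply: L1Z; exact: L1_indicV|exact/L1Z/iI].
by apply: eq_mean => o; ring.
Qed.

Lemma mixture_condE : is_condE P X Y (fun o => mixture_mean (X o)).
Proof.
have [i2 _ e2 _] := Y2_moments.
apply: (@mix_cond 0 g1 mu2) => //; first exact: L1_of_sqr.
by move=> A mA; exact: (condE_indic mX cY1 mA).
Qed.

(** The second moment of Y1 given X is sigma1^2 plus the square of an affine
    function of X, which makes the one of Y quadratic in eta. *)
Lemma mixture_condE_sqr : is_condE P X (fun o => Y o ^+ 2) (fun o => mixture_sqr (X o)).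
Proof.
have [_ i2 _ e2] := Y2_moments.
have -> : (fun o => mixture_sqr (X o)) =
  (fun o => p * (sigma1 ^+ 2 + g1 (X o) ^+ 2) + (1 - p) * (sigma2 ^+ 2 + mu2 ^+ 2)).
  have p0 : p != 0 by case/andP: p01 => /lt0r_neq0.
  by apply/funext => o; rewrite /mixture_sqr /mixture_const dotpZl /g1; field.
apply: (@mix_cond 1 (fun x => sigma1 ^+ 2 + g1 x ^+ 2)) => //.
- by apply: measurable_funD => //; exact: measurable_funX.
- by apply: L1D => //; exact: L1_cst.
Qed.

End mixture.

(** * Matrices and least squares *)

Section matrix_limits.
Context (R : realType) (I : Type) (F : set_system I) {FF : Filter F}.

Definition cvg_mx a b (f : I -> 'M[R]_(a, b)) (A : 'M[R]_(a, b)) :=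
  forall i j, (fun x => f x i j) @ F --> A i j.

Lemma cvg_prod (J : Type) (s : seq J) (f : J -> I -> R) (a : J -> R) :
  (forall j, f j @ F --> a j) ->
  (fun x => \prod_(j <- s) f j x) @ F --> \prod_(j <- s) a j.
Proof.
move=> fa; elim: s => [|j s IH].
  by rewrite big_nil; under eq_fun do rewrite big_nil; exact: cvg_cst.
by rewrite big_cons; under eq_fun do rewrite big_cons; exact: cvgM.
Qed.

Lemma cvg_mx_mul a b c (f : I -> 'M[R]_(a, b)) (g : I -> 'M[R]_(b, c)) A B :
  cvg_mx f A -> cvg_mx g B -> cvg_mx (fun x => f x *m g x) (A *m B).
Proof.
move=> fA gB i j; rewrite mxE; under eq_fun do rewrite mxE.
by apply: cvg_sum => k; apply: cvgM; [exact: fA|exact: gB].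
Qed.

Lemma cvg_det a (f : I -> 'M[R]_a) A : cvg_mx f A ->
  (fun x => \det (f x)) @ F --> \det A.
Proof.
move=> fA; apply: cvg_sum => s; apply: cvgM; first exact: cvg_cst.
by apply: cvg_prod => i; exact: fA.
Qed.

(** Cramer's rule: determinants are polynomials in the entries. *)
Lemma cvg_invmx a (f : I -> 'M[R]_a) A : cvg_mx f A -> A \in unitmx ->
  (\forall x \near F, f x \in unitmx) /\ cvg_mx (fun x => invmx (f x)) (invmx A).
Proof.
move=> fA uA; have dA := cvg_det fA.
have d0 : \det A != 0 by rewrite -unitfE -unitmxE.
have near_unit : \forall x \near F, f x \in unitmx.
  have dn0 : \forall x \near F, \det (f x) != 0 by exact: cvgr_neq0 dA d0.
  by apply: filterS dn0 => x; rewrite unitmxE unitfE.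
split=> // i j.
have H : (fun x => (\det (f x))^-1 * \adj (f x) i j) @ F --> invmx A i j.
  rewrite /invmx uA !mxE; apply: cvgM; first exact: cvgV.
  under eq_fun do rewrite mxE.
  apply: cvgM; first exact: cvg_cst.
  by apply: cvg_det => k l; rewrite !mxE; under eq_fun do rewrite !mxE; exact: fA.
apply: cvg_trans H; apply: near_eq_cvg; apply: filterS near_unit => x ux.
by rewrite /invmx ux !mxE.
Qed.

End matrix_limits.

Section matrix_measurability.
Context (R : realType) (d : measure_display) (T : measurableType d).

Definition measurable_mx a b (f : T -> 'M[R]_(a, b)) :=
  forall i j, measurable_fun setT (fun t => f t i j).

Lemma measurable_mx_mul a b c (f : T -> 'M[R]_(a, b)) (g : T -> 'M[R]_(b, c)) :
  measurable_mx f -> measurable_mx g -> measurable_mx (fun t => f t *m g t).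
Proof.
move=> mf mg i j; under eq_fun do rewrite mxE.
by apply: measurable_sum => k; apply: measurable_funM; [exact: mf|exact: mg].
Qed.

Lemma measurable_mx_cst a b (A : 'M[R]_(a, b)) : measurable_mx (fun=> A).
Proof. by move=> i j; exact: measurable_cst. Qed.

Lemma measurable_det a (f : T -> 'M[R]_a) : measurable_mx f ->
  measurable_fun setT (fun t => \det (f t)).
Proof.
move=> mf; apply: measurable_sum => s; apply: measurable_funM => //.
by apply: measurable_prod => i _; exact: mf.
Qed.

Lemma measurable_funinv (f : T -> R) : measurable_fun setT f ->
  measurable_fun setT (fun t => (f t)^-1).
Proof.
move=> mf; apply: (measurableT_comp (f := fun x : R => x^-1)) => //.
have -> : (fun x : R => x^-1) = fun x => if x == 0 then 0 else x^-1.
  by apply/funext => x; case: eqP => // ->; rewrite invr0.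
apply: measurable_fun_if => //; first exact: measurable_fun_eqr.
have E : [set: R] `&` (fun x => x == 0) @^-1` [set false] = [set x : R | x != 0].
  by apply/seteqP; split => x /= => [[_]|/negbTE]; [move/negbT|].
rewrite E; apply: open_continuous_measurable_fun; first exact: open_neq.
by move=> x; rewrite inE /= => x0; exact: inv_continuous.
Qed.

Lemma measurable_invmx a (f : T -> 'M[R]_a) : measurable_mx f ->
  measurable_mx (fun t => invmx (f t)).
Proof.
move=> mf i j; have md := measurable_det mf.
have madj : measurable_fun setT (fun t => \adj (f t) i j).
  under eq_fun do rewrite mxE; apply: measurable_funM => //.
  apply: measurable_det => k l; under eq_fun do rewrite !mxE; exact: mf.
have -> : (fun t => invmx (f t) i j) =
    (fun t => if \det (f t) == 0 then f t i j else (\det (f t))^-1 * \adj (f t) i j).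
  apply/funext => t; rewrite /invmx unitmxE unitfE.
  by case: eqP => //= _; rewrite !mxE.
apply: measurable_fun_ifT.
- exact: measurable_fun_eqr.
- exact: mf.
- by apply: measurable_funM => //; exact: measurable_funinv.
Qed.

End matrix_measurability.

Section least_squares.
Context (R : realType) (m : nat).
Implicit Types (x : nat -> 'cV[R]_m) (y : nat -> R) (l : 'cV[R]_m).

Definition gram n x : 'M[R]_(1 + m) := (design n x)^T *m design n x.

Lemma gramE n x j k :
  gram n x j k = \sum_(i < n) tilde (x i) j 0 * tilde (x i) k 0.
Proof. by rewrite mxE; apply: eq_bigr => i _; rewrite !mxE. Qed.

Lemma tilde_mul (x0 : 'cV[R]_m) (c0 : R) l :
  (tilde x0)^T *m col_mx c0%:M l = (c0 + dotp l x0)%:M.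
Proof.
rewrite /tilde tr_col_mx mul_row_col trmx1 mul1mx raddfD /=; congr (_ + _).
by rewrite dotpC [LHS]mx11_scalar.
Qed.

(** The response is the design matrix times the coefficients plus the
    residuals, and [Aproj] removes the intercept. *)
Lemma lambda1_hat_error n x y (c0 : R) l : gram n x \in unitmx ->
  lambda1_hat n x y - l = Aproj R m *m invmx (gram n x) *m
    \sum_(i < n) (y i - (c0 + dotp l (x i))) *: tilde (x i).
Proof.
move=> u; rewrite /lambda1_hat -/(gram n x); set A := Aproj R m.
have -> : \sum_(i < n) (y i - (c0 + dotp l (x i))) *: tilde (x i) =
    (design n x)^T *m response n y - gram n x *m col_mx c0%:M l.
  apply/matrixP => k o; rewrite (ord1 o) /gram -mulmxA -mulmxBr summxE mxE.
  apply: eq_bigr => i _; rewrite !mxE mulrC; congr (_ * (_ - _)).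
  have := tilde_mul (x i) c0 l => /matrixP /(_ 0 0); rewrite !mxE eqxx mulr1n => <-.
  by apply: eq_bigr => j _; rewrite !mxE.
rewrite mulmxBr !mulmxA; congr (_ - _).
rewrite -(mulmxA (A *m invmx (gram n x))) -/(gram n x) -(mulmxA A) mulVmx// mulmx1 /A /Aproj mul_row_col mul0mx add0r.
by rewrite mul1mx.
Qed.

Lemma measurable_tilde k : measurable_fun setT (fun x : rvec R m => tilde (x : 'cV_m) k 0).
Proof.
rewrite /tilde; case: (split_ordP k) => j ->.
  by under eq_fun do rewrite col_mxEu mxE; exact: measurable_cst.
under eq_fun do rewrite col_mxEd.
exact: measurable_coord.
Qed.

End least_squares.

Section first_stage.
Context (R : realType) (d : measure_display) (T : measurableType d)
  (P : probability T R) (m : nat).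
Let S := (rvec R m * R)%type.
Context (X : T -> rvec R m) (Y : T -> R) (Xs : nat -> T -> rvec R m) (Ys : nat -> T -> R).
Let Z t : S := (X t, Y t).
Let Zs i t : S := (Xs i t, Ys i t).
Context (mZs : forall i, measurable_fun setT (Zs i)) (mZ : measurable_fun setT Z)
  (iid : iid_copies P Zs Z).
Context (c0 : R) (l1 : 'cV[R]_m).

Definition tilde_coord (k : 'I_(1 + m)) (z : S) : R := tilde (z.1 : 'cV_m) k 0.

Definition residual (z : S) : R := z.2 - (c0 + dotp l1 z.1).

Hypothesis iXX : forall j k, L1 P (fun o => (Xtilde X o : 'cV_(1 + m)) j 0 *
  (Xtilde X o : 'cV_(1 + m)) k 0).
Hypothesis uM : second_moment P X \in unitmx.
Hypothesis score0 : forall k, mean P (fun t => residual (Z t) * tilde_coord k (Z t)) = 0.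
Hypothesis score2 : forall k, L1 P (fun t => (residual (Z t) * tilde_coord k (Z t)) ^+ 2).

Definition ols_influence (z : S) : 'cV[R]_m :=
  Aproj R m *m invmx (second_moment P X) *m (residual z *: tilde (z.1 : 'cV_m)).

Lemma measurable_tilde_coord k : measurable_fun setT (tilde_coord k).
Proof. by apply: (measurableT_comp (measurable_tilde k)); exact: measurable_fst. Qed.

Let mdot l : measurable_fun setT (fun z : S => dotp l z.1).
Proof. by apply: (measurableT_comp (measurable_dotp l)); exact: measurable_fst. Qed.

Lemma measurable_residual : measurable_fun setT residual.
Proof.
apply: measurable_funB; first exact: measurable_snd.
exact: measurable_funD.
Qed.

Let mscore k : measurable_fun setT (fun z => residual z * tilde_coord k z).
Proof. by apply: measurable_funM; [exact: measurable_residual|exact: measurable_tilde_coord]. Qed.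

Let weights : 'M[R]_(m, 1 + m) := Aproj R m *m invmx (second_moment P X).

Let ols_influenceE z j : ols_influence z j 0 =
  \sum_k weights j k * (residual z * tilde_coord k z).
Proof.
by rewrite /ols_influence mxE; apply: eq_bigr => k _; congr (_ * _); rewrite mxE.
Qed.

Lemma measurable_ols_influence j : measurable_fun setT (fun z => ols_influence z j 0).
Proof.
under eq_fun do rewrite ols_influenceE.
by apply: measurable_sum => k; exact: measurable_funM.
Qed.

Let mscoreZ k : measurable_fun setT (fun t => residual (Z t) * tilde_coord k (Z t)).
Proof. exact: (measurableT_comp (mscore k) mZ). Qed.

Lemma ols_influence_mean0 j : mean P (fun t => ols_influence (Z t) j 0) = 0.
Proof.
under eq_mean do rewrite ols_influenceE.
rewrite mean_sum; last by move=> k _; apply: L1Z; exact: L1_of_sqr.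
by rewrite big1// => k _; rewrite meanZ ?score0 ?mulr0//; exact: L1_of_sqr.
Qed.

Lemma ols_influence_L2 j : L1 P (fun t => ols_influence (Z t) j 0 ^+ 2).
Proof.
under eq_fun do rewrite ols_influenceE.
by apply: L1_sum_sqr => k; [exact: measurable_funM|exact: L1Z_sqr].
Qed.

Definition ols (x : nat * T) : 'cV[R]_m :=
  lambda1_hat x.1 (fun i => Xs i x.2) (fun i => Ys i x.2).

Let Mn (x : nat * T) : 'M[R]_(1 + m) :=
  \matrix_(j, k) average Zs (fun z => tilde_coord j z * tilde_coord k z) x.

Let gram_Mn x : (0 < x.1)%N -> gram x.1 (fun i => Xs i x.2) = x.1%:R *: Mn x.
Proof.
move=> x0; apply/matrixP => j k; rewrite gramE !mxE /average mulrA mulfV ?mul1r//.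
by rewrite pnatr_eq0 -lt0n.
Qed.

Let Mn_cvg : cvg_mx (whp P) Mn (second_moment P X).
Proof.
move=> j k; under eq_fun do rewrite mxE; rewrite mxE.
apply: (weak_law mZs mZ iid (h := fun z => tilde_coord j z * tilde_coord k z)).
  by apply: measurable_funM; exact: measurable_tilde_coord.
exact: iXX.
Qed.

Let rs (x : nat * T) : 'cV[R]_(1 + m) :=
  \col_k root_sum Zs (fun z => residual z * tilde_coord k z) x.

Let ols_error x : (0 < x.1)%N -> Mn x \in unitmx ->
  Num.sqrt x.1%:R *: (ols x - l1) = Aproj R m *m invmx (Mn x) *m rs x.
Proof.
move=> x0 uMn; have n0 : (x.1%:R : R) != 0 by rewrite pnatr_eq0 -lt0n.
have un : (x.1%:R : R) \is a GRing.unit by rewrite unitfE.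
have ug : gram x.1 (fun i => Xs i x.2) \in unitmx by rewrite gram_Mn// unitmxZ.
rewrite /ols (lambda1_hat_error _ c0 l1 ug) gram_Mn// invmxZ ?unitmxZ// -scalemxAr.
rewrite -scalemxAl scalerA scalemxAr; congr (_ *m _).
apply/matrixP => k o; rewrite (ord1 o) !mxE summxE /root_sum.
have -> : Num.sqrt x.1%:R * x.1%:R^-1 = (Num.sqrt x.1%:R)^-1 :> R.
  have s0 : Num.sqrt x.1%:R != 0 :> R by rewrite gt_eqF// sqrtr_gt0 ltr0n.
  by rewrite -{2}(sqr_sqrtr (ler0n R x.1)); field.
by congr (_ * _); apply: eq_bigr => i _; rewrite mxE.
Qed.

(** The inverse Gram matrix converges by the weak law, and it multiplies
    normalized sums that are bounded in probability. *)
Theorem ols_expansion j : (fun x => Num.sqrt x.1%:R * (ols x - l1) j 0 -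
  root_sum Zs (fun z => ols_influence z j 0) x) @ whp P --> (0 : R).
Proof.
have [Mn_unit inv_cvg] := cvg_invmx Mn_cvg uM.
have cst_cvg : cvg_mx (whp P) (fun=> Aproj R m) (Aproj R m).
  by move=> i k; exact: cvg_cst.
have W_cvg := cvg_mx_mul cst_cvg inv_cvg.
have H : (fun x => \sum_k ((Aproj R m *m invmx (Mn x)) j k - weights j k) *
    root_sum Zs (fun z => residual z * tilde_coord k z) x) @ whp P --> (0 : R).
  rewrite [X in _ --> X](_ : _ = \sum_(k < 1 + m) 0); last by rewrite big1.
  apply: cvg_sum => k; apply: (root_sum_bounded mZs mZ iid (mscore k)) => //.
  by apply: cvg_to0; exact: W_cvg.
apply: whp_cvg_near H; apply: (filterS _ (filterI (whp_pos P) Mn_unit)) => x [x0 ux].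
have -> : Num.sqrt x.1%:R * (ols x - l1) j 0 = (Num.sqrt x.1%:R *: (ols x - l1)) j 0.
  by rewrite !mxE.
rewrite ols_error// [in RHS]mxE.
have -> : root_sum Zs (fun z => ols_influence z j 0) x =
   \sum_k weights j k * root_sum Zs (fun z => residual z * tilde_coord k z) x.
  rewrite /root_sum; under eq_bigr do rewrite ols_influenceE.
  rewrite exchange_big /= mulr_sumr; apply: eq_bigr => k _.
  by rewrite -mulr_sumr mulrCA.
by rewrite -sumrB; apply: eq_bigr => k _; rewrite mulrBl; congr (_ * _ - _); rewrite mxE.
Qed.

Lemma ols_bounded j : bounded_prob P (fun x => Num.sqrt x.1%:R * (ols x - l1) j 0).
Proof.
have -> : (fun x => Num.sqrt x.1%:R * (ols x - l1) j 0) = fun x =>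
  (Num.sqrt x.1%:R * (ols x - l1) j 0 - root_sum Zs (fun z => ols_influence z j 0) x) +
  root_sum Zs (fun z => ols_influence z j 0) x.
  by apply/funext => x; rewrite subrK.
apply: bounded_probD; first exact: (bounded_prob_cvg (@ols_expansion j)).
apply: (root_sum_bounded mZs mZ iid); [exact: measurable_ols_influence|exact: ols_influence_mean0|].
exact: ols_influence_L2.
Qed.

Let mXs i k : measurable_fun setT (fun t => tilde (Xs i t : 'cV_m) k 0).
Proof. exact: (measurableT_comp (measurable_tilde_coord k) (mZs i)). Qed.

Lemma measurable_ols n j : measurable_fun setT (fun t => ols (n, t) j 0).
Proof.
rewrite /ols /lambda1_hat /=.
have mD : measurable_mx (fun t => design n (fun i => Xs i t : 'cV_m)).
  by move=> i k; under eq_fun do rewrite mxE mxE; exact: mXs.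
have mDT : measurable_mx (fun t => (design n (fun i => Xs i t : 'cV_m))^T).
  by move=> i k; under eq_fun do rewrite mxE; exact: mD.
have mR : measurable_mx (fun t => response n (fun i => Ys i t)).
  move=> i k; under eq_fun do rewrite mxE.
  exact: (measurableT_comp measurable_snd (mZs i)).
have mG := measurable_mx_mul mDT mD.
have mI := measurable_invmx mG.
exact: (measurable_mx_mul (measurable_mx_mul (measurable_mx_mul (measurable_mx_cst _) mI) mDT) mR).
Qed.

End first_stage.

(** * Consistency, asymptotic linearity and asymptotic normality *)

Section estimator.
Context (R : realType) (d : measure_display) (T : measurableType d)
  (P : probability T R) (m : nat).
Let S := (rvec R m * R)%type.
Context (X : T -> rvec R m) (Y : T -> R) (Xs : nat -> T -> rvec R m) (Ys : nat -> T -> R).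
Let Z t : S := (X t, Y t).
Let Zs i t : S := (Xs i t, Ys i t).
Context (mX : measurable_fun setT X) (mY : measurable_fun setT Y)
  (mXs : forall i, measurable_fun setT (Xs i)) (mYs : forall i, measurable_fun setT (Ys i))
  (iid : iid_copies P Zs Z).
Context (w : R -> R) (l1 : 'cV[R]_m) (c0 alpha la2 la3 : R).
Let regr (x : rvec R m) : R := c0 + dotp l1 x.
Let regr2 (x : rvec R m) : R := alpha + la2 * dotp l1 x + la3 * dotp l1 x ^+ 2.
Hypothesis cY : is_condE P X Y (fun o => regr (X o)).
Hypothesis cY2 : is_condE P X (fun o => Y o ^+ 2) (fun o => regr2 (X o)).
Hypothesis dw : forall t : R, derivable w t 1.
Hypothesis dw1 : forall t : R, derivable (derive1 w) t 1.
Hypothesis cw2 : continuous (derive1n 2 w).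
Hypothesis domw : locally_dominated P X Y l1 (fun e _ => w e).
Hypothesis dom : forall jk, jk \in moment_exponents ->
  locally_dominated P X Y l1 (fun e y => e ^+ jk.1 * y ^+ jk.2 * w e).
Hypothesis sqr : forall jk, jk \in (0%N, 0%N) :: moment_exponents ->
  L1 P (fun t => (dotp l1 (X t) ^+ jk.1 * Y t ^+ jk.2 * w (dotp l1 (X t))) ^+ 2).
Hypothesis iXX : forall j k, L1 P (fun o => (Xtilde X o : 'cV_(1 + m)) j 0 *
  (Xtilde X o : 'cV_(1 + m)) k 0).
Hypothesis uM : second_moment P X \in unitmx.
Hypothesis eps2 : L1 P (fun o => let v := (Y o - condE P X Y o) *: (Xtilde X o : 'cV_(1 + m)) in
  dotp v v).
Hypothesis Pw_gt0 : 0 < Pw P w X l1.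
Hypothesis g0 : g3 (P_w P w X Y l1) != 0.

Let mZ : measurable_fun setT Z. Proof. exact: measurable_fun_pair. Qed.
Let mZs i : measurable_fun setT (Zs i). Proof. exact: measurable_fun_pair. Qed.
Let Pw0 : Pw P w X l1 != 0. Proof. exact: lt0r_neq0. Qed.

Let mdot (l : 'cV[R]_m) : measurable_fun setT (dotp l : rvec R m -> R).
Proof. exact: measurable_dotp. Qed.

Let mregr : measurable_fun setT regr.
Proof. exact: measurable_funD. Qed.

Let mregr2 : measurable_fun setT regr2.
Proof.
apply: measurable_funD; first by apply: measurable_funD => //; exact: measurable_funM.
by apply: measurable_funM => //; exact: measurable_funX.
Qed.

Let mw : measurable_fun setT w.
Proof.
apply: continuous_measurable_fun => t.
by apply: differentiable_continuous; apply/derivable1_diffP; exact: dw.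
Qed.

Let iX2 j : L1 P (fun o => (X o : 'cV_m) j 0 ^+ 2).
Proof.
have := iXX (rshift 1 j) (rshift 1 j); congr (L1 P _); apply/funext => o.
by rewrite /Xtilde /tilde col_mxEd expr2.
Qed.

Let iY2 : L1 P (fun o => Y o ^+ 2).
Proof. by case: cY2. Qed.

Let iregr_sqr : L1 P (fun o => regr (X o) ^+ 2).
Proof.
apply: (L1D_sqr (measurable_cst c0) (f := fun=> c0)).
- exact: (measurableT_comp (mdot l1) mX).
- exact: (L1_cst P (c0 ^+ 2)).
under eq_fun do rewrite dotpE.
apply: L1_sum_sqr => j; last exact: L1Z_sqr.
by apply: measurable_funM => //; exact: (measurableT_comp (measurable_coord j) mX).
Qed.

Let mres : measurable_fun setT (fun o => residual c0 l1 (Z o)).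
Proof. exact: (measurableT_comp (measurable_residual c0 l1) mZ). Qed.

Let ires2 : L1 P (fun o => residual c0 l1 (Z o) ^+ 2).
Proof.
have mrX : measurable_fun setT (fun o => regr (X o)) by exact: measurableT_comp.
apply: (@L1D_sqr _ _ _ P Y (fun o => - regr (X o))) => //.
- exact: measurable_funN.
- by under eq_fun do rewrite sqrrN.
Qed.

(** The residual of a conditional expectation is orthogonal to the functions
    of the conditioning variable. *)
Lemma condE_orthogonal (Y' : T -> R) (g h : rvec R m -> R) : measurable_fun setT h ->
  is_condE P X Y' (fun o => g (X o)) ->
  L1 P (fun o => h (X o) * (Y' o - g (X o))) ->
  mean P (fun o => h (X o) * (Y' o - g (X o))) = 0.
Proof.
move=> mh c ih; have [iY' ig _ _] := c.
apply: (@mean_orthogonal _ _ _ P (fun o => Y' o - g (X o)) (fun o => h (X o))) => //.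
- exact: L1B.
- exact: (measurableT_comp mh mX).
move=> B mB; have mhB : measurable (h @^-1` B).
  by rewrite -[X in measurable X]setTI; exact: mh.
have e := condE_indic mX c mhB.
rewrite [LHS](_ : _ = mean P (fun o => \1_(h @^-1` B) (X o) * Y' o - \1_(h @^-1` B) (X o) * g (X o))).
  by rewrite meanB ?L1_indicV// e subrr.
by apply: eq_mean => o; rewrite mulrBr.
Qed.

Let mtX k : measurable_fun setT (fun o => tilde (X o : 'cV_m) k 0).
Proof. exact: (measurableT_comp (measurable_tilde k) mX). Qed.

Let itX2 k : L1 P (fun o => tilde (X o : 'cV_m) k 0 ^+ 2).
Proof. exact: iXX. Qed.

Let score0 k : mean P (fun t => residual c0 l1 (Z t) * tilde_coord k (Z t)) = 0.
Proof.
under eq_mean do rewrite mulrC.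
apply: (@condE_orthogonal Y regr (fun x => tilde (x : 'cV_m) k 0)) => //.
- exact: measurable_tilde.
- exact: (@L1M_of_sqr _ _ _ P (fun o => tilde (X o : 'cV_m) k 0) (fun o => residual c0 l1 (Z o))).
Qed.

Let mcond : measurable_fun setT (condE P X Y).
Proof. exact: (condE_measurable mX (condEP cY)). Qed.

Let score2 k : L1 P (fun t => (residual c0 l1 (Z t) * tilde_coord k (Z t)) ^+ 2).
Proof.
have i1 : L1 P (fun t => ((Y t - condE P X Y t) * tilde_coord k (Z t)) ^+ 2).
  apply: L1_le eps2 => [|t].
    by apply: measurable_sqr; apply: measurable_funM; [exact: measurable_funB|exact: mtX].
  rewrite ger0_norm ?sqr_ge0// /= dotpE (bigD1 k)//= mxE -expr2 lerDl.
  by apply: sumr_ge0 => j _; rewrite -expr2 sqr_ge0.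
apply: (ae_L1 _ _ i1).
  by apply: measurable_sqr; apply: measurable_funM => //; exact: mtX.
by apply: filterS (condE_ae mX cY) => t /= ->.
Qed.

Let lhat := ols Xs Ys.

Let b_delta j : bounded_prob P (fun x => Num.sqrt x.1%:R * (lhat x - l1) j 0).
Proof. exact: (ols_bounded mZs mZ iid iXX uM score0 score2). Qed.

Let iw jk : jk \in (0%N, 0%N) :: moment_exponents ->
  L1 P (fun t => dotp l1 (X t) ^+ jk.1 * Y t ^+ jk.2 * w (dotp l1 (X t))).
Proof.
move=> mjk; apply: L1_of_sqr; last exact: sqr.
have mdX := measurableT_comp (mdot l1) mX.
apply: measurable_funM; last exact: (measurableT_comp mw mdX).
by apply: measurable_funM; exact: measurable_funX.
Qed.

Let mu j k := avg (P_w P w X Y l1) j k.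

(** [condE_orthogonal] applied to the residual of Y^2 and to eta^j w(eta). *)
Let mom j : (j <= 2)%N ->
  mu j 2 = alpha * mu j 0 + la2 * mu j.+1 0 + la3 * mu j.+2 0.
Proof.
move=> j2; have i_y : L1 P (fun t => dotp l1 (X t) ^+ j * Y t ^+ 2 * w (dotp l1 (X t))).
  by apply: (iw (jk := (j, 2)%N)); move: j j2 => [|[|[|]]].
have i_e k : (k <= 4)%N -> L1 P (fun t => dotp l1 (X t) ^+ k * Y t ^+ 0 * w (dotp l1 (X t))).
  by move=> k4; apply: (iw (jk := (k, 0)%N)); move: k k4 => [|[|[|[|[|]]]]].
have i0 := i_e j (leq_trans j2 (isT : (2 <= 4)%N)).
have i1 : L1 P (fun t => dotp l1 (X t) ^+ j.+1 * Y t ^+ 0 * w (dotp l1 (X t))).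
  by apply: i_e; rewrite ltnS (leq_trans j2).
have i2 := i_e j.+2 j2.
have iA0 := L1Z alpha i0; have iA1 := L1Z la2 i1; have iA2 := L1Z la3 i2.
have iA01 := L1D iA0 iA1; have iA012 := L1D iA01 iA2.
rewrite /mu /avg /P_w !mulrA -!mulrDl; congr (_ / _); rewrite /Pfw.
rewrite -!meanZ// -!meanD//.
apply/eqP; rewrite -subr_eq0 -meanB//.
have E : (fun t => dotp l1 (X t) ^+ j * Y t ^+ 2 * w (dotp l1 (X t)) -
    (alpha * (dotp l1 (X t) ^+ j * Y t ^+ 0 * w (dotp l1 (X t))) +
     la2 * (dotp l1 (X t) ^+ j.+1 * Y t ^+ 0 * w (dotp l1 (X t))) +
     la3 * (dotp l1 (X t) ^+ j.+2 * Y t ^+ 0 * w (dotp l1 (X t))))) =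
   (fun t => (dotp l1 (X t) ^+ j * w (dotp l1 (X t))) * (Y t ^+ 2 - regr2 (X t))).
  by apply/funext => t; rewrite /regr2 !exprS; ring.
rewrite E; apply/eqP; apply: (@condE_orthogonal _ regr2 (fun x => dotp l1 x ^+ j * w (dotp l1 x))) => //.
  by apply: measurable_funM; [exact: measurable_funX|exact: measurableT_comp].
by rewrite -E; exact: L1B.
Qed.

Let mu00 : mu 0 0 = 1.
Proof.
rewrite /mu /avg /P_w (_ : Pfw _ _ _ _ _ _ = Pw P w X l1) ?divff//.
by apply: eq_mean => t; rewrite !expr0 !mul1r.
Qed.

Let m02 : mu 0 2 = alpha + la2 * mu 1 0 + la3 * mu 2 0.
Proof. by rewrite mom// mu00 mulr1. Qed.

Lemma lambda3_lim_true : lambda3_lim P w X Y l1 = la3.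
Proof.
apply: (lambda3_of_slope (N := P_w P w X Y) (alpha := alpha) (la2 := la2)) => //.
- exact: (mom (j := 1)).
- exact: (mom (j := 2)).
Qed.

Let phi3 : S -> R := lambda3_phi l1 (P_w P w X Y) (fun j k (z : S) => (Pw P w X l1)^-1 *
    ((dotp l1 z.1 ^+ j * z.2 ^+ k - mu j k) * w (dotp l1 z.1))).

Let phi3E z : phi3 z = (g3 (P_w P w X Y l1) * Pw P w X l1)^-1 * w (dotp l1 z.1) *
  (a3 (P_w P w X Y l1) * ((dotp l1 z.1 ^+ 2 - mu 2 0) * (z.2 ^+ 2 - regr2 z.1)) -
   a2 (P_w P w X Y l1) * ((dotp l1 z.1 - mu 1 0) * (z.2 ^+ 2 - regr2 z.1))).
Proof.
apply: (lambda3_phiE (alpha := alpha) (la2 := la2) (la3 := la3)) => //.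
- exact: (mom (j := 1)).
- exact: (mom (j := 2)).
Qed.

Let l3hat x := lambda3_hat w x.1 (fun i => Xs i x.2) (fun i => Ys i x.2).

Let exp3 : expansion P Zs Z l1 lhat l3hat (lambda3_lim P w X Y) phi3.
Proof. exact: (lambda3_lim_expansion mZs mZ iid dw dw1 cw2 b_delta domw dom sqr Pw0 g0). Qed.

Lemma differentiable_lambda3_lim : differentiable (lambda3_lim P w X Y) l1.
Proof. by have [] := expansion_gradient exp3. Qed.

Let grad := gradient (lambda3_lim P w X Y) l1.

Let xi (z : S) : 'cV[R]_m :=
  (la3%:M + l1 *m grad^T) *m ols_influence P X c0 l1 z + phi3 z *: l1.

Let xi_coord z j : xi z j 0 = l1 j 0 * phi3 z +
  (la3 * ols_influence P X c0 l1 z j 0 +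
   l1 j 0 * dotp grad (ols_influence P X c0 l1 z)).
Proof.
rewrite /xi mulmxDl mul_scalar_mx -mulmxA [grad^T *m _]mx11_scalar mul_mx_scalar.
rewrite -/(dotp grad _); set v := ols_influence _ _ _ _ _; set c := dotp grad v.
by rewrite !mxE; ring.
Qed.

Let rt (x : nat * T) : R := Num.sqrt x.1%:R.

Let dotp_ols (c : 'cV[R]_m) : (fun x => rt x * dotp c (lhat x - l1) -
  root_sum Zs (fun z => dotp c (ols_influence P X c0 l1 z)) x) @ whp P --> (0 : R).
Proof.
have H : (fun x => \sum_j c j 0 * (rt x * (lhat x - l1) j 0 -
    root_sum Zs (fun z => ols_influence P X c0 l1 z j 0) x)) @ whp P --> (0 : R).
  rewrite [X in _ --> X](_ : _ = \sum_(j < m) c j 0 * 0); last first.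
    by rewrite big1// => j _; rewrite mulr0.
  apply: cvg_sum => j; apply: cvgM; first exact: cvg_cst.
  exact: (ols_expansion mZs mZ iid iXX uM score0 score2).
apply: whp_cvg_near H; apply: nearW => x.
have -> : root_sum Zs (fun z => dotp c (ols_influence P X c0 l1 z)) x =
    \sum_j c j 0 * root_sum Zs (fun z => ols_influence P X c0 l1 z j 0) x.
  rewrite /root_sum; under eq_bigr do rewrite dotpE.
  rewrite exchange_big /= mulr_sumr; apply: eq_bigr => j _.
  by rewrite -mulr_sumr mulrCA.
rewrite dotpE mulr_sumr -sumrB; apply: eq_bigr => j _.
by rewrite mulrBr mulrCA.
Qed.

Let gradE j : gradient (fun l => lambda3_lim P w X Y l * l j 0) l1 =
  la3 *: basisv R j + l1 j 0 *: grad.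
Proof.
have g := has_gradientM (expansion_gradient exp3) (has_gradient_coord j l1).
by rewrite (has_gradientE g) lambda3_lim_true.
Qed.

(** The estimator of beta is a product of two quantities with known expansions;
    the first stage turns the gradient term into a sum over observations. *)
Lemma product_expansion j : (fun x => rt x * (l3hat x *: lhat x - la3 *: l1) j 0 -
  root_sum Zs (fun z => xi z j 0) x) @ whp P --> (0 : R).
Proof.
have /expansion_remainder := expansionM mZs mZ iid b_delta exp3 (expansion_coord P Zs Z l1 lhat j).
rewrite gradE lambda3_lim_true => H1.
have H2 := dotp_ols (la3 *: basisv R j + l1 j 0 *: grad).
apply: (@whp_cvg_near _ _ _ P _ _ 0 _ (cvgD_to (c := 0 : R) H1 H2 _)); last by rewrite addr0.
apply: nearW => x.
have -> : root_sum Zs (fun z => xi z j 0) x =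
    root_sum Zs (fun z => l1 j 0 * phi3 z + la3 * 0) x +
    root_sum Zs (fun z => dotp (la3 *: basisv R j + l1 j 0 *: grad) (ols_influence P X c0 l1 z)) x.
  rewrite /root_sum -mulrDr -big_split /=; congr (_ * _); apply: eq_bigr => i _.
  by rewrite xi_coord dotpDl !dotpZl dotp_basis; ring.
by rewrite /rt !mxE; ring.
Qed.

Let mols j : measurable_fun setT (fun z => ols_influence P X c0 l1 z j 0).
Proof. exact: measurable_ols_influence. Qed.

Let mgols : measurable_fun setT (fun z => dotp grad (ols_influence P X c0 l1 z)).
Proof.
by under eq_fun do rewrite dotpE; apply: measurable_sum => j; exact: measurable_funM.
Qed.

Let mphi3 : measurable_fun setT phi3.
Proof. exact: (expansion_measurable exp3). Qed.

Lemma measurable_xi j : measurable_fun setT (fun z => xi z j 0).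
Proof.
under eq_fun do rewrite xi_coord.
apply: measurable_funD; first exact: measurable_funM.
by apply: measurable_funD; exact: measurable_funM.
Qed.

Let iols2 j : L1 P (fun t => ols_influence P X c0 l1 (Z t) j 0 ^+ 2).
Proof. exact: (ols_influence_L2 mZ score2). Qed.

Let molsZ j : measurable_fun setT (fun t => ols_influence P X c0 l1 (Z t) j 0).
Proof. exact: (measurableT_comp (mols j) mZ). Qed.

Let mgolsZ : measurable_fun setT (fun t => dotp grad (ols_influence P X c0 l1 (Z t))).
Proof. exact: (measurableT_comp mgols mZ). Qed.

Let mphi3Z : measurable_fun setT (fun t => phi3 (Z t)).
Proof. exact: (measurableT_comp mphi3 mZ). Qed.

Let igols2 : L1 P (fun t => dotp grad (ols_influence P X c0 l1 (Z t)) ^+ 2).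
Proof.
under eq_fun do rewrite dotpE.
by apply: L1_sum_sqr => j; [exact: measurable_funM|exact: L1Z_sqr].
Qed.

Lemma xi_L2 j : L1 P (fun t => xi (Z t) j 0 ^+ 2).
Proof.
under eq_fun do rewrite xi_coord.
apply: (@L1D_sqr _ _ _ P (fun t => l1 j 0 * phi3 (Z t)) (fun t =>
  la3 * ols_influence P X c0 l1 (Z t) j 0 + l1 j 0 * dotp grad (ols_influence P X c0 l1 (Z t)))).
- exact: measurable_funM.
- by apply: measurable_funD; exact: measurable_funM.
- by apply: L1Z_sqr; exact: (expansion_L2 exp3).
apply: (@L1D_sqr _ _ _ P (fun t => la3 * ols_influence P X c0 l1 (Z t) j 0)
  (fun t => l1 j 0 * dotp grad (ols_influence P X c0 l1 (Z t)))).
- exact: measurable_funM.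
- exact: measurable_funM.
- exact: L1Z_sqr.
- exact: L1Z_sqr.
Qed.

Lemma xi_mean0 j : mean P (fun t => xi (Z t) j 0) = 0.
Proof.
have iols k : L1 P (fun t => ols_influence P X c0 l1 (Z t) k 0) by exact: L1_of_sqr.
have igols : L1 P (fun t => dotp grad (ols_influence P X c0 l1 (Z t))) by exact: L1_of_sqr.
have iphi : L1 P (fun t => phi3 (Z t)) := L1_of_sqr mphi3Z (expansion_L2 exp3).
have ols0 k : mean P (fun t => ols_influence P X c0 l1 (Z t) k 0) = 0.
  exact: (ols_influence_mean0 mZ score0 score2).
have gols0 : mean P (fun t => dotp grad (ols_influence P X c0 l1 (Z t))) = 0.
  under eq_mean do rewrite dotpE.
  rewrite mean_sum; last by move=> k _; exact: L1Z.
  by rewrite big1// => k _; rewrite meanZ// ols0 mulr0.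
under eq_mean do rewrite xi_coord.
rewrite meanD; [|exact: L1Z|by apply: L1D; exact: L1Z].
rewrite meanD; [|exact: L1Z|exact: L1Z].
by rewrite !meanZ// (expansion_mean0 exp3) ols0 gols0 !mulr0 !addr0.
Qed.

Section one_observation.
Context (Xi : T -> rvec R m) (Yi : T -> R).
Hypothesis mXi : measurable_fun setT Xi.
Hypothesis mYi : measurable_fun setT Yi.
Hypothesis law_i : same_law P (fun t => (Xi t, Yi t) : S) Z.

Let mZi : measurable_fun setT (fun t => (Xi t, Yi t) : S).
Proof. exact: measurable_fun_pair. Qed.

Let cYi : is_condE P Xi Yi (fun o => regr (Xi o)).
Proof.
exact: (is_condE_same_law mZ mZi law_i measurable_fst measurable_snd mregr cY).
Qed.

Let cYi2 : is_condE P Xi (fun o => Yi o ^+ 2) (fun o => regr2 (Xi o)).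
Proof.
have ms : measurable_fun setT (fun z : S => z.2 ^+ 2) by exact: measurable_funX.
exact: (is_condE_same_law mZ mZi law_i measurable_fst ms mregr2 cY2).
Qed.

Let mtilde : measurable_fun setT (fun x : rvec R m => tilde (x : 'cV_m) : rvec R (1 + m)).
Proof. by apply: measurable_rvec => k; exact: measurable_tilde. Qed.

Let mXti : measurable_fun setT (Xtilde Xi).
Proof. exact: (measurableT_comp mtilde mXi). Qed.

Let cYit : is_condE P (Xtilde Xi) Yi (fun o => regr (Xi o)).
Proof.
pose r (v : rvec R (1 + m)) : rvec R m := dsubmx (v : 'cV[R]_(1 + m)).
apply: (is_condE_embed mXi mtilde (r := r)) => //.
- apply: measurable_rvec => j; under eq_fun do rewrite mxE; exact: measurable_coord.
- by move=> x; rewrite /r /tilde col_mxKd.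
Qed.

(** The terms of the statement use chosen versions of conditional expectations;
    up to null sets they are one explicit function of the observation. *)
Lemma xi_term_ae : {ae P, forall o, xi_term P w X Y l1 la3 Xi Yi o = xi (Xi o, Yi o)}.
Proof.
have E1 := condE_ae mXti cYit; have E2 := condE_ae mXi cYi2.
apply: filterS2 E1 E2 => o e1 e2.
rewrite /xi_term /xi phi3E; congr (_ *m _ + _ *: _).
  by rewrite /eps_term e1.
rewrite /f1_term /f2_term /delta_term e2 /= -/regr2.
have -> : P_w P w X Y l1 (fun e _ => e) = mu 1 0.
  by rewrite /mu /avg; congr (P_w _ _ _ _ _ _); apply/funext => e; apply/funext => y; rewrite expr1 expr0 mulr1.
have -> : P_w P w X Y l1 (fun e _ => e ^+ 2) = mu 2 0 => //.
by rewrite /mu /avg; congr (P_w _ _ _ _ _ _); apply/funext => e; apply/funext => y; rewrite expr0 mulr1.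
Qed.

Lemma measurable_xi_term j : measurable_fun setT (fun o => xi_term P w X Y l1 la3 Xi Yi o j 0).
Proof.
have mc1 : measurable_fun setT (condE P (Xtilde Xi) Yi) := condE_measurable mXti (condEP cYit).
have mc2 := condE_measurable mXi (condEP cYi2).
have meps : measurable_mx (eps_term P X Xi Yi).
  apply: measurable_mx_mul; first exact: measurable_mx_cst.
  move=> k l; rewrite (ord1 l); under eq_fun do rewrite mxE; apply: measurable_funM.
    exact: measurable_funB.
  exact: (measurableT_comp (measurable_coord k) mXti).
have md : measurable_fun setT (delta_term P Xi Yi).
  by apply: measurable_funB => //; exact: measurable_sqr.
have me : measurable_fun setT (fun o => dotp l1 (Xi o)) := measurableT_comp (mdot l1) mXi.
rewrite /xi_term; under eq_fun do rewrite mxE.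
apply: measurable_funD; first exact: (measurable_mx_mul (measurable_mx_cst _) meps).
under eq_fun do rewrite mxE; apply: measurable_funM => //.
apply: measurable_funM; first by apply: measurable_funM => //; exact: (measurableT_comp mw me).
apply: measurable_funB; apply: measurable_funM => //; apply: measurable_funM => //.
  by apply: measurable_funB => //; exact: measurable_funX.
exact: measurable_funB.
Qed.

End one_observation.

Let bhat n o := beta_hat w n (fun i => Xs i o : 'cV_m) (fun i => Ys i o).
Let err n o := Num.sqrt n%:R *: (bhat n o - la3 *: l1).

Let mlhat n j : measurable_fun setT (fun o => lhat (n, o) j 0).
Proof. exact: measurable_ols. Qed.

Let mavg n j k : measurable_fun setT
  (fun o => avg (Pn_w w n (fun i => Xs i o : 'cV_m) (fun i => Ys i o) (lhat (n, o))) j k).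
Proof.
have me i : measurable_fun setT (fun o => dotp (lhat (n, o)) (Xs i o)).
  under eq_fun do rewrite dotpE; apply: measurable_sum => l.
  by apply: measurable_funM => //; exact: (measurableT_comp (measurable_coord l) (mXs i)).
have mwe i : measurable_fun setT (fun o => w (dotp (lhat (n, o)) (Xs i o))).
  exact: (measurableT_comp mw (me i)).
apply: measurable_funM; last first.
  by apply: measurable_funinv; apply: measurable_sum => i; exact: mwe.
apply: measurable_sum => i; apply: measurable_funM; last exact: mwe.
by apply: measurable_funM; apply: measurable_funX.
Qed.

Let ml3hat n : measurable_fun setT (fun o => l3hat (n, o)).
Proof.
rewrite /l3hat /lambda3_hat /lambda3_of /g3 /a1 /a2 /a3 /b1 /b2.
have m2 := measurable_sqr; have mB := measurable_funB; have mM := measurable_funM.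
have ma1 := mB _ _ _ _ _ _ (mavg n 4 0) (m2 _ _ _ _ (mavg n 2 0)).
have ma2 := mB _ _ _ _ _ _ (mavg n 3 0) (mM _ _ _ _ _ _ (mavg n 1 0) (mavg n 2 0)).
have ma3 := mB _ _ _ _ _ _ (mavg n 2 0) (m2 _ _ _ _ (mavg n 1 0)).
have mb1 := mB _ _ _ _ _ _ (mavg n 1 2) (mM _ _ _ _ _ _ (mavg n 1 0) (mavg n 0 2)).
have mb2 := mB _ _ _ _ _ _ (mavg n 2 2) (mM _ _ _ _ _ _ (mavg n 2 0) (mavg n 0 2)).
apply: measurable_funM.
  by apply: measurable_funB; apply: measurable_funM.
apply: measurable_funinv; apply: measurable_funB; first exact: measurable_funM.
exact: measurable_sqr.
Qed.

Let mbhat_coord n j : measurable_fun setT (fun o => bhat n o j 0).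
Proof.
rewrite (_ : (fun o => _) = fun o => l3hat (n, o) * lhat (n, o) j 0).
  exact: measurable_funM.
by apply/funext => o; rewrite /bhat /beta_hat mxE.
Qed.

Let mbhat n : measurable_fun setT (bhat n : T -> rvec R m).
Proof. by apply: measurable_rvec => j; exact: mbhat_coord. Qed.

Let merr_coord n j : measurable_fun setT (fun o => err n o j 0).
Proof.
rewrite (_ : (fun o => _) = fun o => Num.sqrt n%:R * (bhat n o j 0 - la3 * l1 j 0)).
  by apply: measurable_funM => //; exact: measurable_funB.
by apply/funext => o; rewrite /err; move: (bhat n o) => u; rewrite !mxE.
Qed.

Let merr n : measurable_fun setT (err n : T -> rvec R m).
Proof. by apply: measurable_rvec => j; exact: merr_coord. Qed.

Lemma beta_hat_consistent : cvg_in_prob P bhat (la3 *: l1).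
Proof.
apply: (whp_cvg_in_prob mbhat); apply: cvg_vec => j.
have H := expansion_cvg mZs mZ iid b_delta
  (expansionM mZs mZ iid b_delta exp3 (expansion_coord P Zs Z l1 lhat j)).
rewrite lambda3_lim_true in H; rewrite mxE.
rewrite (_ : (fun x => _) = fun x => l3hat x * lhat x j 0)//.
by apply/funext => -[n o]; rewrite /bhat /beta_hat mxE.
Qed.

Let err_expansion j : (fun x => err x.1 x.2 j 0 - root_sum Zs (fun z => xi z j 0) x)
  @ whp P --> (0 : R).
Proof.
have := @product_expansion j.
rewrite (_ : (fun x => rt x * _ - _) =
  fun x => err x.1 x.2 j 0 - root_sum Zs (fun z => xi z j 0) x)//.
by apply/funext => -[n o]; rewrite /err /bhat /beta_hat [in RHS]mxE.
Qed.

Let iid_law i : same_law P (fun t => (Xs i t, Ys i t) : S) Z.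
Proof. exact: (iid_same_law iid i). Qed.

Let Z_law : same_law P (fun t => (X t, Y t) : S) Z.
Proof. by []. Qed.

Let xi_term_Z := xi_term_ae mX mY Z_law.

Let mxi_term := measurable_xi_term mX mY Z_law.

Let mxiZ j : measurable_fun setT (fun t => xi (Z t) j 0).
Proof. exact: (measurableT_comp (measurable_xi j) mZ). Qed.

Lemma covmx_xi : covmx P (xi_term P w X Y l1 la3 X Y) =
  \matrix_(j, k) mean P (fun t => xi (Z t) j 0 * xi (Z t) k 0).
Proof.
have mean0 j : mean P (fun o => xi_term P w X Y l1 la3 X Y o j 0) = 0.
  rewrite -(xi_mean0 j); apply: ae_mean => //.
  by apply: filterS xi_term_Z => o ->.
apply/matrixP => j k; rewrite !mxE covariance.unlock -!/(mean P _) !mean0.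
apply: ae_mean.
- by apply: measurable_funM; apply: measurable_funB.
- exact: measurable_funM.
- by apply: filterS xi_term_Z => o /= e; rewrite -[LHS]/((_ - 0) * (_ - 0)) !subr0 e.
Qed.

Lemma beta_hat_normal :
  asymptotically_normal P err (covmx P (xi_term P w X Y l1 la3 X Y)).
Proof.
rewrite covmx_xi.
apply: (vector_clt mZs mZ iid measurable_xi xi_mean0 xi_L2 merr) => j.
under eq_fun do rewrite [X in _ - X]mxE.
exact: err_expansion.
Qed.

Lemma beta_hat_expansion : oP1 P (fun n o => err n o -
  (Num.sqrt n%:R)^-1 *: \sum_(i < n) xi_term P w X Y l1 la3 (Xs i) (Ys i) o).
Proof.
have mxi_i i j : measurable_fun setT (fun o => xi_term P w X Y l1 la3 (Xs i) (Ys i) o j 0).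
  exact: (measurable_xi_term (mXs i) (mYs i) (@iid_law i)).
apply: whp_cvg_in_prob => [n|].
  apply: measurable_rvec => j.
  rewrite (_ : (fun o => _) = fun o => err n o j 0 - (Num.sqrt n%:R)^-1 *
      \sum_(i < n) xi_term P w X Y l1 la3 (Xs i) (Ys i) o j 0); last first.
    by apply/funext => o; rewrite -summxE; move: (err n o) (\sum_(i < n) _) => u v; rewrite !mxE.
  apply: measurable_funB; first exact: merr_coord.
  by apply: measurable_funM => //; apply: measurable_sum => i; exact: mxi_i.
apply: cvg_vec => j; rewrite mxE.
have ae_i i := xi_term_ae (mXs i) (mYs i) (@iid_law i).
have ae_all : {ae P, forall o, forall i, xi_term P w X Y l1 la3 (Xs i) (Ys i) o = xi (Zs i o)}.
  exact: ae_foralln ae_i.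
have near_all := @whp_ae _ _ _ P (fun n o => forall i, xi_term P w X Y l1 la3 (Xs i) (Ys i) o = xi (Zs i o))
  (fun=> ae_all).
apply: (whp_cvg_near _ (@err_expansion j)); apply: (filterS _ near_all) => -[n o] /= H.
rewrite !mxE summxE /root_sum /=; congr (_ - _ * _).
by apply: eq_bigr => i _; rewrite H.
Qed.

End estimator.

Theorem mainTheorem2 (R : realType) (d : measure_display)
  (T : measurableType d) (P : probability T R) (m : nat)
  (* generic observation, with its latent variables *)
  (X : {RV P >-> rvec R m}) (Y1 Y2 Y : {RV P >-> R}) (B : {RV P >-> bool})
  (* data *)
  (Xs : nat -> {RV P >-> rvec R m}) (Ys : nat -> {RV P >-> R})
  (w : R -> R) (p mu1 mu2 sigma1 sigma2 : R) (beta : 'cV[R]_m) :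
  let lambda1 := p *: beta in
  let lambda3 := p^-1 in
  (* model *)
  0 < p < 1 ->
  P (B @^-1` [set true]) = p%:E ->
  (forall o, Y o = (B o)%:R * Y1 o + (1 - (B o)%:R) * Y2 o) ->
  indep P Y1 Y2 ->
  indep P B (fun o => (X o, Y1 o, Y2 o)) ->
  indep P Y2 X ->
  is_condE P X Y1 (fun o => mu1 + dotp beta (X o)) ->
  is_condV P X Y1 (cst (sigma1 ^+ 2)) ->
  ('E_P[Y2] = mu2%:E)%E ->
  ('V_P[Y2] = (sigma2 ^+ 2)%:E)%E ->
  iid_copies P (fun i o => (Xs i o, Ys i o)) (fun o => (X o, Y o)) ->
  (* weight function *)
  (forall t, 0 <= w t) ->
  (forall t, derivable w t 1) ->
  (forall t, derivable (derive1 w) t 1) ->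
  continuous (derive1n 2 w) ->
  locally_dominated P X Y lambda1 (fun eta _ => w eta) ->
  (* moment conditions *)
  (forall jk, jk \in moment_exponents ->
     locally_dominated P X Y lambda1
       (fun eta y => eta ^+ jk.1 * y ^+ jk.2 * w eta)) ->
  (forall jk, jk \in (0%N, 0%N) :: moment_exponents ->
     P.-integrable setT (fun o => ((dotp lambda1 (X o) ^+ jk.1 * Y o ^+ jk.2
                                    * w (dotp lambda1 (X o))) ^+ 2)%:E)) ->
  (forall j k, P.-integrable setT
     (fun o => ((Xtilde X o : 'cV_(1 + m)) j 0 *
                (Xtilde X o : 'cV_(1 + m)) k 0)%:E)) ->
  second_moment P X \in unitmx ->
  P.-integrable setT
    (fun o => let v := (Y o - condE P X Y o) *: (Xtilde X o : 'cV_(1 + m)) in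
              (dotp v v)%:E) ->
  0 < Pw P w X lambda1 ->
  g3 (P_w P w X Y lambda1) != 0 ->
  let bhat := fun n o => beta_hat w n (fun i => Xs i o) (fun i => Ys i o) in
  let root_n_err := fun n o => Num.sqrt n%:R *: (bhat n o - beta) in
  let xi := xi_term P w X Y lambda1 lambda3 in
  [/\ cvg_in_prob P bhat beta,
      asymptotically_normal P root_n_err (covmx P (xi X Y)),
      differentiable (lambda3_lim P w X Y) lambda1 &
      oP1 P (fun n o => root_n_err n o
               - (Num.sqrt n%:R)^-1 *: \sum_(i < n) xi (Xs i) (Ys i) o)].
Proof.
move=> l1 la3 p01 PB YE _ BXY Y2X cY1 vY1 EY2 VY2 iid w0 dw dw1 cw2 domw dom sqr iXX uM eps2 Pw0 g0.
have p0 : p != 0 by case/andP: p01 => /lt0r_neq0.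
have mX : measurable_fun setT X by [].
have mXs i : measurable_fun setT (Xs i) by [].
have mYs i : measurable_fun setT (Ys i) by [].
have cY : is_condE P X Y (fun o => p * mu1 + (1 - p) * mu2 + dotp l1 (X o)).
  have := mixture_condE mX (measurable_funPT Y1) (measurable_funPT Y2) (measurable_funPT B)
    PB YE BXY Y2X cY1 EY2 VY2 iXX.
  congr (is_condE P X Y _); apply/funext => o.
  by rewrite /mixture_mean /l1 dotpZl; ring.
have cY2 := mixture_condE_sqr mX (measurable_funPT Y1) (measurable_funPT Y2) (measurable_funPT B)
    p01 PB YE BXY Y2X cY1 vY1 EY2 VY2 iXX.
have betaE : beta = la3 *: l1 by rewrite /l1 /la3 scalerA mulVf// scale1r.
move=> bhat root_n_err xi; rewrite /root_n_err /bhat /xi betaE; split.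
- exact: (beta_hat_consistent mX (measurable_funPT Y) mXs mYs iid cY cY2 dw dw1 cw2 domw dom sqr iXX uM eps2 Pw0 g0).
- exact: (beta_hat_normal mX (measurable_funPT Y) mXs mYs iid cY cY2 dw dw1 cw2 domw dom sqr iXX uM eps2 Pw0 g0).
- exact: (differentiable_lambda3_lim mX (measurable_funPT Y) mXs mYs iid cY cY2 dw dw1 cw2 domw dom sqr iXX uM eps2 Pw0 g0).
- exact: (beta_hat_expansion mX (measurable_funPT Y) mXs mYs iid cY cY2 dw dw1 cw2 domw dom sqr iXX uM eps2 Pw0 g0).
Qed.
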